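(* Let $u:\mathbb{R}\times\mathbb{T}^2\to\mathbb{C}$ be an $H^1$ solution of $$-iu_t+\Delta u=|u|^2u$$ which scatters modulo phases in $H^1$, in the sense that there exist $u_+\in H^1(\mathbb{T}^2)$ and a function $\theta:\mathbb{R}\to\mathbb{R}/2\pi\mathbb{Z}$ such that $$\big\|u(t)-e^{i\theta(t)}e^{-it\Delta}u_+\big\|_{H^1(\mathbb{T}^2)}\to 0\qquad\text{as } t\to+\infty.$$ Then $u$ is of the form $$u(t,x)=A\,e^{i\kappa}e^{in\cdot x}e^{i|n|^2t}e^{i|A|^2t}$$ for some $A\ge 0$, $\kappa\in\mathbb{R}/2\pi\mathbb{Z}$, $n\in\mathbb{Z}^2$.
   Context: $\mathbb{T}^2=\mathbb{R}^2/(2\pi\mathbb{Z})^2$. An $H^1$ solution is a global solution continuous in time with values in $H^1(\mathbb{T}^2)$. The operator $e^{-it\Delta}$ is the free propagator for $-iu_t+\Delta u=0$, i.e. the Fourier multiplier $\widehat{e^{-it\Delta}f}(n)=e^{it|n|^2}\hat f(n)$. *)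

(* Defs.v *)
From mathcomp Require Import all_boot all_order all_algebra.
From mathcomp Require Import complex.
From mathcomp Require Import all_classical all_reals all_analysis.

Set Implicit Arguments.
Unset Strict Implicit.
Unset Printing Implicit Defensive.

Import Order.TTheory GRing.Theory Num.Theory.
Import numFieldNormedType.Exports.

Local Open Scope classical_set_scope.
Local Open Scope ring_scope.

(* A function on T^2 = R^2 / (2 pi Z)^2 is a function R * R -> R[i] that is
   2 pi-periodic in each variable.  A distribution on T^2 is given by its
   Fourier coefficients, i.e. by a family int * int -> R[i]. *)

Section Torus.
Context {R : realType}.
Implicit Types (f : R * R -> R[i]) (a : int * int -> R[i]) (n : int * int).

Definition cis (y : R) : R[i] := Complex (cos y) (sin y).

Definition modulus (z : R[i]) : R := ComplexField.Normc.normc z.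

Definition freq2 n : R := (n.1 ^+ 2 + n.2 ^+ 2)%:~R.

Definition dotp n (x : R * R) : R := n.1%:~R * x.1 + n.2%:~R * x.2.

Definition lebesgue2 :
    {measure set (measurableTypeR R * measurableTypeR R) -> \bar R} :=
  (@lebesgue_measure R \x @lebesgue_measure R)%E.

Definition fundamental_square : set (R * R) :=
  `[0, 2 * pi[%classic `*` `[0, 2 * pi[%classic.

Definition periodic2 f : Prop :=
  forall x1 x2, f (x1 + 2 * pi, x2) = f (x1, x2) /\
                f (x1, x2 + 2 * pi) = f (x1, x2).

Definition torus_integral f : R[i] :=
  Complex (Rintegral lebesgue2 fundamental_square (fun x => complex.Re (f x)))
          (Rintegral lebesgue2 fundamental_square (fun x => complex.Im (f x))).

(* Only meaningful when f is integrable over the square.  This is the case for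
   every f in H^1 and, by Sobolev embedding, for |f|^2 f with f in H^1. *)
Definition fourier f n : R[i] :=
  (((2 * pi) ^+ 2)^-1)%:C%C * torus_integral (fun x => cis (- dotp n x) * f x).

Definition inL2 f : Prop :=
  [/\ periodic2 f,
      measurable_fun [set: measurableTypeR R * measurableTypeR R]
        (fun x => complex.Re (f x)),
      measurable_fun [set: measurableTypeR R * measurableTypeR R]
        (fun x => complex.Im (f x)) &
      (\int[lebesgue2]_(x in fundamental_square) (modulus (f x) ^+ 2)%:E
        < +oo)%E].

(* ( \sum_n (1 + |n|^2)^s |a n|^2 )^(1/2), possibly +oo *)
Definition sobolev_norm (s : int) a : \bar R :=
  poweR (\esum_(n in [set: int * int])
           ((1 + freq2 n) ^ s * modulus (a n) ^+ 2)%:E) 2^-1.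

Definition inH1 f : Prop := inL2 f /\ (sobolev_norm 1 (fourier f) < +oo)%E.

Definition laplacian a : int * int -> R[i] :=
  fun n => - (freq2 n)%:C%C * a n.

(* e^{- i t Delta} *)
Definition free_propagator (t : R) a : int * int -> R[i] :=
  fun n => cis (t * freq2 n) * a n.

Definition cubic f : R * R -> R[i] :=
  fun x => (modulus (f x) ^+ 2)%:C%C * f x.

Definition is_sobolev_derive (s : int) (v : R -> int * int -> R[i]) (t : R)
    (dv : int * int -> R[i]) : Prop :=
  sobolev_norm s (fun n => (h^-1)%:C%C * (v (t + h) n - v t n) - dv n)
    @[h --> 0^'] --> 0%E.

Definition continuous_in_H1 (u : R -> R * R -> R[i]) : Prop :=
  (forall t, inH1 (u t)) /\
  forall t0, sobolev_norm 1 (fun n => fourier (u t) n - fourier (u t0) n)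
               @[t --> t0] --> 0%E.

(* The time derivative u_t exists in H^{-1} at every time, and
   - i u_t + Delta u = |u|^2 u holds as an identity of distributions on T^2. *)
Definition H1_solution (u : R -> R * R -> R[i]) : Prop :=
  continuous_in_H1 u /\
  forall t, exists ut : int * int -> R[i],
    is_sobolev_derive (-1) (fun s => fourier (u s)) t ut /\
    forall n, - 'i%C * ut n + laplacian (fourier (u t)) n
              = fourier (cubic (u t)) n.

(* theta is a real-valued lift of the phase in R / 2 pi Z; no regularity of
   theta is assumed. *)
Definition scatters_modulo_phases (u : R -> R * R -> R[i]) : Prop :=
  exists (uplus : R * R -> R[i]) (theta : R -> R),
    inH1 uplus /\
    sobolev_norm 1 (fun n => fourier (u t) n
                      - cis (theta t) * free_propagator t (fourier uplus) n)
      @[t --> +oo] --> 0%E.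

End Torus.

(* Main.v *)
From HB Require Import structures.
Require Import Defs.
From mathcomp Require Import all_boot all_order all_algebra.
From mathcomp Require Import complex.
From mathcomp Require Import all_classical all_reals all_analysis.
From mathcomp Require Import measurable_realfun.
From mathcomp Require Import ring lra zify.

(** The proof works with the Fourier coefficients [v t n] of the solution.  In
    them [|u|^2 u] becomes the cubic convolution [cub (v t)], absolutely
    convergent for [H^1] data in two dimensions ([trilinear_bound],
    [fourier_cubic]), so that each coefficient solves
    [v_n' = i (cub v n + |n|^2 v_n)].

    The asymptotic state.  Let [w] be the free solution to which [v] is
    asymptotic.  The products
    [v_n * conj v_m * exp (- i t (|n|^2 - |m|^2))] do not see the unknown phase;
    they converge, and their derivatives are asymptotically [2 pi]-periodic,
    because the frequencies are integers.  The derivative of a convergent function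
    can only be asymptotically periodic if it tends to zero
    ([asymptotically_periodic_derivative]).  At every time this leaves
    [cub w n * conj (w m) = w n * conj (cub w m)] ([asymptotic_exchange]), hence
    [|w|^2 w = c w] with a real factor [c], nonzero unless [w] vanishes.  A
    function in [H^1] with this property has constant modulus: on the Fourier side,
    moving a linear weight through the symmetric quartic form shows that the
    autocorrelation vanishes at nonzero frequencies ([corr_rigid], [corr_delta]).
    The current [conj w grad w] is then curl-free, as the modulus is constant in
    space, and divergence-free, as it is constant in time; on the torus it is
    constant, and [w] is a single exponential with frequency [n0]
    ([single_mode], [free_single_mode]).

    Rigidity.  The quantity
    [1/2 \sum |n - n0|^2 |v n|^2 + 1/4 \sum |corr v k|^2], a combination of energy,
    momentum and mass, is at least a quarter of the squared mass, with equality only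
    for functions with the single frequency [n0].  It is conserved, so is the mass,
    and the asymptotic state attains the minimum; hence [v] lives on the frequency
    [n0] at all times ([asymptotic_rigidity]), where the equation is an explicit
    linear one ([single_mode_solution]).

    Conservation of energy is the delicate point, for a solution that is merely
    continuous in time with values in [H^1]: the product of [grad u] with
    [grad (|u|^2 u)] exceeds the control of the [H^1] norm by a logarithm.  The
    energies of the truncations to boxes of radius [r] are differentiable.  Their
    derivatives need not be small for each [r], but their averages are, with the
    weights [1 / (r + 1)] for [r < N]: these have the divergent total mass [harm N],
    and the averaged derivatives are bounded by the tails of [v] times [harm N],
    which absorbs the logarithm ([energy_flux], [flux_average], [conservation]).

    Finally, Fourier coefficients determine an integrable function almost everywhere
    on a period ([fourier_ae0]), and a periodic function on the plane
    ([ae_periodic]). *)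

Set Implicit Arguments.
Unset Strict Implicit.
Unset Printing Implicit Defensive.

Import Order.TTheory GRing.Theory Num.Theory.
Import numFieldNormedType.Exports.

Local Open Scope classical_set_scope.
Local Open Scope ring_scope.

(** * Sums of families of complex numbers *)

Section Sums.
Context {R : realType}.

(** A common bound of the finite subsums of a nonnegative family says at once
    that the family is summable and how large its sum is, without extended
    reals; almost all estimates below have this form. *)
Definition sumle {T : choiceType} (f : T -> R) (A : R) :=
  forall s : seq T, uniq s -> \sum_(i <- s) f i <= A.

Definition nsum {T : choiceType} (f : T -> R) : R :=
  fine (\esum_(i in [set: T]) (f i)%:E).

Section Basic.
Context {T : choiceType}.
Implicit Types (f g : T -> R) (A B : R).

Lemma sumle_esum f A : sumle f A <-> (\esum_(i in [set: T]) (f i)%:E <= A%:E)%E.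
Proof.
split=> [h|h s us].
  apply: ge_ereal_sup => _ /= [X [finX _] <-].
  rewrite fsbig_finite//= sumEFin lee_fin; apply: h; exact: finmap.fset_uniq.
rewrite -lee_fin; apply: le_trans h; apply: esum_ge.
exists [set` s]; first by split.
by rewrite -fsbig_seq// sumEFin.
Qed.

Lemma sumle_ge0 f A : sumle f A -> 0 <= A.
Proof. by move=> h; have := h [::] isT; rewrite big_nil. Qed.

Lemma sumle_term f A i : sumle f A -> f i <= A.
Proof. by move=> h; have := h [:: i] isT; rewrite big_seq1. Qed.

Lemma sumle_weak f A B : A <= B -> sumle f A -> sumle f B.
Proof. by move=> AB h s us; apply: le_trans (h s us) AB. Qed.

Lemma sumle_le f g A : (forall i, f i <= g i) -> sumle g A -> sumle f A.
Proof. by move=> fg h s us; apply: le_trans (h s us); apply: ler_sum. Qed.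

Lemma sumleD f g A B : sumle f A -> sumle g B -> sumle (fun i => f i + g i) (A + B).
Proof. by move=> fA gB s us; rewrite big_split/= lerD ?fA ?gB. Qed.

Lemma sumleZ k f A : 0 <= k -> sumle f A -> sumle (fun i => k * f i) (k * A).
Proof. by move=> k0 fA s us; rewrite -mulr_sumr ler_wpM2l ?fA. Qed.

Lemma sumle0 : sumle (fun _ : T => 0) 0.
Proof. by move=> s _; rewrite big1. Qed.

(** Each term obeys the arithmetic-geometric inequality with weights in the ratio
    of the two bounds, for which both halves contribute equally. *)
Lemma sumle_cauchy_schwarz f g A B :
  sumle (fun i => f i ^+ 2) A -> sumle (fun i => g i ^+ 2) B ->
  sumle (fun i => f i * g i) (Num.sqrt A * Num.sqrt B).
Proof.
move=> fA gB s us.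
have A0 := sumle_ge0 fA; have B0 := sumle_ge0 gB.
have [/eqP a0|a0] := boolP (A == 0).
  rewrite big1 ?mulr_ge0 ?sqrtr_ge0// => i _.
  have := sumle_term i fA; rewrite a0 => h.
  have : f i ^+ 2 == 0 by rewrite eq_le h sqr_ge0.
  by rewrite sqrf_eq0 => /eqP ->; rewrite mul0r.
have [/eqP b0|b0] := boolP (B == 0).
  rewrite big1 ?mulr_ge0 ?sqrtr_ge0// => i _.
  have := sumle_term i gB; rewrite b0 => h.
  have : g i ^+ 2 == 0 by rewrite eq_le h sqr_ge0.
  by rewrite sqrf_eq0 => /eqP ->; rewrite mulr0.
have sa : 0 < Num.sqrt A by rewrite sqrtr_gt0 lt_neqAle eq_sym a0.
have sb : 0 < Num.sqrt B by rewrite sqrtr_gt0 lt_neqAle eq_sym b0.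
set a := Num.sqrt A in sa *; set b := Num.sqrt B in sb *.
have aA : A = a ^+ 2 by rewrite sqr_sqrtr.
have bB : B = b ^+ 2 by rewrite sqr_sqrtr.
have pt i : f i * g i <= (b / (2 * a)) * f i ^+ 2 + (a / (2 * b)) * g i ^+ 2.
  have : 0 <= (b * f i - a * g i) ^+ 2 / (2 * a * b).
    by rewrite divr_ge0 ?sqr_ge0// !mulr_ge0 ?ltW.
  suff -> : (b * f i - a * g i) ^+ 2 / (2 * a * b) =
    (b / (2 * a)) * f i ^+ 2 + (a / (2 * b)) * g i ^+ 2 - f i * g i by rewrite subr_ge0.
  by field; rewrite !gt_eqF.
apply: le_trans (_ : \sum_(i <- s) ((b / (2 * a)) * f i ^+ 2 + (a / (2 * b)) * g i ^+ 2) <= _).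
  exact: ler_sum.
rewrite big_split/= -!mulr_sumr.
apply: le_trans (_ : (b / (2 * a)) * A + (a / (2 * b)) * B <= _).
  apply: lerD; apply: ler_wpM2l; [|exact: fA| |exact: gB];
    by rewrite divr_ge0 ?mulr_ge0 ?ltW.
by rewrite aA bB le_eqVlt; apply/orP; left; apply/eqP; field; rewrite !gt_eqF.
Qed.

Lemma esum_nsum f A : (forall i, 0 <= f i) -> sumle f A ->
  (\esum_(i in [set: T]) (f i)%:E = (nsum f)%:E)%E.
Proof.
move=> f0 /sumle_esum h; rewrite /nsum fineK// ge0_fin_numE.
  by apply: le_lt_trans h _; rewrite ltry.
by apply: esum_ge0 => x _; rewrite lee_fin.
Qed.

Lemma nsum_ge0 f : (forall i, 0 <= f i) -> 0 <= nsum f.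
Proof. by move=> f0; rewrite /nsum fine_ge0// esum_ge0// => x _; rewrite lee_fin. Qed.

Lemma sumle_nsum f A : (forall i, 0 <= f i) -> sumle f A -> sumle f (nsum f).
Proof. by move=> f0 fA; apply/sumle_esum; rewrite (esum_nsum f0 fA). Qed.

Lemma nsum_le f A : (forall i, 0 <= f i) -> sumle f A -> nsum f <= A.
Proof. by move=> f0 fA; rewrite -lee_fin -(esum_nsum f0 fA); exact/sumle_esum. Qed.

Lemma nsumD f g A B : (forall i, 0 <= f i) -> (forall i, 0 <= g i) ->
  sumle f A -> sumle g B -> nsum (fun i => f i + g i) = nsum f + nsum g.
Proof.
move=> f0 g0 fA gB; apply: EFin_inj; rewrite EFinD.
rewrite -(esum_nsum f0 fA) -(esum_nsum g0 gB) -(esum_nsum (A := A + B)) //.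
- by rewrite -esumD// => x _; rewrite lee_fin.
- by move=> i; rewrite addr_ge0.
- exact: sumleD.
Qed.

Lemma nsumZ k f A : 0 <= k -> (forall i, 0 <= f i) -> sumle f A ->
  nsum (fun i => k * f i) = k * nsum f.
Proof.
move=> k0 f0 fA; apply/eqP; rewrite eq_le; apply/andP; split.
  by apply: nsum_le; [move=> i; rewrite mulr_ge0|apply: sumleZ => //; exact: sumle_nsum fA].
have [k1|k1] := eqVneq k 0.
  by rewrite k1 mul0r; apply: nsum_ge0 => i; rewrite mul0r.
have {k1}k0 : 0 < k by rewrite lt_neqAle eq_sym k1.
rewrite -ler_pdivlMl//; apply: nsum_le => //.
have := sumleZ (ltW k0) fA => /(sumle_nsum _).
move=> /(_ (fun i => mulr_ge0 (ltW k0) (f0 i))) h.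
have := @sumleZ k^-1 _ _ _ h; rewrite invr_ge0 ltW// => /(_ isT).
by apply: sumle_le => i; rewrite mulKf// gt_eqF.
Qed.

Lemma sumle_seq f (s : seq T) : uniq s -> (forall i, 0 <= f i) ->
  (forall i, i \notin s -> f i = 0) -> sumle f (\sum_(i <- s) f i).
Proof.
move=> us f0 fs r ur.
rewrite (bigID (mem s))/= [X in _ + X]big1 ?addr0; last by move=> i; exact: fs.
rewrite -big_filter.
have -> : \sum_(i <- [seq i <- r | i \in s]) f i = \sum_(i <- s | i \in r) f i.
  rewrite -[RHS]big_filter; apply: perm_big; apply: uniq_perm; rewrite ?filter_uniq//.
  by move=> x; rewrite !mem_filter andbC.
rewrite [leRHS](bigID (mem r))/= lerDl; exact: sumr_ge0.
Qed.

Lemma nsum_seq f (s : seq T) : uniq s -> (forall i, 0 <= f i) ->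
  (forall i, i \notin s -> f i = 0) -> nsum f = \sum_(i <- s) f i.
Proof.
move=> us f0 fs; have h := sumle_seq us f0 fs.
by apply/eqP; rewrite eq_le (nsum_le f0 h)/=; apply: (sumle_nsum f0 h).
Qed.

End Basic.

Lemma sumle_inj {T T' : choiceType} (e : T' -> T) (f : T -> R) A :
  injective e -> sumle f A -> sumle (f \o e) A.
Proof.
move=> ie fA s us; have := fA (map e s); rewrite map_inj_uniq// => /(_ us).
by rewrite big_map.
Qed.

Lemma eq_nsum {T : choiceType} (f g : T -> R) : f =1 g -> nsum f = nsum g.
Proof. by move=> /funext ->. Qed.

Lemma nsum_bij {T T' : choiceType} (e : T' -> T) (f : T -> R) :
  bijective e -> nsum (f \o e) = nsum f.
Proof.
move=> be; rewrite /nsum [in RHS](reindex_esum [set: T'] _ e)//.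
by have := (setTT_bijective e); move=> ->.
Qed.

(** Tonelli's theorem: from a double family to its rows here, from the rows to
    the double family in [sumle_pair]. *)
Lemma nsum_pair {T T' : choiceType} (F : T -> T' -> R) A :
  (forall i j, 0 <= F i j) -> sumle (fun p => F p.1 p.2) A ->
  [/\ forall i, sumle (F i) (nsum (F i)), sumle (fun i => nsum (F i)) A &
      nsum (fun p => F p.1 p.2) = nsum (fun i => nsum (F i))].
Proof.
move=> F0 FA.
have row i : sumle (F i) (nsum (F i)).
  apply: (sumle_nsum (A := A)) => //.
  by have := sumle_inj (e := fun j => (i, j)) _ FA; apply => x y [].
have E : (\esum_(k in [set: T * T']) (F k.1 k.2)%:E =
          \esum_(i in [set: T]) (nsum (F i))%:E)%E.
  have := esum_esum (I := [set: T]) (J := fun _ => [set: T'])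
    (a := fun i j => (F i j)%:E) (fun i j _ _ => F0 i j).
  have -> : [set: T] `*`` (fun=> [set: T']) = [set: T * T'].
    by apply/seteqP; split.
  move=> <-; apply: eq_esum => i _; exact: esum_nsum (row i).
split => //; first by apply/sumle_esum; rewrite -E; exact/sumle_esum.
by rewrite /nsum E.
Qed.

Lemma sumle_pair {T T' : choiceType} (F : T -> T' -> R) (g : T -> R) A :
  (forall i j, 0 <= F i j) ->
  (forall i, sumle (F i) (g i)) -> sumle g A -> sumle (fun p => F p.1 p.2) A.
Proof.
move=> F0 Fg gA; apply/sumle_esum.
have := esum_esum (I := [set: T]) (J := fun _ => [set: T'])
  (a := fun i j => (F i j)%:E) (fun i j _ _ => F0 i j).
have -> : [set: T] `*`` (fun=> [set: T']) = [set: T * T'].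
  by apply/seteqP; split.
move=> <-; apply: le_trans (_ : (\esum_(i in [set: T]) (g i)%:E <= _)%E).
  by apply: le_esum => i _; exact/sumle_esum.
exact/sumle_esum.
Qed.

Definition rsum {T : choiceType} (f : T -> R) : R :=
  nsum (fun i => Num.max (f i) 0) - nsum (fun i => Num.max (- f i) 0).

Section RealSums.
Context {T : choiceType}.
Implicit Types (f g p q : T -> R) (A B : R).

Lemma rsum_diff p q A B : (forall i, 0 <= p i) -> (forall i, 0 <= q i) ->
  sumle p A -> sumle q B -> rsum (fun i => p i - q i) = nsum p - nsum q.
Proof.
move=> p0 q0 pA qB.
have M0 f i : 0 <= Num.max (f i) 0 by rewrite le_max lexx orbT.
have l1 : sumle (fun i => Num.max (p i - q i) 0) A.
  by apply: sumle_le pA => i; rewrite ge_max p0 andbT gerBl.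
have l2 : sumle (fun i => Num.max (- (p i - q i)) 0) B.
  by apply: sumle_le qB => i; rewrite ge_max q0 andbT opprB gerBl.
have E : nsum (fun i => Num.max (p i - q i) 0 + q i) =
         nsum (fun i => Num.max (- (p i - q i)) 0 + p i).
  by apply: eq_nsum => i; rewrite !maxEle; do 2 case: ifP => //; lra.
move: E; rewrite (nsumD (M0 (fun i => p i - q i)) q0 l1 qB).
rewrite (nsumD (M0 (fun i => - (p i - q i))) p0 l2 pA) /rsum => E.
by apply/eqP; rewrite subr_eq addrAC eq_sym subr_eq E addrC.
Qed.

Lemma rsum_ge0E p A : (forall i, 0 <= p i) -> sumle p A -> rsum p = nsum p.
Proof.
move=> p0 pA; have := rsum_diff p0 (fun _ => lexx 0) pA sumle0.
rewrite [X in _ = _ - X](_ : _ = 0) ?subr0 => [<-|].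
  by congr rsum; apply/funext => i; rewrite subr0.
by apply/eqP; rewrite eq_le nsum_ge0// (nsum_le _ sumle0).
Qed.

Let pp f i : 0 <= Num.max (f i) 0. Proof. by rewrite le_max lexx orbT. Qed.
Let pq f i : 0 <= Num.max (- f i) 0. Proof. by rewrite le_max lexx orbT. Qed.
Let dec f i : f i = Num.max (f i) 0 - Num.max (- f i) 0.
Proof. by rewrite !maxEle; do 2 case: ifP; lra. Qed.
Let sp f A : sumle (fun i => `|f i|) A -> sumle (fun i => Num.max (f i) 0) A.
Proof. by apply: sumle_le => i; rewrite ge_max normr_ge0 ler_norm. Qed.
Let sq f A : sumle (fun i => `|f i|) A -> sumle (fun i => Num.max (- f i) 0) A.
Proof. by apply: sumle_le => i; rewrite ge_max normr_ge0 -normrN ler_norm. Qed.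

Lemma rsumD f g A B : sumle (fun i => `|f i|) A -> sumle (fun i => `|g i|) B ->
  rsum (fun i => f i + g i) = rsum f + rsum g.
Proof.
move=> fA gB.
have -> : (fun i => f i + g i) = (fun i => (Num.max (f i) 0 + Num.max (g i) 0) -
    (Num.max (- f i) 0 + Num.max (- g i) 0)).
  by apply/funext => i; rewrite [in LHS](dec f) [in LHS](dec g); lra.
rewrite (rsum_diff (A := A + B) (B := A + B)).
- rewrite (nsumD (pp f) (pp g) (sp fA) (sp gB)) (nsumD (pq f) (pq g) (sq fA) (sq gB)).
  by rewrite /rsum; lra.
- by move=> i; rewrite addr_ge0 ?pp.
- by move=> i; rewrite addr_ge0 ?pq.
- exact: sumleD (sp fA) (sp gB).
- exact: sumleD (sq fA) (sq gB).
Qed.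

Lemma rsumZ k f A : sumle (fun i => `|f i|) A -> rsum (fun i => k * f i) = k * rsum f.
Proof.
move=> fA; have [k0|k0] := leP 0 k.
  have -> : (fun i => k * f i) =
      (fun i => k * Num.max (f i) 0 - k * Num.max (- f i) 0).
    by apply/funext => i; rewrite [in LHS](dec f) mulrBr.
  rewrite (rsum_diff _ _ (sumleZ k0 (sp fA)) (sumleZ k0 (sq fA))).
  - by rewrite (nsumZ k0 (pp f) (sp fA)) (nsumZ k0 (pq f) (sq fA)) -mulrBr.
  - by move=> i; rewrite mulr_ge0 ?pp.
  - by move=> i; rewrite mulr_ge0 ?pq.
have {}k0 : 0 <= - k by rewrite oppr_ge0 ltW.
have -> : (fun i => k * f i) =
    (fun i => (- k) * Num.max (- f i) 0 - (- k) * Num.max (f i) 0).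
  by apply/funext => i; rewrite [in LHS](dec f); lra.
rewrite (rsum_diff _ _ (sumleZ k0 (sq fA)) (sumleZ k0 (sp fA))).
- by rewrite (nsumZ k0 (pp f) (sp fA)) (nsumZ k0 (pq f) (sq fA)) /rsum; lra.
- by move=> i; rewrite mulr_ge0 ?pq.
- by move=> i; rewrite mulr_ge0 ?pp.
Qed.

Lemma rsum_le f A : sumle (fun i => `|f i|) A -> rsum f <= A.
Proof.
move=> fA; apply: le_trans (_ : nsum (fun i => Num.max (f i) 0) <= _).
  by rewrite /rsum gerBl nsum_ge0// => i; exact: pq.
by apply: nsum_le (pp f) (sp fA).
Qed.

Lemma rsum_seq f (s : seq T) : uniq s -> (forall i, i \notin s -> f i = 0) ->
  rsum f = \sum_(i <- s) f i.
Proof.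
move=> us fs; rewrite /rsum !(nsum_seq us) ?pp//.
- by rewrite -sumrB; apply: eq_bigr => i _; rewrite -dec.
- by move=> i /fs ->; rewrite oppr0 maxEle lexx.
- by move=> i /fs ->; rewrite maxEle lexx.
Qed.

End RealSums.

Lemma rsum_bij {T T' : choiceType} (e : T' -> T) (f : T -> R) :
  bijective e -> rsum (f \o e) = rsum f.
Proof. by move=> be; rewrite /rsum -[in RHS](nsum_bij _ be) -[X in _ = _ - X](nsum_bij _ be). Qed.

Lemma rsum_pair {T T' : choiceType} (F : T -> T' -> R) A :
  sumle (fun p => `|F p.1 p.2|) A ->
  rsum (fun p => F p.1 p.2) = rsum (fun i => rsum (F i)).
Proof.
move=> FA.
have P0 i j : 0 <= Num.max (F i j) 0 by rewrite le_max lexx orbT.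
have Q0 i j : 0 <= Num.max (- F i j) 0 by rewrite le_max lexx orbT.
have sP : sumle (fun p => Num.max (F p.1 p.2) 0) A.
  by apply: sumle_le FA => i; rewrite ge_max normr_ge0 ler_norm.
have sQ : sumle (fun p => Num.max (- F p.1 p.2) 0) A.
  by apply: sumle_le FA => i; rewrite ge_max normr_ge0 -normrN ler_norm.
have [rP aP eP] := nsum_pair P0 sP.
have [rQ aQ eQ] := nsum_pair Q0 sQ.
rewrite {1}/rsum eP eQ.
have -> : (fun i => rsum (F i)) = (fun i => nsum (fun j => Num.max (F i j) 0) -
  nsum (fun j => Num.max (- F i j) 0)) by [].
by rewrite (rsum_diff _ _ aP aQ)// => i; apply: nsum_ge0.
Qed.

(** ** Modulus and phases *)

Lemma sqr_modulus (z : R[i]) : modulus z ^+ 2 = complex.Re z ^+ 2 + complex.Im z ^+ 2.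
Proof. by case: z => a b; rewrite /modulus /= sqr_sqrtr// addr_ge0 ?sqr_ge0. Qed.

Lemma modulus_ge0 (z : R[i]) : 0 <= modulus z.
Proof. by case: z => a b; rewrite /modulus /= sqrtr_ge0. Qed.

Lemma modulusM (x y : R[i]) : modulus (x * y) = modulus x * modulus y.
Proof. exact: ComplexField.Normc.normcM. Qed.

Lemma modulus0 : modulus (0 : R[i]) = 0.
Proof. exact: ComplexField.Normc.normc0. Qed.

Lemma modulus1 : modulus (1 : R[i]) = 1.
Proof. exact: ComplexField.Normc.normc1. Qed.

Lemma modulus_eq0 (z : R[i]) : modulus z = 0 -> z = 0.
Proof. exact: ComplexField.Normc.eq0_normc. Qed.

Lemma modulusN (z : R[i]) : modulus (- z) = modulus z.
Proof. exact: normcN. Qed.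

Lemma modulusD (x y : R[i]) : modulus (x + y) <= modulus x + modulus y.
Proof. exact: le_normcD. Qed.

Lemma modulusB (x y : R[i]) : modulus (x - y) <= modulus x + modulus y.
Proof. by rewrite -(modulusN y) modulusD. Qed.

Lemma modulus_sum {T : Type} (s : seq T) (F : T -> R[i]) :
  modulus (\sum_(i <- s) F i) <= \sum_(i <- s) modulus (F i).
Proof.
elim: s => [|i s IH]; first by rewrite !big_nil modulus0.
by rewrite !big_cons; apply: le_trans (modulusD _ _) _; rewrite lerD2l.
Qed.

Lemma modulus_le_sqrt (z : R[i]) e : modulus z ^+ 2 <= e -> modulus z <= Num.sqrt e.
Proof.
by move=> h; rewrite -[leLHS]ger0_norm ?modulus_ge0// -sqrtr_sqr ler_wsqrtr.
Qed.

Lemma modulusC (x : R) : modulus x%:C%C = `|x|.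
Proof. by rewrite /modulus /= expr0n addr0 sqrtr_sqr. Qed.

Lemma modulusJ (z : R[i]) : modulus z^*%C = modulus z.
Proof. by case: z => a b; rewrite /modulus /= sqrrN. Qed.

Lemma modulus_i : modulus ('i%C : R[i]) = 1.
Proof. by rewrite /modulus /= expr0n add0r expr1n sqrtr1. Qed.

Lemma modulus_cis y : modulus (cis y : R[i]) = 1.
Proof. by rewrite /modulus /= cos2Dsin2 sqrtr1. Qed.

Lemma Re_le_modulus (z : R[i]) : `|complex.Re z| <= modulus z.
Proof.
by rewrite -(@ler_pXn2r _ 2) ?nnegrE ?modulus_ge0// sqr_modulus -normrX ger0_norm ?sqr_ge0// lerDl sqr_ge0.
Qed.

Lemma Im_le_modulus (z : R[i]) : `|complex.Im z| <= modulus z.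
Proof.
by rewrite -(@ler_pXn2r _ 2) ?nnegrE ?modulus_ge0// sqr_modulus -normrX ger0_norm ?sqr_ge0// lerDr sqr_ge0.
Qed.

Lemma modulus_le_ReIm (z : R[i]) : modulus z <= `|complex.Re z| + `|complex.Im z|.
Proof.
rewrite -(@ler_pXn2r _ 2) ?nnegrE ?modulus_ge0 ?addr_ge0// sqr_modulus.
rewrite sqrrD !real_normK ?num_real// -addrA [_ *+ 2 + _]addrC addrA lerDl.
by rewrite mulrn_wge0 ?mulr_ge0.
Qed.

Lemma mulJc (z : R[i]) : z * z^*%C = (modulus z ^+ 2)%:C%C.
Proof.
rewrite sqr_modulus; case: z => a b; simpc; rewrite -!expr2; congr Complex.
by rewrite mulrC addNr.
Qed.

Lemma conjcM (x y : R[i]) : (x * y)^*%C = x^*%C * y^*%C.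
Proof. exact: rmorphM. Qed.

Lemma conjcD (x y : R[i]) : (x + y)^*%C = x^*%C + y^*%C.
Proof. exact: rmorphD. Qed.

Lemma conjcB (x y : R[i]) : (x - y)^*%C = x^*%C - y^*%C.
Proof. exact: rmorphB. Qed.

Lemma conjcR (x : R) : (x%:C%C)^*%C = x%:C%C :> R[i].
Proof. exact: conjc_real. Qed.

Lemma conjc_sum {T : Type} (s : seq T) (F : T -> R[i]) :
  (\sum_(i <- s) F i)^*%C = \sum_(i <- s) (F i)^*%C.
Proof. exact: rmorph_sum. Qed.

Lemma realc_sum {T : Type} (s : seq T) (F : T -> R) :
  (\sum_(i <- s) F i)%:C%C = \sum_(i <- s) (F i)%:C%C :> R[i].
Proof. exact: rmorph_sum. Qed.

Lemma realcD (x y : R) : (x + y)%:C%C = x%:C%C + y%:C%C :> R[i].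
Proof. exact: rmorphD. Qed.

Lemma realcB (x y : R) : (x - y)%:C%C = x%:C%C - y%:C%C :> R[i].
Proof. exact: rmorphB. Qed.

Lemma realcM (x y : R) : (x * y)%:C%C = x%:C%C * y%:C%C :> R[i].
Proof. exact: rmorphM. Qed.

Lemma realcX (x : R) n : (x ^+ n)%:C%C = x%:C%C ^+ n :> R[i].
Proof. exact: rmorphXn. Qed.

Lemma cisD x y : cis (x + y) = cis x * cis y :> R[i].
Proof. by rewrite /cis cosD sinD; simpc; congr Complex; rewrite addrC. Qed.

Lemma cis0 : cis 0 = 1 :> R[i].
Proof. by rewrite /cis cos0 sin0. Qed.

Lemma conj_cis y : (cis y)^*%C = cis (- y) :> R[i].
Proof. by rewrite /cis cosN sinN. Qed.

Lemma cisNK y : cis y * cis (- y) = 1 :> R[i].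
Proof. by rewrite -cisD subrr cis0. Qed.

Lemma cis_periodic y (k : int) : cis (y + k%:~R * (2 * pi)) = cis y :> R[i].
Proof.
have P n x : cis (x + n%:R * (2 * pi)) = cis x :> R[i].
  elim: n x => [|n IH] x; first by rewrite mul0r addr0.
  rewrite -natr1 mulrDl mul1r addrA [2 * pi]mulrC mulr_natr.
  have h z : cis (z + pi *+ 2) = cis z :> R[i].
    by rewrite /cis cosD2pi sinD2pi.
  by rewrite h -[pi *+ 2]mulr_natl IH.
case: (intP k) => [|n|n]; first by rewrite mul0r addr0.
  exact: P.
by rewrite -[LHS](P n.+1) -addrA -mulrDl mulrNz addNr mul0r addr0.
Qed.

(** ** Absolutely summable complex families *)

Definition summ {T : choiceType} (F : T -> R[i]) :=
  exists A, sumle (fun i => modulus (F i)) A.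

Definition csum {T : choiceType} (F : T -> R[i]) : R[i] :=
  Complex (rsum (fun i => complex.Re (F i))) (rsum (fun i => complex.Im (F i))).

Section ComplexSums.
Context {T : choiceType}.
Implicit Types (F G : T -> R[i]) (A B : R).

Lemma eq_csum F G : F =1 G -> csum F = csum G.
Proof. by move=> /funext ->. Qed.

Let reA F A : sumle (fun i => modulus (F i)) A -> sumle (fun i => `|complex.Re (F i)|) A.
Proof. by apply: sumle_le => i; exact: Re_le_modulus. Qed.
Let imA F A : sumle (fun i => modulus (F i)) A -> sumle (fun i => `|complex.Im (F i)|) A.
Proof. by apply: sumle_le => i; exact: Im_le_modulus. Qed.

Lemma summD F G : summ F -> summ G -> summ (fun i => F i + G i).
Proof.
move=> [A fA] [B gB]; exists (A + B).
by apply: sumle_le (sumleD fA gB) => i; exact: modulusD.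
Qed.

Lemma summZ k F : summ F -> summ (fun i => k * F i).
Proof.
move=> [A fA]; exists (modulus k * A).
by apply: sumle_le (sumleZ (modulus_ge0 k) fA) => i; rewrite modulusM.
Qed.

Lemma summB F G : summ F -> summ G -> summ (fun i => F i - G i).
Proof.
by move=> [A fA] [B gB]; exists (A + B); apply: sumle_le (sumleD fA gB) => i; exact: modulusB.
Qed.

Lemma csumD F G : summ F -> summ G -> csum (fun i => F i + G i) = csum F + csum G.
Proof.
move=> [A fA] [B gB]; rewrite /csum; simpc.
rewrite -(rsumD (reA fA) (reA gB)) -(rsumD (imA fA) (imA gB)).
by congr Complex; congr rsum; apply/funext => i; case: (F i) (G i) => [a b] [c d].
Qed.

Lemma csumZ k F : summ F -> csum (fun i => k * F i) = k * csum F.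
Proof.
move=> [A fA]; case: k => u v; rewrite /csum; simpc.
have n1 f c : sumle (fun i : T => `|f i|) A -> sumle (fun i => `|c * f i|) (`|c| * A).
  by move=> h; apply: sumle_le (sumleZ (normr_ge0 c) h) => i; rewrite normrM.
rewrite -!(rsumZ _ (reA fA)) -!(rsumZ _ (imA fA)).
rewrite -mulN1r -(rsumZ _ (n1 _ v (imA fA))).
have n2 := n1 _ v (imA fA).
rewrite -(rsumD (n1 _ u (reA fA)) (B := `|v| * A)); last first.
  by apply: sumle_le n2 => i; rewrite mulN1r normrN.
rewrite -(rsumD (n1 _ u (imA fA)) (n1 _ v (reA fA))).
by congr Complex; congr rsum; apply/funext => i; case: (F i) => a b; simpc => /=; rewrite ?mulN1r.
Qed.

Lemma csumB F G : summ F -> summ G -> csum (fun i => F i - G i) = csum F - csum G.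
Proof.
move=> fA gB.
have -> : (fun i => F i - G i) = (fun i => F i + (-1) * G i).
  by apply/funext => i; rewrite mulN1r.
by rewrite csumD ?csumZ ?mulN1r//; exact: summZ.
Qed.

Lemma csum_conj F : csum (fun i => (F i)^*%C) = (csum F)^*%C.
Proof.
rewrite /csum; simpc; congr Complex.
  by congr rsum; apply/funext => i; case: (F i).
rewrite /rsum opprB; congr (_ - _); apply: eq_nsum => i; case: (F i) => a b //=.
by rewrite opprK.
Qed.

(** Rotate the sum onto the positive real axis. *)
Lemma csum_le F A : sumle (fun i => modulus (F i)) A -> modulus (csum F) <= A.
Proof.
move=> fA; have [/eqP->|z0] := boolP (csum F == 0); first by rewrite modulus0 (sumle_ge0 fA).
set z := csum F in z0 *.
have m0 : modulus z != 0 by apply: contra_neq z0 => /modulus_eq0.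
pose k := (modulus z)^-1%:C%C * z^*%C.
have mk : modulus k = 1.
  by rewrite modulusM modulusC modulusJ normfV ger0_norm ?modulus_ge0// mulVf.
have kF : summ F by exists A.
have : complex.Re (csum (fun i => k * F i)) = modulus z.
  rewrite csumZ// -/z /k -mulrA [_^*%C * _]mulrC mulJc.
  by simpc; rewrite /= expr2 mulrA mulVf// mul1r.
move=> <-; rewrite /csum /=; apply: rsum_le.
by apply: sumle_le fA => i; apply: le_trans (Re_le_modulus _) _; rewrite modulusM mk mul1r.
Qed.

Lemma csum_seq F (s : seq T) : uniq s -> (forall i, i \notin s -> F i = 0) ->
  csum F = \sum_(i <- s) F i.
Proof.
move=> us fs; rewrite /csum !(rsum_seq us); try by move=> i /fs ->.
elim: s {us fs} => [|x s IH]; first by rewrite !big_nil.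
by rewrite !big_cons -IH; case: (F x) => a b; simpc.
Qed.

End ComplexSums.

Lemma csum_bij {T T' : choiceType} (e : T' -> T) (F : T -> R[i]) :
  bijective e -> csum (F \o e) = csum F.
Proof.
move=> be; rewrite /csum.
by rewrite -(rsum_bij (fun i => complex.Re (F i)) be) -(rsum_bij (fun i => complex.Im (F i)) be).
Qed.

Lemma summ_inj {T T' : choiceType} (e : T' -> T) (F : T -> R[i]) :
  injective e -> summ F -> summ (F \o e).
Proof. by move=> ie [A FA]; exists A; exact: (sumle_inj ie FA). Qed.

Lemma summ_bij {T T' : choiceType} (e : T' -> T) (F : T -> R[i]) :
  bijective e -> summ (F \o e) -> summ F.
Proof.
move=> [d ed de] /(summ_inj (can_inj de)).
by rewrite (_ : _ \o d = F)//; apply/funext => x /=; rewrite de.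
Qed.

Lemma csum_pair {T T' : choiceType} (F : T -> T' -> R[i]) :
  summ (fun p => F p.1 p.2) -> 
  csum (fun p => F p.1 p.2) = csum (fun i => csum (F i)).
Proof.
move=> [A FA].
have rA : sumle (fun p => `|complex.Re (F p.1 p.2)|) A.
  by apply: sumle_le FA => p; exact: Re_le_modulus.
have iA : sumle (fun p => `|complex.Im (F p.1 p.2)|) A.
  by apply: sumle_le FA => p; exact: Im_le_modulus.
by rewrite /csum (rsum_pair (F := fun i j => complex.Re (F i j)) rA)
   (rsum_pair (F := fun i j => complex.Im (F i j)) iA).
Qed.

End Sums.

Arguments csum : simpl never.

Section Tails.
Context {R : realType}.

Lemma nsum_approx {T : choiceType} (f : T -> R) A e : (forall i, 0 <= f i) -> sumle f A ->
  0 < e -> exists2 s : seq T, uniq s & sumle (fun i => if i \in s then 0 else f i) e.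
Proof.
move=> f0 fA e0.
have [s us hs] : exists2 s, uniq s & nsum f - e < \sum_(i <- s) f i.
  apply: contrapT => h.
  have : sumle f (nsum f - e).
    by move=> s us; rewrite leNgt; apply/negP => hs; apply: h; exists s.
  by move=> /(nsum_le f0); lra.
exists s => // r ur.
rewrite -(lerD2r (\sum_(i <- s) f i)).
pose r' := [seq i <- r | i \notin s].
have u' : uniq (r' ++ s).
  rewrite cat_uniq filter_uniq// us andbT; apply/hasPn => i si.
  by rewrite mem_filter si.
have := sumle_nsum f0 fA u'; rewrite big_cat/= big_filter.
have -> : \sum_(i <- r) (if i \in s then 0 else f i) = \sum_(i <- r | i \notin s) f i.
  by rewrite [RHS]big_mkcond; apply: eq_bigr => i _; case: ifP.
by move=> h; apply: le_trans h _; rewrite -lerBlDl ltW.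
Qed.

Lemma csum_ge0E {T : choiceType} (f : T -> R) A : (forall i, 0 <= f i) -> sumle f A ->
  csum (fun i => (f i)%:C%C) = (nsum f)%:C%C.
Proof.
move=> f0 fA; rewrite /csum /=; congr Complex; first exact: rsum_ge0E fA.
by rewrite (rsum_seq (s := [::]))// big_nil.
Qed.

Lemma csum_sum {T T' : choiceType} (s : seq T') (F : T' -> T -> R[i]) :
  (forall j, summ (F j)) ->
  csum (fun i => \sum_(j <- s) F j i) = \sum_(j <- s) csum (F j) /\
  summ (fun i => \sum_(j <- s) F j i).
Proof.
move=> sF; elim: s => [|j s [IH IHs]].
  have z : (fun i : T => \sum_(j <- [::]) F j i) = fun=> 0.
    by apply/funext => i; rewrite big_nil.
  rewrite z big_nil (csum_seq (s := [::]))// big_nil; split => //.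
  by exists 0; apply: sumle_le (sumle0 (T := T)) => i; rewrite modulus0.
have z : (fun i : T => \sum_(j <- j :: s) F j i) = fun i => F j i + \sum_(j <- s) F j i.
  by apply/funext => i; rewrite big_cons.
by rewrite z big_cons csumD// IH; split => //; exact: summD.
Qed.

End Tails.

(** * Lattice sums and the trilinear estimate *)

Notation lattice := (int * int)%type.

Section Lattice.
Context {R : realType}.
Implicit Types (n p q r : lattice) (f g h : lattice -> R) (a b c : lattice -> R[i]).

Definition sz n : nat := maxn `|n.1|%N `|n.2|%N.
Definition wt n : R := (sz n).+1%:R.

Definition boxside (j : nat) : seq int := [seq ((i : nat)%:Z - j%:Z) | i : nat <- iota 0 (2 * j).+1].
Definition box (j : nat) : seq lattice := [seq (x, y) | x <- boxside j, y <- boxside j].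

Lemma mem_boxside j (x : int) : (x \in boxside j) = (`|x| <= j)%N.
Proof.
apply/mapP/idP => [[m]|h].
  by rewrite mem_iota => /andP[_ h] ->; lia.
by exists `|(x + j%:Z)%R|%N; rewrite ?mem_iota; lia.
Qed.

Lemma uniq_boxside j : uniq (boxside j).
Proof. by rewrite map_inj_uniq ?iota_uniq// => x y /addIr []. Qed.

Lemma mem_box j n : (n \in box j) = (sz n <= j)%N.
Proof.
case: n => x y; have -> : sz (x, y) = maxn `|x|%N `|y|%N by [].
rewrite geq_max -!mem_boxside /box.
apply/allpairsP/andP => [[[u v] [hu hv [-> ->]]]|[hx hy]]; first by split.
by exists (x, y); split.
Qed.

Lemma uniq_box j : uniq (box j).
Proof.
apply: allpairs_uniq; [exact: uniq_boxside|exact: uniq_boxside|].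
by move=> [? ?] [? ?] _ _ [-> ->].
Qed.

Lemma wt_gt0 n : 0 < wt n. Proof. by rewrite /wt ltr0n. Qed.
Lemma wt_ge0 n : 0 <= wt n. Proof. exact: ltW (wt_gt0 n). Qed.
Lemma wt_ge1 n : 1 <= wt n. Proof. by rewrite /wt ler1n. Qed.
Lemma wt_neq0 n : wt n != 0. Proof. by rewrite gt_eqF// wt_gt0. Qed.

(** The sphere of radius [j] consists of four sides with [2 j + 1] points. *)
Lemma sphere_count (s : seq lattice) j :
  uniq s -> (count (fun n => sz n == j) s <= 8 * j.+1)%N.
Proof.
move=> us; rewrite -size_filter.
pose L : seq lattice := [seq (j%:Z, y) | y <- boxside j] ++ [seq (- j%:Z, y) | y <- boxside j]
  ++ [seq (x, j%:Z) | x <- boxside j] ++ [seq (x, - j%:Z) | x <- boxside j].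
apply: leq_trans (_ : size L <= _)%N; last first.
  by rewrite /L !size_cat !size_map size_iota; lia.
apply: uniq_leq_size; first by rewrite filter_uniq.
move=> [x y]; rewrite mem_filter => /andP[/eqP + _]; rewrite /sz /= => h.
rewrite !mem_cat.
have [hx|hx] := eqVneq x j%:Z.
  by apply/orP; left; apply/mapP; exists y; rewrite ?hx// mem_boxside; lia.
have [hx'|hx'] := eqVneq x (- j%:Z).
  by apply/orP; right; apply/orP; left; apply/mapP; exists y; rewrite ?hx'// mem_boxside; lia.
have [hy|hy] := eqVneq y j%:Z.
  by apply/orP; right; apply/orP; right; apply/orP; left; apply/mapP; exists x; rewrite ?hy// mem_boxside; lia.
have hy' : y = - j%:Z by lia.
by apply/orP; right; apply/orP; right; apply/orP; right; apply/mapP; exists x; rewrite ?hy'// mem_boxside; lia.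
Qed.

Lemma sumle_radial (psi : nat -> R) A : (forall j, 0 <= psi j) ->
  (forall N, \sum_(j < N) 8 * j.+1%:R * psi j <= A) -> sumle (fun n => psi (sz n)) A.
Proof.
move=> psi0 psiA s us.
pose N := (\max_(n <- s) sz n).+1.
apply: le_trans (psiA N).
have -> : \sum_(n <- s) psi (sz n) = \sum_(n <- s) \sum_(j < N) (sz n == j)%:R * psi j.
  rewrite big_seq [RHS]big_seq; apply: eq_bigr => n ns.
  have hN : (sz n < N)%N by rewrite ltnS; exact: leq_bigmax_seq.
  rewrite (bigD1 (Ordinal hN))//= eqxx mul1r big1 ?addr0// => j.
  by rewrite eq_sym -val_eqE /= => /negPf ->; rewrite mul0r.
rewrite exchange_big/=; apply: ler_sum => j _.
rewrite -mulr_suml ler_wpM2r// -natr_sum.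
have -> : (\sum_(i <- s) (sz i == j))%N = count (fun n => sz n == j) s.
  by rewrite -sum1_count [RHS]big_mkcond; apply: eq_bigr => i _; case: eqP.
by rewrite -natrM ler_nat; apply: sphere_count.
Qed.

Lemma sum_inv_sqr_tail m N : (0 < m)%N ->
  \sum_(i < N) ((m + i).+1%:R ^+ 2)^-1 <= m%:R^-1 - (m + N)%:R^-1 :> R.
Proof.
move=> m0; elim: N => [|N IH]; first by rewrite big_ord0 addn0 subrr.
rewrite big_ord_recr/=; apply: le_trans (lerD IH (lexx _)) _.
have x0 : 0 < (m + N)%:R :> R by rewrite ltr0n addn_gt0 m0.
rewrite addnS -[(m + N).+1%:R]natr1; set x : R := (m + N)%:R in x0 *.
rewrite -subr_ge0.
have -> : m%:R^-1 - (x + 1)^-1 - (m%:R^-1 - x^-1 + ((x + 1) ^+ 2)^-1) = (x * (x + 1) ^+ 2)^-1.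
  have xn : x != 0 by rewrite gt_eqF.
  have x1 : x + 1 != 0 by rewrite gt_eqF ?addr_gt0.
  have mn : m%:R != 0 :> R by rewrite pnatr_eq0 -lt0n.
  clearbody x; move: (m%:R : R) mn => y y0.
  by field; rewrite ?xn ?x1 ?y0.
by rewrite invr_ge0 mulr_ge0 ?exprn_ge0 ?addr_ge0 ?ltW.
Qed.

Lemma sum_inv_sqr N : \sum_(j < N) (j.+1%:R ^+ 2)^-1 <= 2 :> R.
Proof.
case: N => [|N]; first by rewrite big_ord0.
rewrite big_ord_recl/= expr1n invr1; have := @sum_inv_sqr_tail 1 N isT.
have : 0 <= (1 + N)%:R^-1 :> R by rewrite invr_ge0.
rewrite invr1; under [X in _ -> X <= _ -> _]eq_bigr do rewrite add1n.
by under [X in _ -> _ -> _ + X <= _]eq_bigr do rewrite /bump /= add1n; lra.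
Qed.

(** Two dimensions: the exponent three is summable, the exponent two is not. *)
Lemma sumle_wt3 : sumle (fun n => (wt n ^+ 3)^-1) 16.
Proof.
apply: (@sumle_radial (fun j => (j.+1%:R ^+ 3)^-1)) => [j|N]; first by rewrite invr_ge0 exprn_ge0.
under eq_bigr => j _.
  have -> : 8 * j.+1%:R * (j.+1%:R ^+ 3)^-1 = 8 * (j.+1%:R ^+ 2)^-1 :> R.
    have : j.+1%:R != 0 :> R by rewrite pnatr_eq0.
    by move: (j.+1%:R : R) => y y0; field.
  over.
by rewrite -mulr_sumr; have := sum_inv_sqr N; lra.
Qed.

Lemma amgm3 (u v w : R) : 0 <= u -> 0 <= v -> 0 <= w ->
  (u * v * w) ^+ 2 <= (u * v) ^+ 3 + (v * w) ^+ 3 + (w * u) ^+ 3.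
Proof.
move=> u0 v0 w0.
have U := mulr_ge0 u0 v0; have V := mulr_ge0 v0 w0; have W := mulr_ge0 w0 u0.
have -> : (u * v * w) ^+ 2 = (u * v) * (v * w) * (w * u) by ring.
move: (u * v) (v * w) (w * u) U V W => {u v w u0 v0 w0} x y z x0 y0 z0.
have : 0 <= (x + y + z) * ((x - y) ^+ 2 + (y - z) ^+ 2 + (z - x) ^+ 2).
  by rewrite mulr_ge0 ?addr_ge0 ?sqr_ge0.
have h : 0 <= x * y * z by rewrite !mulr_ge0.
suff -> : (x + y + z) * ((x - y) ^+ 2 + (y - z) ^+ 2 + (z - x) ^+ 2) =
  2 * (x ^+ 3 + y ^+ 3 + z ^+ 3) - 6 * (x * y * z) by lra.
by ring.
Qed.

Definition kappa : R := 16 * 16 + 16 * 16 + 16 * 16.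

Lemma kappa_ge0 : 0 <= kappa. Proof. by rewrite /kappa; lra. Qed.

(** The arithmetic-geometric inequality replaces the borderline weight
    [1 / (wt p * wt q * wt r)] by products of two cubes, each summable in its
    own variable. *)
Lemma sumle_wt_triple n :
  sumle (fun pq => ((wt pq.1 * wt pq.2 * wt (n - pq.1 + pq.2))^-1) ^+ 2) kappa.
Proof.
have P2 : sumle (fun pq : lattice * lattice => (wt pq.1 ^+ 3)^-1 * (wt pq.2 ^+ 3)^-1) (16 * 16).
  have := @sumle_pair R _ _ (fun p q : lattice => (wt p ^+ 3)^-1 * (wt q ^+ 3)^-1) (fun p => (wt p ^+ 3)^-1 * 16).
  apply.
  - by move=> i j; rewrite mulr_ge0 ?invr_ge0 ?exprn_ge0 ?wt_ge0.
  - by move=> i; apply: sumleZ sumle_wt3; rewrite invr_ge0 exprn_ge0 ?wt_ge0.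
  - have := sumleZ (ler0n R 16) sumle_wt3.
    by apply: sumle_le => i; rewrite mulrC.
pose e1 (pq : lattice * lattice) : lattice * lattice := (pq.2, n - pq.1 + pq.2).
pose e2 (pq : lattice * lattice) : lattice * lattice := (n - pq.1 + pq.2, pq.1).
have i1 : injective e1.
  by move=> [p q] [p' q'] /pair_equal_spec[/= -> /addIr /addrI /oppr_inj ->].
have i2 : injective e2.
  by move=> [p q] [p' q'] /pair_equal_spec[/= + E]; rewrite E => /addrI ->.
have := sumleD (sumleD P2 (sumle_inj i1 P2)) (sumle_inj i2 P2).
apply: sumle_le => -[p q] /=; rewrite /e1 /e2 /=.
have w m : 0 <= (wt m)^-1 by rewrite invr_ge0 wt_ge0.
have := amgm3 (w p) (w q) (w (n - p + q)).
by rewrite -!exprVn !invfM !exprMn.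
Qed.

Lemma sqr_sqrtM (x y : R) : 0 <= x -> 0 <= y -> (Num.sqrt x * Num.sqrt y) ^+ 2 = x * y.
Proof. by move=> x0 y0; rewrite exprMn !sqr_sqrtr. Qed.

Definition h1le f A := sumle (fun n => (wt n * f n) ^+ 2) A.

Lemma sumle_scale {T : choiceType} (u v : T -> R) (k A B : R) :
  0 <= k -> sumle u A -> (forall i, v i <= k * u i) -> k * A <= B -> sumle v B.
Proof. by move=> k0 uA vu AB; apply: sumle_weak AB _; apply: sumle_le vu (sumleZ k0 uA). Qed.

(** Cauchy-Schwarz with the weights [wt]; the sum of the squared weights is
    bounded uniformly in [n] by [sumle_wt_triple]. *)
Lemma trilinear_bound f g h A B C :
  (forall n, 0 <= f n) -> (forall n, 0 <= g n) -> (forall n, 0 <= h n) ->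
  h1le f A -> h1le g B -> h1le h C ->
  let t (n : lattice) : R := nsum (fun pq => f pq.1 * g pq.2 * h (n - pq.1 + pq.2)) in
  (forall n, sumle (fun pq => f pq.1 * g pq.2 * h (n - pq.1 + pq.2)) (t n)) /\ sumle (fun n => t n ^+ 2) (kappa * (A * B * C)).
Proof.
move=> f0 g0 h0 fA gB hC t.
have [[A0 B0] C0] := (sumle_ge0 fA, sumle_ge0 gB, sumle_ge0 hC).
pose X (p q r : lattice) := ((wt p * f p) * (wt q * g q) * (wt r * h r)) ^+ 2.
have X0 p q r : 0 <= X p q r by rewrite sqr_ge0.
have s3 : sumle (fun pqr : lattice * (lattice * lattice) => X pqr.1 pqr.2.1 pqr.2.2) (A * B * C).
  have := @sumle_pair R _ _ (fun (p : lattice) (qr : lattice * lattice) => X p qr.1 qr.2)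
    (fun p => (B * C) * (wt p * f p) ^+ 2).
  apply => [p qr|p|]; first exact: X0.
  - have := @sumle_pair R _ _ (fun q r : lattice => X p q r) (fun q => C * (wt p * f p) ^+ 2 * (wt q * g q) ^+ 2).
    apply => [q r|q|]; first exact: X0.
    + apply: (sumle_scale (k := (wt p * f p) ^+ 2 * (wt q * g q) ^+ 2) _ hC).
      * by rewrite mulr_ge0 ?sqr_ge0.
      * by move=> r; rewrite /X !exprMn.
      * by rewrite mulrC mulrA.
    + apply: (sumle_scale (k := C * (wt p * f p) ^+ 2) _ gB) => //.
      * by rewrite mulr_ge0 ?sqr_ge0.
      * by rewrite mulrAC [C * B]mulrC.
  - apply: (sumle_scale (k := B * C) _ fA) => //; first exact: mulr_ge0.
    by rewrite mulrC mulrA.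
pose e (x : lattice * (lattice * lattice)) : lattice * (lattice * lattice) := (x.2.1, (x.2.2, x.1 - x.2.1 + x.2.2)).
have ie : injective e.
  by move=> [n [p q]] [n' [p' q']] /pair_equal_spec[/= -> /pair_equal_spec[-> /addIr /addIr ->]].
have := sumle_inj ie s3.
move=> /(@nsum_pair R _ _ (fun n pq => X pq.1 pq.2 (n - pq.1 + pq.2))) -/(_ (fun n pq => X0 _ _ _)).
move=> [rX sX _].
set S := fun n => nsum _ in rX sX.
have cs n : sumle (fun pq => f pq.1 * g pq.2 * h (n - pq.1 + pq.2))
    (Num.sqrt (S n) * Num.sqrt kappa).
  have := sumle_cauchy_schwarz (f := fun pq => (wt pq.1 * f pq.1) * (wt pq.2 * g pq.2) *
     (wt (n - pq.1 + pq.2) * h (n - pq.1 + pq.2))) (rX n) (sumle_wt_triple n).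
  apply: sumle_le => -[p q] /=; rewrite le_eqVlt; apply/orP; left; apply/eqP.
  move: (wt_neq0 p) (wt_neq0 q) (wt_neq0 (n - p + q)).
  move: (wt p) (wt q) (wt (n - p + q)) => x y z x0 y0 z0.
  by field; rewrite ?x0 ?y0 ?z0.
have F0 n (pq : lattice * lattice) : 0 <= f pq.1 * g pq.2 * h (n - pq.1 + pq.2).
  by rewrite !mulr_ge0.
split=> [n|]; first exact: sumle_nsum (cs n).
have S0 n : 0 <= S n by apply: nsum_ge0.
have := sumleZ kappa_ge0 sX; apply: sumle_le => n.
rewrite mulrC -sqr_sqrtM ?kappa_ge0// ler_pXn2r ?nnegrE ?nsum_ge0 ?mulr_ge0 ?sqrtr_ge0//.
exact: nsum_le (cs n).
Qed.

End Lattice.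

(** * The cubic convolution and its rigidity *)

Section Cubic.
Context {R : realType}.
Implicit Types (n p q r : lattice) (a b c : lattice -> R[i]).

Definition inh1 a (A : R) := h1le (fun n => modulus (a n)) A.
Definition inl2 a (A : R) := sumle (fun n => modulus (a n) ^+ 2) A.

(** Fourier coefficients of [f * conj g * h] in terms of those of the factors. *)
Definition tri a b c n : R[i] :=
  csum (fun pq : lattice * lattice => a pq.1 * (b pq.2)^*%C * c (n - pq.1 + pq.2)).

Definition cub a := tri a a a.

Lemma inh1_l2 a A : inh1 a A -> inl2 a A.
Proof.
apply: sumle_le => n; rewrite exprMn ler_peMl ?sqr_ge0//.
by rewrite expr_ge1 ?wt_ge1// wt_ge0.
Qed.

Lemma inl2_mul a b A B : inl2 a A -> inl2 b B ->
  sumle (fun n => modulus (a n * b n)) (Num.sqrt A * Num.sqrt B).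
Proof.
move=> aA bB; apply: sumle_le (sumle_cauchy_schwarz aA bB) => n.
by rewrite modulusM.
Qed.

Lemma inl2_conj a A : inl2 a A -> inl2 (fun n => (a n)^*%C) A.
Proof. by apply: sumle_le => n; rewrite modulusJ. Qed.

Lemma inl2_inj (e : lattice -> lattice) a A : injective e -> inl2 a A -> inl2 (a \o e) A.
Proof. exact: sumle_inj. Qed.

Lemma inl2_shift k a A : inl2 a A -> inl2 (fun n => a (n + k)) A.
Proof. by apply: (inl2_inj (e := fun n => n + k)); apply: addIr. Qed.

Lemma bij_shift k : bijective (fun n : lattice => n + k).
Proof. by exists (fun n => n - k) => n; rewrite ?addrK ?subrK. Qed.

Lemma inh1D a b A B : inh1 a A -> inh1 b B -> inh1 (fun n => a n + b n) (2 * A + 2 * B).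
Proof.
move=> aA bB.
apply: sumle_le (sumleD (sumleZ (ler0n R 2) aA) (sumleZ (ler0n R 2) bB)) => n /=.
rewrite !exprMn; apply: le_trans (_ : wt n ^+ 2 *
  (2 * modulus (a n) ^+ 2 + 2 * modulus (b n) ^+ 2) <= _); last first.
  by rewrite le_eqVlt; apply/orP; left; apply/eqP; ring.
apply: ler_wpM2l; first exact: sqr_ge0.
have := modulusD (a n) (b n); have := modulus_ge0 (a n + b n).
have := modulus_ge0 (a n); have := modulus_ge0 (b n).
move: (modulus (a n + b n)) (modulus (a n)) (modulus (b n)) => z x y y0 x0 z0 zxy.
have : z ^+ 2 <= (x + y) ^+ 2 by rewrite ler_pXn2r ?nnegrE ?addr_ge0.
by have := sqr_ge0 (x - y); nra.
Qed.

Lemma inh1B a b A B : inh1 a A -> inh1 b B -> inh1 (fun n => a n - b n) (2 * A + 2 * B).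
Proof.
move=> aA bB; apply: inh1D => //.
by apply: sumle_le bB => n; rewrite modulusN.
Qed.

Lemma inl2D3 a b c A B C : inl2 a A -> inl2 b B -> inl2 c C ->
  inl2 (fun n => a n + b n + c n) (3 * (A + B + C)).
Proof.
move=> aA bB cC.
apply: sumle_le (sumleZ (ler0n R 3) (sumleD (sumleD aA bB) cC)) => n /=.
have := modulusD (a n + b n) (c n); have := modulusD (a n) (b n).
have := modulus_ge0 (a n); have := modulus_ge0 (b n); have := modulus_ge0 (c n).
have := modulus_ge0 (a n + b n); have := modulus_ge0 (a n + b n + c n).
move: (modulus (a n)) (modulus (b n)) (modulus (c n)) (modulus _) (modulus _) => x y z s t.
move=> t0 s0 z0 y0 x0 ts st.
have : t ^+ 2 <= (x + y + z) ^+ 2 by rewrite ler_pXn2r ?nnegrE ?addr_ge0//; lra.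
have := sqr_ge0 (x - y); have := sqr_ge0 (x - z); have := sqr_ge0 (y - z); nra.
Qed.

Section Trilinear.
Variables (a b c : lattice -> R[i]) (A B C : R).
Hypotheses (aA : inh1 a A) (bB : inh1 b B) (cC : inh1 c C).

Let t n := nsum (fun pq : lattice * lattice =>
  modulus (a pq.1) * modulus (b pq.2) * modulus (c (n - pq.1 + pq.2))).

Lemma tri_dom : exists t : lattice -> R,
  [/\ forall n, 0 <= t n,
      forall n, sumle (fun pq : lattice * lattice => modulus (a pq.1 * (b pq.2)^*%C * c (n - pq.1 + pq.2))) (t n) &
      sumle (fun n => t n ^+ 2) (kappa * (A * B * C))].
Proof.
have [h1 h2] := trilinear_bound (fun n => modulus_ge0 (a n)) (fun n => modulus_ge0 (b n))
  (fun n => modulus_ge0 (c n)) aA bB cC.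
exists t; split => //.
- by move=> n; apply: nsum_ge0 => pq; rewrite !mulr_ge0 ?modulus_ge0.
- by move=> n; apply: sumle_le (h1 n) => pq; rewrite !modulusM modulusJ.
Qed.

Lemma tri_summ n : summ (fun pq : lattice * lattice => a pq.1 * (b pq.2)^*%C * c (n - pq.1 + pq.2)).
Proof. by have [u [_ h _]] := tri_dom; exists (u n). Qed.

Lemma tri_l2 : inl2 (tri a b c) (kappa * (A * B * C)).
Proof.
have [u [u0 h]] := tri_dom; apply: sumle_le => n.
by rewrite ler_pXn2r ?nnegrE ?modulus_ge0//; apply: csum_le.
Qed.

End Trilinear.

Lemma cub_l2 a A : inh1 a A -> inl2 (cub a) (kappa * (A * A * A)).
Proof. by move=> aA; apply: tri_l2. Qed.

(** The difference telescopes into three trilinear terms, each with a factor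
    [a - b]. *)
Lemma cub_diff a b A D : inh1 a A -> inh1 b A -> inh1 (fun n => a n - b n) D ->
  inl2 (fun n => cub a n - cub b n) (9 * kappa * A ^+ 2 * D).
Proof.
move=> aA bA dD.
have := inl2D3 (tri_l2 dD aA aA) (tri_l2 bA dD aA) (tri_l2 bA bA dD).
have -> : 3 * (kappa * (D * A * A) + kappa * (A * D * A) + kappa * (A * A * D)) =
  9 * kappa * A ^+ 2 * D by ring.
apply: sumle_le => n.
rewrite le_eqVlt; apply/orP; left; apply/eqP; congr (modulus _ ^+ 2).
rewrite /cub /tri.
rewrite -csumD; [|exact: (tri_summ dD aA aA n)|exact: (tri_summ bA dD aA n)].
rewrite -csumD; [|apply: summD|]; last 1 first.
- exact: (tri_summ bA bA dD n).
- rewrite -csumB; [|exact: (tri_summ aA aA aA n)|exact: (tri_summ bA bA bA n)].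
  apply: eq_csum => -[p q] /=; rewrite conjcB; ring.
- exact: (tri_summ dD aA aA n).
- exact: (tri_summ bA dD aA n).
Qed.

End Cubic.

(** ** Autocorrelation and quartic sums *)

Section Quartic.
Context {R : realType}.
Implicit Types (n p q r : lattice) (a b c : lattice -> R[i]).

Definition corr a (k : lattice) : R[i] := csum (fun n => a n * (a (n - k))^*%C).

Section Moment.
Variables (a : lattice -> R[i]) (A : R) (l : lattice -> R).
Hypothesis aA : inh1 a A.
Hypothesis lB : forall m n, l (m - n) = l m - l n.
Hypothesis lwt : forall n, `|l n| <= wt n.

Let l0 : l 0 = 0. Proof. by rewrite -[X in l X](subrr (0 : lattice)) lB subrr. Qed.
Let lN m : l (- m) = - l m. Proof. by rewrite -[X in l X]sub0r lB l0 sub0r. Qed.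
Let lD m n : l (m + n) = l m + l n. Proof. by rewrite -[n in LHS]opprK lB lN opprK. Qed.

Let la n : R[i] := (l n)%:C%C * a n.

Let la_l2 : inl2 la A.
Proof.
apply: sumle_le aA => n; rewrite /la modulusM modulusC.
by rewrite ler_pXn2r ?nnegrE ?mulr_ge0 ?modulus_ge0 ?wt_ge0// ler_wpM2r ?modulus_ge0.
Qed.

Let B (k : lattice) (x : lattice * (lattice * lattice)) : R[i] :=
  (a x.1)^*%C * (a x.2.1 * (a x.2.2)^*%C * a (x.1 + k - x.2.1 + x.2.2)).

Let summ_w (k : lattice) (w : lattice -> R[i]) W : inl2 w W ->
  summ (fun x : lattice * (lattice * lattice) =>
    (w x.1)^*%C * (a x.2.1 * (a x.2.2)^*%C * a (x.1 + k - x.2.1 + x.2.2))).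
Proof.
move=> wW; have [t [t0 ht tt]] := tri_dom aA aA aA.
have tk : sumle (fun n => t (n + k) ^+ 2) (kappa * (A * A * A)).
  have := sumle_inj (e := fun n : lattice => n + k) _ tt.
  by apply; exact: addIr.
exists (Num.sqrt W * Num.sqrt (kappa * (A * A * A))).
have := @sumle_pair R _ _ (fun (n : lattice) (pq : lattice * lattice) =>
   modulus ((w n)^*%C * (a pq.1 * (a pq.2)^*%C * a (n + k - pq.1 + pq.2))))
   (fun n => modulus (w n) * t (n + k)).
apply.
- by move=> *; exact: modulus_ge0.
- move=> n; apply: sumle_le (sumleZ (modulus_ge0 (w n)) (ht (n + k))) => pq.
  by rewrite [in leLHS]modulusM modulusJ.
- exact: sumle_cauchy_schwarz wW tk.
Qed.

Let csum_w (k : lattice) (w : lattice -> R[i]) W : inl2 w W ->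
  csum (fun x : lattice * (lattice * lattice) =>
    (w x.1)^*%C * (a x.2.1 * (a x.2.2)^*%C * a (x.1 + k - x.2.1 + x.2.2))) =
  csum (fun n => (w n)^*%C * cub a (n + k)).
Proof.
move=> wW; rewrite (csum_pair (F := fun n (pq : lattice * lattice) =>
   (w n)^*%C * (a pq.1 * (a pq.2)^*%C * a (n + k - pq.1 + pq.2)))); last exact: summ_w wW.
apply: eq_csum => n; rewrite csumZ//.
exact: (tri_summ aA aA aA (n + k)).
Qed.

Variable k : lattice.

(* the involution exchanging the two conjugated entries *)
Let e24 (x : lattice * (lattice * lattice)) : lattice * (lattice * lattice) :=
  (x.2.2, (x.2.1, x.1)).
(* the involution exchanging the two unconjugated entries *)
Let e13 (x : lattice * (lattice * lattice)) : lattice * (lattice * lattice) :=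
  (x.1, (x.1 + k - x.2.1 + x.2.2, x.2.2)).
(* [p] becomes the outer index *)
Let e1 (x : lattice * (lattice * lattice)) : lattice * (lattice * lattice) :=
  (x.1 - x.2.1 + x.2.2 - k, (x.1, x.2.1)).

Let bij24 : bijective e24.
Proof. by exists e24 => -[n [p q]]. Qed.

Let bij13 : bijective e13.
Proof.
have h : involutive e13.
  move=> [n [p q]]; rewrite /e13 /=; congr (_, (_, _)).
  by rewrite opprD opprB !addrA; ring.
by exists e13.
Qed.

Let bij1 : bijective e1.
Proof.
exists (fun x => (x.2.1, (x.2.2, x.1 + k - x.2.1 + x.2.2))) => -[n [p q]];
  by rewrite /e1 /=; congr (_, (_, _)); ring.
Qed.

Let B24 x : B k (e24 x) = B k x.
Proof.
case: x => [n [p q]]; rewrite /B /e24 /=.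
have -> : q + k - p + n = n + k - p + q by ring.
by ring.
Qed.

Let B13 x : B k (e13 x) = B k x.
Proof.
case: x => [n [p q]]; rewrite /B /e13 /=.
have -> : n + k - (n + k - p + q) + q = p by ring.
by ring.
Qed.

(** The weight [l] is placed on each of the four entries in turn.  The symmetries
    of the quartic form identify these sums in pairs, and the additivity of [l]
    on the resonance relation between the four frequencies relates the pairs. *)
Lemma quartic_moment :
  2 * csum (fun n => (la n)^*%C * cub a (n + k)) =
  2 * csum (fun p => la p * (cub a (p - k))^*%C)
  - (l k)%:C%C * csum (fun n => (a n)^*%C * cub a (n + k)).
Proof.
have a2 := inh1_l2 aA.
pose S (w : lattice * (lattice * lattice) -> R) x := (w x)%:C%C * B k x.
pose w4 (x : lattice * (lattice * lattice)) := l x.1.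
pose w1 (x : lattice * (lattice * lattice)) := l x.2.1.
pose w2 (x : lattice * (lattice * lattice)) := l x.2.2.
pose w3 (x : lattice * (lattice * lattice)) := l (x.1 + k - x.2.1 + x.2.2).
have E4 : S w4 = fun x => (la x.1)^*%C * (a x.2.1 * (a x.2.2)^*%C * a (x.1 + k - x.2.1 + x.2.2)).
  by apply/funext => x; rewrite /S /la /B conjcM conjcR mulrA.
have s4 : summ (S w4) by rewrite E4; exact: (summ_w k la_l2).
have S4 : csum (S w4) = csum (fun n => (la n)^*%C * cub a (n + k)).
  by rewrite E4; exact: (csum_w k la_l2).
have s0 : summ (B k) by exact: (summ_w k a2).
have S0 : csum (B k) = csum (fun n => (a n)^*%C * cub a (n + k)) by exact: (csum_w k a2).
have E1 : S w1 \o e1 = fun x => ((la x.1)^*%C * (a x.2.1 * (a x.2.2)^*%C * a (x.1 + (- k) - x.2.1 + x.2.2)))^*%C.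
  apply/funext => -[p [q r]]; rewrite /S /w1 /B /e1 /la /=.
  have -> : p - q + r - k + k - p + q = r by ring.
  have -> : p - q + r - k = p - k - q + r by ring.
  by rewrite !conjcM !conjcK; ring.
have sE1 : summ (S w1 \o e1).
  rewrite E1; have [W hW] := summ_w (- k) la_l2; exists W.
  by apply: sumle_le hW => x; rewrite modulusJ.
have s1 := summ_bij bij1 sE1.
have S1 : csum (S w1) = csum (fun p => la p * (cub a (p - k))^*%C).
  rewrite -(csum_bij _ bij1) E1 csum_conj (csum_w (- k) la_l2) -csum_conj.
  by apply: eq_csum => p; rewrite conjcM conjcK.
have E2 : S w4 \o e24 = S w2 by apply/funext => x; rewrite /S /= B24.
have E3 : S w1 \o e13 = S w3 by apply/funext => x; rewrite /S /= B13.
have s2 : summ (S w2) by rewrite -E2; apply: summ_inj s4; exact: bij_inj bij24.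
have s3 : summ (S w3) by rewrite -E3; apply: summ_inj s1; exact: bij_inj bij13.
have S2 : csum (S w2) = csum (S w4) by rewrite -E2 csum_bij.
have S3 : csum (S w3) = csum (S w1) by rewrite -E3 csum_bij.
have : csum (S w4) = csum (S w1) - csum (S w2) + csum (S w3) - (l k)%:C%C * csum (B k).
  rewrite -csumB// -csumD//; last exact: summB.
  rewrite -csumZ// -csumB//; [|by apply: summD => //; exact: summB|exact: summZ].
  apply: eq_csum => -[n [p q]]; rewrite /S /w4 /w1 /w2 /w3 /=.
  by rewrite !lD lN !rmorphD rmorphN/=; ring.
rewrite S2 S3 S1 S4 S0.
have gen (x y z w : R[i]) : x = y - x + y - z * w -> 2 * x = 2 * y - z * w.
  move=> h; apply/eqP; rewrite -subr_eq0.
  have -> : 2 * x - (2 * y - z * w) = x - (y - x + y - z * w) by ring.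
  by rewrite -h subrr.
exact: gen.
Qed.

End Moment.

Lemma corr_shift a k : corr a k = csum (fun n => (a n)^*%C * a (n + k)).
Proof.
rewrite /corr -(csum_bij _ (bij_shift k)); apply: eq_csum => n /=.
by rewrite addrK mulrC.
Qed.

Lemma inl2_la a A (l : lattice -> R) : inh1 a A -> (forall n, `|l n| <= wt n) ->
  inl2 (fun n => (l n)%:C%C * a n) A.
Proof.
move=> aA lwt; apply: sumle_le aA => n; rewrite modulusM modulusC.
by rewrite ler_pXn2r ?nnegrE ?mulr_ge0 ?modulus_ge0 ?wt_ge0// ler_wpM2r ?modulus_ge0.
Qed.

(** If [a * a~ * a = c a], two evaluations of the same quartic sum, with the
    weight [l] placed on a conjugated or on an unconjugated entry, differ by a
    factor of two unless the autocorrelation vanishes where [l] does not. *)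
Lemma corr_rigid a A (c : R) (l : lattice -> R) k :
  inh1 a A -> (forall m n, l (m - n) = l m - l n) -> (forall n, `|l n| <= wt n) ->
  (forall n, cub a n = c%:C%C * a n) -> c != 0 -> l k != 0 -> corr a k = 0.
Proof.
move=> aA lB lwt ac c0 lk.
have := quartic_moment aA lB lwt k.
pose la n : R[i] := (l n)%:C%C * a n; have la2 : inl2 la A by exact: inl2_la.
have a2 := inh1_l2 aA.
have lkn n : l (n + k) = l n + l k.
  have l0 : l 0 = 0 by rewrite -[X in l X](subrr (0 : lattice)) lB subrr.
  by rewrite -[k in LHS]opprK lB -[- k]sub0r lB l0 sub0r opprK.
have s1 : summ (fun n => (la n)^*%C * a (n + k)).
  by exists (Num.sqrt A * Num.sqrt A); apply: inl2_mul (inl2_conj la2) (inl2_shift k a2).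
have s2 : summ (fun n => (a n)^*%C * a (n + k)).
  by exists (Num.sqrt A * Num.sqrt A); apply: inl2_mul (inl2_conj a2) (inl2_shift k a2).
set X := csum (fun n => (la n)^*%C * a (n + k)).
have -> : csum (fun n => (la n)^*%C * cub a (n + k)) = c%:C%C * X.
  by rewrite -csumZ//; apply: eq_csum => n; rewrite ac; ring.
have -> : csum (fun n => (a n)^*%C * cub a (n + k)) = c%:C%C * corr a k.
  by rewrite corr_shift -csumZ//; apply: eq_csum => n; rewrite ac; ring.
have -> : csum (fun p => la p * (cub a (p - k))^*%C) = c%:C%C * (X + (l k)%:C%C * corr a k).
  rewrite -(csum_bij _ (bij_shift k)) corr_shift -csumZ// -csumD//; last exact: summZ.
  rewrite -csumZ; last by apply: summD => //; exact: summZ.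
  apply: eq_csum => n; rewrite /comp addrK ac /la lkn.
  by rewrite (conjcM (l n)%:C%C) conjcR (conjcM c%:C%C) conjcR rmorphD; ring.
set Y := corr a k => h.
have /eqP : c%:C%C * ((l k)%:C%C * Y) = 0.
  have gen (x y z w : R[i]) : 2 * (x * y) = 2 * (x * (y + z * w)) - z * (x * w) -> x * (z * w) = 0.
    move=> e; have -> : x * (z * w) = 2 * (x * (y + z * w)) - z * (x * w) - 2 * (x * y) by ring.
    by rewrite -e subrr.
  by rewrite (gen _ _ _ _ h).
rewrite !mulf_eq0 => /or3P[|| /eqP//].
  by move=> /eqP[] h1; rewrite h1 eqxx in c0.
by move=> /eqP[] h1; rewrite h1 eqxx in lk.
Qed.

Lemma l1_wt n : `|n.1%:~R : R| <= wt n.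
Proof.
rewrite /wt -intr_norm -natr_absz ler_nat (leq_trans (leq_maxl _ `|n.2|%N))//.
Qed.

Lemma l2_wt n : `|n.2%:~R : R| <= wt n.
Proof.
rewrite /wt -intr_norm -natr_absz ler_nat (leq_trans (leq_maxr `|n.1|%N _))//.
Qed.

(** A solution of [|w|^2 w = c w] takes values of modulus [0] or [sqrt c]; in [H^1]
    it cannot jump between the two, so [|w|^2] is constant. *)
Lemma corr_delta a A (c : R) k : inh1 a A ->
  (forall n, cub a n = c%:C%C * a n) -> c != 0 -> k != 0 -> corr a k = 0.
Proof.
move=> aA ac c0; case: k => x y k0.
have [x0|x0] := eqVneq x 0; last first.
  apply: (corr_rigid (l := fun n => n.1%:~R) aA _ l1_wt ac c0); last by rewrite intr_eq0.
  by move=> m n; rewrite rmorphB.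
apply: (corr_rigid (l := fun n => n.2%:~R) aA _ l2_wt ac c0).
  by move=> m n; rewrite rmorphB.
by rewrite intr_eq0 /=; move: k0; rewrite x0; apply: contraNneq => ->.
Qed.

(** At [k = 0] the identity [quartic_moment] equates the sum with its conjugate;
    this is the conservation of momentum. *)
Lemma quartic_real a A (l : lattice -> R) :
  inh1 a A -> (forall m n, l (m - n) = l m - l n) -> (forall n, `|l n| <= wt n) ->
  complex.Im (csum (fun n => (l n)%:C%C * ((a n)^*%C * cub a n))) = 0.
Proof.
move=> aA lB lwt.
have := quartic_moment aA lB lwt 0.
have -> : l 0 = 0 by rewrite -[X in l X](subrr (0 : lattice)) lB subrr.
under eq_csum do rewrite addr0.
under [in RHS]eq_csum do rewrite subr0.
rewrite mul0r subr0.
have -> : csum (fun n => ((l n)%:C%C * a n)^*%C * cub a n) =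
          csum (fun n => (l n)%:C%C * ((a n)^*%C * cub a n)).
  by apply: eq_csum => n; rewrite conjcM conjcR mulrA.
have -> : csum (fun p => (l p)%:C%C * a p * (cub a p)^*%C) =
          (csum (fun n => (l n)%:C%C * ((a n)^*%C * cub a n)))^*%C.
  by rewrite -csum_conj; apply: eq_csum => n; rewrite !conjcM conjcR conjcK mulrA.
have key (z : R[i]) : 2 * z = 2 * z^*%C -> complex.Im z = 0.
  have n2 : (2 : R[i]) != 0 by rewrite pnatr_eq0.
  by move=> /(mulfI n2); case: z => u v [] /= h; lra.
exact: key.
Qed.

End Quartic.

(** * Unimodular sequences *)

Section Unimodular.
Context {R : realType}.
Implicit Types (n p q r k m : lattice) (y z : lattice -> R[i]).

Variables (a : lattice -> R[i]) (A : R).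
Hypothesis aA : inh1 a A.
Hypothesis acorr : forall k, k != 0 -> corr a k = 0.

Let a2 : inl2 a A := inh1_l2 aA.

Definition mass : R := nsum (fun n => modulus (a n) ^+ 2).

Let c := mass.
Let c0 : 0 <= c. Proof. by apply: nsum_ge0 => n; exact: sqr_ge0. Qed.

Lemma corr0 : corr a 0 = c%:C%C.
Proof.
rewrite /corr /c /mass -(csum_ge0E (A := A))//; last by move=> n; exact: sqr_ge0.
by apply: eq_csum => n; rewrite subr0 mulJc.
Qed.

(** Fourier coefficients of the product of [y] with the conjugate of [a]. *)
Definition cmul y k : R[i] := csum (fun n => y n * (a (n - k))^*%C).

Let ash k : inl2 (fun n => (a (n - k))^*%C) A.
Proof. by apply: inl2_conj; exact: inl2_shift. Qed.

Lemma cmul_summ y Y k : inl2 y Y -> summ (fun n => y n * (a (n - k))^*%C).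
Proof. by move=> yY; exists (Num.sqrt Y * Num.sqrt A); apply: inl2_mul. Qed.

Lemma corrE k k' : csum (fun n => (a (n - k))^*%C * a (n - k')) = corr a (k - k').
Proof.
rewrite /corr -(csum_bij (fun n => (a (n - k))^*%C * a (n - k')) (bij_shift k')).
by apply: eq_csum => n /=; rewrite mulrC addrK opprB addrA.
Qed.

(** Vanishing autocorrelation makes the translates of [a] orthogonal, so that
    [cmul] is, up to the factor [sqrt c], the adjoint of an isometry. *)
Lemma cmul_l2 y Y : inl2 y Y -> inl2 (cmul y) (c * Y).
Proof.
move=> yY K uK; have Y0 := sumle_ge0 yY.
set S := \sum_(k <- K) _.
have S0 : 0 <= S by apply: sumr_ge0 => k _; exact: sqr_ge0.
pose g := cmul y.
pose v n := \sum_(k <- K) (g k)^*%C * (a (n - k))^*%C.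
pose F (p : lattice * lattice) n := ((g p.1)^*%C * g p.2) * ((a (n - p.1))^*%C * a (n - p.2)).
have sF (x : lattice * lattice) : summ (F x).
  apply: summZ; exists (Num.sqrt A * Num.sqrt A).
  by apply: inl2_mul => //; exact: inl2_shift.
have [E sv] := csum_sum (allpairs pair K K) sF.
have vF n : (modulus (v n) ^+ 2)%:C%C = \sum_(p <- allpairs pair K K) F p n.
  rewrite big_allpairs -mulJc /v conjc_sum mulr_suml; apply: eq_bigr => i _.
  rewrite mulr_sumr; apply: eq_bigr => j _.
  by rewrite /F !conjcM !conjcK; ring.
(* [v] tests [y] against the translates of [a]: orthogonality gives its norm *)
have v2 : inl2 v (c * S).
  have [B hB] : exists B, inl2 v B.
    have [B hB] := sv; exists B; apply: sumle_le hB => n.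
    by rewrite -vF modulusC ger0_norm ?sqr_ge0.
  have -> : c * S = nsum (fun n => modulus (v n) ^+ 2).
    apply: complexI; rewrite -(csum_ge0E (A := B))//; last by move=> n; exact: sqr_ge0.
    under [RHS]eq_csum do rewrite vF.
    rewrite E big_allpairs /S mulr_sumr realc_sum big_seq [RHS]big_seq; apply: eq_bigr => i iK.
    rewrite (bigD1_seq i)//= big1 ?addr0; last first.
      move=> j ji; rewrite csumZ; last first.
        by exists (Num.sqrt A * Num.sqrt A); apply: inl2_mul => //; exact: inl2_shift.
      by rewrite corrE acorr ?mulr0// subr_eq0 eq_sym.
    rewrite csumZ; last first.
      by exists (Num.sqrt A * Num.sqrt A); apply: inl2_mul => //; exact: inl2_shift.
    by rewrite corrE subrr corr0 mulrC [_^*%C * _]mulrC mulJc -rmorphM.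
  by apply: sumle_nsum hB => n; exact: sqr_ge0.
have sG k : summ (fun n => (g k)^*%C * (y n * (a (n - k))^*%C)).
  by apply: summZ; exact: cmul_summ yY.
have [E2 _] := csum_sum K sG.
have SE : S%:C%C = csum (fun n => y n * v n).
  have -> : csum (fun n => y n * v n) = \sum_(k <- K) csum (fun n => (g k)^*%C * (y n * (a (n - k))^*%C)).
    rewrite -E2; apply: eq_csum => n; rewrite /v mulr_sumr; apply: eq_bigr => k _; ring.
  rewrite /S realc_sum; apply: eq_bigr => k _; rewrite csumZ; last exact: cmul_summ yY.
  by rewrite -/(cmul y k) -/g mulrC mulJc.
have : S <= Num.sqrt Y * Num.sqrt (c * S).
  have := csum_le (inl2_mul yY v2); rewrite -SE modulusC ger0_norm//.
move=> h; have [->|Sn] := eqVneq S 0; first exact: mulr_ge0.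
have Sp : 0 < S by rewrite lt_neqAle eq_sym Sn.
have : S ^+ 2 <= Y * (c * S).
  rewrite -sqr_sqrtM ?mulr_ge0// ler_pXn2r ?nnegrE ?mulr_ge0 ?sqrtr_ge0//.
by rewrite expr2 mulrA [Y * c]mulrC ler_pM2r.
Qed.

Let delta0 : inh1 (fun n : lattice => ((n == 0)%:R : R[i])) 1.
Proof.
have h : sumle (fun n : lattice => if n == 0 then 1 else 0 : R) 1.
  have := @sumle_seq R _ (fun n : lattice => if n == 0 then 1 else 0) [:: 0] isT.
  rewrite big_seq1 eqxx; apply => [i|i]; first by case: eqP.
  by rewrite inE => /negPf ->.
apply: sumle_le h => n; case: eqP => [->|_]; last by rewrite modulus0 mulr0 expr0n.
by rewrite (_ : true%:R = 1)// modulus1 mulr1 /wt /sz /= maxnn expr1n.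
Qed.

(** Associativity of the product, as the product of [a] with its conjugate is the
    constant [c]. *)
Lemma cmulK y Y m : inl2 y Y -> csum (fun k => a (m - k) * cmul y k) = c%:C%C * y m.
Proof.
move=> yY.
have [t [t0 ht tt]] := tri_dom aA aA delta0.
have row n : sumle (fun k => modulus (a (m - k)) * modulus (a (n - k))) (t (m - n)).
  have ie : injective (fun k : lattice => (m - k, n - k)).
    by move=> k k' /pair_equal_spec[/addrI /oppr_inj].
  have := sumle_inj ie (ht (m - n)); apply: sumle_le => k /=.
  have -> : m - n - (m - k) + (n - k) = 0 by ring.
  by rewrite eqxx mulr1 modulusM modulusJ.
pose F n k := y n * ((a (n - k))^*%C * a (m - k)).
have sF : summ (fun p : lattice * lattice => F p.1 p.2).
  exists (Num.sqrt Y * Num.sqrt (kappa * (A * A * 1))).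
  apply: (sumle_pair (F := fun n k => modulus (F n k)) (g := fun n => modulus (y n) * t (m - n))).
  - by move=> *; exact: modulus_ge0.
  - move=> n; apply: sumle_le (sumleZ (modulus_ge0 (y n)) (row n)) => k.
    by rewrite /F !modulusM modulusJ [modulus (a (m - k)) * _]mulrC.
  - apply: sumle_cauchy_schwarz yY _.
    have ie : injective (fun n : lattice => m - n) by move=> n n' /addrI /oppr_inj.
    exact: (sumle_inj ie tt).
have sw : bijective (fun p : lattice * lattice => (p.2, p.1)) by exists (fun p : lattice * lattice => (p.2, p.1)) => -[].
transitivity (csum (fun p : lattice * lattice => F p.2 p.1)).
  rewrite (csum_pair (F := fun k n => F n k)); last exact: (summ_inj (bij_inj sw) sF).
  apply: eq_csum => k; rewrite -csumZ; last exact: cmul_summ yY.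
  by apply: eq_csum => n; rewrite /F; ring.
rewrite (csum_bij (fun p : lattice * lattice => F p.1 p.2) sw) csum_pair//.
have row0 n : summ (fun k => (a (n - k))^*%C * a (m - k)).
  by exists (t (m - n)); apply: sumle_le (row n) => k; rewrite modulusM modulusJ mulrC.
have Eh n : csum (fun k => (a (n - k))^*%C * a (m - k)) = corr a (m - n).
  have bm : bijective (fun k : lattice => m - k).
    by exists (fun k : lattice => m - k) => k; rewrite subKr.
  rewrite /corr -[in RHS](csum_bij _ bm); apply: eq_csum => k /=.
  by rewrite mulrC; congr (_ * (a _)^*%C); ring.
rewrite (csum_seq (s := [:: m]))//.
  by rewrite big_seq1 csumZ// Eh subrr corr0 mulrC.
move=> n; rewrite inE => nm; rewrite csumZ// Eh acorr ?mulr0// subr_eq0 eq_sym//.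
Qed.

Definition inner y z : R[i] := csum (fun n => y n * (z n)^*%C).

Lemma inner_summ y z Y Z : inl2 y Y -> inl2 z Z -> summ (fun n => y n * (z n)^*%C).
Proof. by move=> yY zZ; exists (Num.sqrt Y * Num.sqrt Z); apply: inl2_mul => //; exact: inl2_conj. Qed.

Lemma inner_le y z Y Z : inl2 y Y -> inl2 z Z -> modulus (inner y z) <= Num.sqrt Y * Num.sqrt Z.
Proof. by move=> yY zZ; apply: csum_le; apply: inl2_mul => //; exact: inl2_conj. Qed.

Lemma inner_cmul_fin (s : seq lattice) y z Z : uniq s -> inl2 z Z ->
  (forall n, n \notin s -> y n = 0) -> inner (cmul y) (cmul z) = c%:C%C * inner y z.
Proof.
move=> us zZ ys.
have zc := cmul_l2 zZ.
pose F (n k : lattice) := y n * (a (n - k) * cmul z k)^*%C.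
have am n : inl2 (fun k => a (n - k)) A.
  by have := sumle_inj (e := fun k : lattice => n - k) _ a2; apply=> k k' /addrI /oppr_inj.
have sF n : summ (F n).
  apply: summZ; exists (Num.sqrt A * Num.sqrt (c * Z)).
  have := inl2_mul (am n) zc; apply: sumle_le => k.
  by rewrite modulusJ.
have [E _] := csum_sum s sF.
transitivity (csum (fun k => \sum_(n <- s) F n k)).
  apply: eq_csum => k; rewrite /cmul (csum_seq us); last by move=> n /ys ->; rewrite mul0r.
  rewrite mulr_suml; apply: eq_bigr => n _; rewrite /F conjcM -/(cmul z k); ring.
rewrite E /inner (csum_seq us); last by move=> n /ys ->; rewrite mul0r.
rewrite mulr_sumr; apply: eq_bigr => n _.
rewrite /F csumZ; last first.
  exists (Num.sqrt A * Num.sqrt (c * Z)).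
  by have := inl2_mul (am n) zc; apply: sumle_le => k; rewrite modulusJ.
by rewrite csum_conj (cmulK n zZ) conjcM conjcR; ring.
Qed.

(** Both sides are continuous in [y], so [inner_cmul_fin] extends by density. *)
Lemma inner_cmul y z Y Z : inl2 y Y -> inl2 z Z ->
  inner (cmul y) (cmul z) = c%:C%C * inner y z.
Proof.
move=> yY zZ.
have Z0 := sumle_ge0 zZ.
apply/eqP; rewrite -subr_eq0; apply/eqP/modulus_eq0/eqP.
rewrite eq_le modulus_ge0 andbT; apply/ler_addgt0Pr => e e0; rewrite add0r.
pose M := 2 * c * Num.sqrt Z + 1.
have M0 : 0 < M by rewrite ltr_wpDl// !mulr_ge0 ?sqrtr_ge0.
have eM2 : 0 < (e / M) ^+ 2 by rewrite exprn_gt0 ?divr_gt0.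
have [s us hs] := nsum_approx (fun n => sqr_ge0 (modulus (y n))) yY eM2.
pose y1 n := if n \in s then y n else 0.
pose y2 n := if n \in s then 0 else y n.
have y1Y : inl2 y1 Y.
  by apply: sumle_le yY => n; rewrite /y1; case: ifP => // _; rewrite modulus0 expr0n sqr_ge0.
have y2e : inl2 y2 ((e / M) ^+ 2).
  by apply: sumle_le hs => n; rewrite /y2; case: ifP => // _; rewrite modulus0 expr0n.
have yE : y = fun n => y1 n + y2 n.
  by apply/funext => n; rewrite /y1 /y2; case: ifP; rewrite ?addr0 ?add0r.
have cE : cmul y = fun k => cmul y1 k + cmul y2 k.
  apply/funext => k; rewrite /cmul -csumD; [|exact: cmul_summ y1Y|exact: cmul_summ y2e].
  by apply: eq_csum => n; rewrite [in LHS]yE mulrDl.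
have y1s n : n \notin s -> y1 n = 0 by rewrite /y1 => /negPf ->.
have E1 := inner_cmul_fin us zZ y1s.
have -> : inner (cmul y) (cmul z) = inner (cmul y1) (cmul z) + inner (cmul y2) (cmul z).
  rewrite {1}/inner cE.
  rewrite -csumD; [|exact: (inner_summ (cmul_l2 y1Y) (cmul_l2 zZ))|exact: (inner_summ (cmul_l2 y2e) (cmul_l2 zZ))].
  by apply: eq_csum => n; rewrite mulrDl.
have -> : inner y z = inner y1 z + inner y2 z.
  rewrite -csumD; [|exact: (inner_summ y1Y zZ)|exact: (inner_summ y2e zZ)].
  by apply: eq_csum => n; rewrite [in LHS]yE mulrDl.
rewrite E1 mulrDr opprD addrACA subrr add0r.
apply: le_trans (modulusB _ _) _; rewrite modulusM modulusC ger0_norm//.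
have h1 := inner_le (cmul_l2 y2e) (cmul_l2 zZ).
have h2 := ler_wpM2l c0 (inner_le y2e zZ).
have eM : 0 <= e / M by rewrite divr_ge0 ?ltW.
rewrite (sqrtrM ((e / M) ^+ 2) c0) (sqrtrM Z c0) in h1.
rewrite sqrtr_sqr ger0_norm// in h1 h2.
apply: le_trans (lerD h1 h2) _.
have -> : Num.sqrt c * (e / M) * (Num.sqrt c * Num.sqrt Z) + c * (e / M * Num.sqrt Z) =
  (Num.sqrt c ^+ 2 + c) * (e / M * Num.sqrt Z) by ring.
rewrite sqr_sqrtr//.
have -> : (c + c) * (e / M * Num.sqrt Z) = (2 * c * Num.sqrt Z) / M * e by ring.
apply: ler_piMl; first exact: ltW.
by rewrite ler_pdivrMr// mul1r /M lerDl.
Qed.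

Section Momentum.
Variable l : lattice -> R.
Hypothesis lB : forall m n, l (m - n) = l m - l n.
Hypothesis lwt : forall n, `|l n| <= wt n.

Definition moment n : R[i] := (l n)%:C%C * a n.

Lemma moment_l2 : inl2 moment A.
Proof. exact: inl2_la. Qed.

(** The current [conj w grad w] of a function of constant modulus is purely
    imaginary. *)
Lemma cmul_moment_herm k : (cmul moment (- k))^*%C = cmul moment k.
Proof.
have l0 : l 0 = 0 by rewrite -[X in l X](subrr (0 : lattice)) lB subrr.
have lk0 : (l k)%:C%C * corr a k = 0.
  by have [->|k0] := eqVneq k 0; [rewrite l0 mul0r|rewrite acorr// mulr0].
have s1 := cmul_summ k moment_l2.
have s2 : summ (fun n => a n * (a (n - k))^*%C).
  by exists (Num.sqrt A * Num.sqrt A); apply: inl2_mul.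
rewrite -[RHS]subr0 -lk0 /corr -csumZ// /cmul -csumB//; last exact: summZ.
rewrite -csum_conj -[in RHS](csum_bij _ (bij_shift k)); apply: eq_csum => n /=.
have lk : l (n + k) = l n + l k.
  by rewrite -[k in LHS]opprK lB -[- k]sub0r lB l0 sub0r opprK.
by rewrite addrK opprK /moment !conjcM conjcR conjcK lk rmorphD; ring.
Qed.

End Momentum.

Lemma cmul_shift y k j : cmul (fun n => y (n - k)) j = cmul y (j - k).
Proof.
rewrite /cmul -(csum_bij _ (bij_shift k)); apply: eq_csum => n /=.
by rewrite addrK; congr (_ * (a _)^*%C); ring.
Qed.

Let x1 := moment (fun n => n.1%:~R).
Let x2 := moment (fun n => n.2%:~R).
Let lB1 (m n : lattice) : (m - n).1%:~R = m.1%:~R - n.1%:~R :> R. Proof. exact: rmorphB. Qed.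
Let lB2 (m n : lattice) : (m - n).2%:~R = m.2%:~R - n.2%:~R :> R. Proof. exact: rmorphB. Qed.
Let x1A : inl2 x1 A. Proof. exact: (moment_l2 l1_wt). Qed.
Let x2A : inl2 x2 A. Proof. exact: (moment_l2 l2_wt). Qed.

(** The current [conj w grad w] of a function of constant modulus is curl-free:
    its rotational is an antisymmetric product of the gradients, which the
    isometry [inner_cmul] turns into the antisymmetrisation of a product of two
    Hermitian sequences. *)
Lemma current_curl_free k :
  c != 0 -> (k.2%:~R)%:C%C * cmul x1 k = (k.1%:~R)%:C%C * cmul x2 k.
Proof.
move=> cn0.
have x1k : inl2 (fun n => x1 (n - k)) A by exact: (inl2_shift (- k) x1A).
have x2k : inl2 (fun n => x2 (n - k)) A by exact: (inl2_shift (- k) x2A).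
have sym : inner x2 (fun n => x1 (n - k)) = inner x1 (fun n => x2 (n - k)).
  have cc : c%:C%C != 0 :> R[i] by apply: contra_neq cn0 => /complexI.
  apply: (mulfI cc); rewrite -(inner_cmul x2A x1k) -(inner_cmul x1A x2k).
  have bk : bijective (fun j : lattice => k - j).
    by exists (fun j : lattice => k - j) => j; rewrite subKr.
  rewrite /inner -[in RHS](csum_bij _ bk); apply: eq_csum => j; rewrite /comp !cmul_shift.
  have -> : j - k = - (k - j) by rewrite opprB.
  have -> : k - j - k = - j by ring.
  by rewrite (cmul_moment_herm lB1 l1_wt) (cmul_moment_herm lB2 l2_wt) mulrC.
apply/eqP; rewrite -subr_eq0; apply/eqP.
move/eqP: sym; rewrite -subr_eq0 => /eqP <-.
rewrite /cmul /inner -csumZ; last exact: cmul_summ x1A.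
rewrite -csumZ; last exact: cmul_summ x2A.
rewrite -!csumB.
- apply: eq_csum => n; rewrite /x1 /x2 /moment lB1 lB2 !conjcM !conjcR !rmorphB; ring.
- exact: inner_summ x2A x1k.
- exact: inner_summ x1A x2k.
- by apply: summZ; exact: cmul_summ x1A.
- by apply: summZ; exact: cmul_summ x2A.
Qed.

(** A curl-free and divergence-free current on the torus is constant, and a
    function whose logarithmic gradient is constant is a single exponential. *)
Lemma single_mode m m' :
  (forall k, (k.1%:~R)%:C%C * cmul x1 k + (k.2%:~R)%:C%C * cmul x2 k = 0) ->
  a m != 0 -> a m' != 0 -> m = m'.
Proof.
move=> div am am'.
have cn0 : c != 0.
  apply: contra_neq am => c00; apply: modulus_eq0.
  have := sumle_term m (sumle_nsum (fun n => sqr_ge0 (modulus (a n))) a2).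
  rewrite -/mass -/c c00 => h; apply/eqP; rewrite -sqrf_eq0 eq_le h sqr_ge0//.
have cc : c%:C%C != 0 :> R[i] by apply: contra_neq cn0 => /complexI.
have J0 k : k != 0 -> cmul x1 k = 0 /\ cmul x2 k = 0.
  move=> k0; have h1 := div k; have h2 := current_curl_free k cn0.
  set u : R[i] := (k.1%:~R)%:C%C in h1 h2; set v : R[i] := (k.2%:~R)%:C%C in h1 h2.
  have uv : u ^+ 2 + v ^+ 2 != 0.
    rewrite /u /v -!realcX -realcD; apply: contra_neq k0 => /complexI/eqP.
    rewrite paddr_eq0 ?sqr_ge0// !sqrf_eq0 !intr_eq0 => /andP[/eqP h3 /eqP h4].
    by case: k h3 h4 {h1 h2 u v} => ? ? /= -> ->.
  split; apply: (mulfI uv); rewrite mulr0.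
    have -> : (u ^+ 2 + v ^+ 2) * cmul x1 k = u * (u * cmul x1 k) + v * (v * cmul x1 k) by ring.
    by rewrite h2 [v * (u * _)]mulrCA -mulrDr h1 mulr0.
  have -> : (u ^+ 2 + v ^+ 2) * cmul x2 k = u * (u * cmul x2 k) + v * (v * cmul x2 k) by ring.
  by rewrite -h2 [u * (v * _)]mulrCA -mulrDr h1 mulr0.
have H x (X : inl2 x A) (Jx : forall k, k != 0 -> cmul x k = 0) n : a n * cmul x 0 = c%:C%C * x n.
  rewrite -(cmulK n X) (csum_seq (s := [:: 0]))//; first by rewrite big_seq1 subr0.
  by move=> k; rewrite inE => /Jx ->; rewrite mulr0.
have Q (l : lattice -> R) (X : inl2 (moment l) A) (Jx : forall k, k != 0 -> cmul (moment l) k = 0) :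
    l m = l m'.
  have G n : a n != 0 -> cmul (moment l) 0 = c%:C%C * (l n)%:C%C.
    by move=> an; apply: (mulfI an); rewrite (H _ X Jx) /moment; ring.
  by have := G m am; rewrite (G m' am') => /(mulfI cc)/complexI.
have e1 := Q _ x1A (fun k h => proj1 (J0 k h)).
have e2 := Q _ x2A (fun k h => proj2 (J0 k h)).
move: e1 e2 => /eqP; rewrite eqr_int => /eqP e1 /eqP; rewrite eqr_int => /eqP.
by case: m m' e1 {am am' Q} => ? ? [? ?] /= -> ->.
Qed.

End Unimodular.

(** ** Free solutions of constant modulus *)

Section FreeUnimodular.
Context {R : realType}.
Implicit Types (n k m : lattice).

Lemma mvt_bound (f df : R -> R) (M x y : R) :
  (forall z : R, is_derive z (1 : R) f (df z)) ->
  (forall z, `|z - x| <= `|y - x| -> `|df z| <= M) -> `|f y - f x| <= M * `|y - x|.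
Proof.
move=> fd fM.
have cf a b : {within `[a, b], continuous f}.
  by apply/continuous_subspaceT => r; exact/differentiable_continuous/derivable1_diffP.
have [xy|yx] := leP x y.
  have [c cxy ->] := MVT_segment xy (fun z _ => fd z) (cf x y).
  rewrite normrM ler_wpM2r// fM//.
  by move: cxy; rewrite in_itv/= => /andP[h1 h2]; rewrite !ger0_norm ?subr_ge0// lerD2r.
have [c cxy] := MVT_segment (ltW yx) (fun z _ => fd z) (cf y x).
rewrite distrC => ->; rewrite normrM [`|y - x|]distrC ler_wpM2r// fM//.
move: cxy; rewrite in_itv/= => /andP[h1 h2].
by rewrite distrC [leRHS]distrC !ger0_norm ?subr_ge0// ?lerD2l ?lerN2// ltW.
Qed.

Lemma cos_sub1_le (y : R) : `|cos y - 1| <= `|y|.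
Proof.
have := @mvt_bound cos (fun z => - sin z) 1 0 y (fun z => is_derive_cos z).
rewrite cos0 subr0 mul1r; apply => z _; rewrite normrN.
by rewrite ler_norml; have := sin_geN1 z; have := sin_le1 z; move=> -> ->.
Qed.

Lemma cis_taylor1 (y : R) : modulus (cis y - 1 - 'i%C * y%:C%C) <= 2 * y ^+ 2.
Proof.
have h1 : `|sin y - y| <= `|y| * `|y|.
  have dd (z : R) : is_derive z (1 : R) (fun x => sin x - x) (cos z - 1) by apply: is_deriveB.
  have := @mvt_bound (fun x => sin x - x) (fun z => cos z - 1) `|y| 0 y dd.
  rewrite sin0 !subr0; apply => z; rewrite subr0; exact: le_trans (cos_sub1_le z).
have h2 : `|cos y - 1| <= `|y| * `|y|.
  have := @mvt_bound cos (fun z => - sin z) `|y| 0 y (fun z => is_derive_cos z).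
  rewrite cos0 !subr0; apply => z; rewrite subr0 normrN => zy; apply: le_trans zy.
  have := @mvt_bound sin cos 1 0 z (fun z => is_derive_sin z).
  rewrite sin0 !subr0 mul1r; apply => x _.
  by rewrite ler_norml; have := cos_geN1 x; have := cos_le1 x; move=> -> ->.
apply: le_trans (modulus_le_ReIm _) _.
have -> : cis y - 1 - 'i%C * y%:C%C = Complex (cos y - 1) (sin y - y).
  by rewrite /cis; simpc; congr Complex; ring.
rewrite /= -[y ^+ 2]real_normK ?num_real// expr2; lra.
Qed.

Lemma freq2D n k : freq2 n - freq2 (n - k) =
  2 * (k.1%:~R * n.1%:~R + k.2%:~R * n.2%:~R) - freq2 k :> R.
Proof.
case: n k => [x y] [z w]; rewrite /freq2 /=.
rewrite !rmorphD !rmorphXn/= !rmorphD !rmorphN/=; ring.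
Qed.

Lemma wt_sub n k : wt n <= wt k * wt (n - k) :> R.
Proof.
rewrite /wt -natrM ler_nat.
have : (sz n <= sz k + sz (n - k)%R)%N.
  by case: n k => [x y] [z w]; rewrite /sz /=; lia.
by rewrite mulSn mulnS; lia.
Qed.

Lemma freq2_wt n : freq2 n <= 2 * wt n ^+ 2 :> R.
Proof.
have h1 := l1_wt (R := R) n; have h2 := l2_wt (R := R) n.
rewrite /freq2 rmorphD !rmorphXn/=.
rewrite -[_.1%:~R ^+ 2]real_normK ?num_real// -[_.2%:~R ^+ 2]real_normK ?num_real//.
have : `|n.1%:~R : R| ^+ 2 <= wt n ^+ 2 by rewrite ler_pXn2r ?nnegrE ?wt_ge0.
have : `|n.2%:~R : R| ^+ 2 <= wt n ^+ 2 by rewrite ler_pXn2r ?nnegrE ?wt_ge0.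
lra.
Qed.

Lemma freq2_ge0 n : 0 <= freq2 n :> R.
Proof. by rewrite /freq2 ler0z addr_ge0 ?sqr_ge0. Qed.

Lemma freq2_sub_le n k : `|freq2 n - freq2 (n - k)| <= 6 * wt k ^+ 2 * wt n :> R.
Proof.
rewrite freq2D; apply: le_trans (ler_normB _ _) _.
rewrite (ger0_norm (freq2_ge0 k)) normrM (ger0_norm (ler0n R 2)).
have h1 := l1_wt (R := R) n; have h2 := l2_wt (R := R) n.
have h3 := l1_wt (R := R) k; have h4 := l2_wt (R := R) k.
have h5 := freq2_wt k; have n1 := wt_ge1 (R := R) n; have k1 := wt_ge1 (R := R) k.
have : `|k.1%:~R * n.1%:~R + k.2%:~R * n.2%:~R : R| <= 2 * (wt k * wt n).
  apply: le_trans (ler_normD _ _) _; rewrite !normrM.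
  have := ler_pM (normr_ge0 _) (normr_ge0 _) h3 h1.
  have := ler_pM (normr_ge0 _) (normr_ge0 _) h4 h2; lra.
move: (wt n) (wt k) n1 k1 h5 => x y x1 y1 h5 h6.
have : y * x <= y ^+ 2 * x by rewrite ler_wpM2r ?expr2 ?ler_peMl//; lra.
have : y ^+ 2 <= y ^+ 2 * x by rewrite ler_peMr ?sqr_ge0.
lra.
Qed.

Variables (a : lattice -> R[i]) (A : R).
Hypothesis aA : inh1 a A.

(** A free solution whose modulus is constant in space at all times is a single
    mode: differentiating the vanishing autocorrelations in time at [0] yields
    the conservation law [div (conj w grad w) = 0]. *)
Lemma free_single_mode :
  (forall t k, k != 0 -> corr (fun n => cis (t * freq2 n) * a n) k = 0) ->
  exists n0, forall n, n != n0 -> a n = 0.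
Proof.
move=> ct.
have a2 := inh1_l2 aA.
have a0 k : k != 0 -> corr a k = 0.
  move=> k0; rewrite -(ct 0 k k0); congr (corr _ k); apply/funext => n.
  by rewrite mul0r cis0 mul1r.
have [[m am]|h] := pselect (exists m, a m != 0); last first.
  exists 0 => n _; apply/eqP; apply: contrapT => /negP an; apply: h; by exists n.
exists m => m' mm'; apply/eqP; apply: contraNT mm' => am'; apply/eqP.
apply: (single_mode aA a0) => // k.
have [->|k0] := eqVneq k 0; first by rewrite !mulr0z !mul0r addr0.
pose u n := a n * (a (n - k))^*%C.
pose s n : R := freq2 n - freq2 (n - k).
pose C : R := 6 * wt k ^+ 2.
have C0 : 0 <= C by rewrite mulr_ge0 ?sqr_ge0.
have su2 : sumle (fun n => wt n ^+ 2 * modulus (u n)) (wt k * A).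
  have h1 : sumle (fun n => (wt n * modulus (a n)) * (wt (n - k) * modulus (a (n - k)))) A.
    have := sumle_cauchy_schwarz aA (sumle_inj (e := fun n : lattice => n - k) (@addIr _ _) aA).
    apply: sumle_weak.
    by rewrite -expr2 sqr_sqrtr// (sumle_ge0 aA).
  apply: (sumle_scale (wt_ge0 k) h1) => // n.
  rewrite /u modulusM modulusJ.
  have := wt_sub n k; have := wt_ge0 (R := R) n.
  have := mulr_ge0 (modulus_ge0 (a n)) (modulus_ge0 (a (n - k))).
  rewrite expr2 => m0 w0 w1.
  have -> : wt k * (wt n * modulus (a n) * (wt (n - k) * modulus (a (n - k)))) =
    (wt k * wt (n - k)) * (wt n * (modulus (a n) * modulus (a (n - k)))) by ring.
  by rewrite -mulrA ler_wpM2r// mulr_ge0.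
pose D : R := 2 * C ^+ 2 * (wt k * A).
have su : summ u by exists (Num.sqrt A * Num.sqrt A); apply: inl2_mul (inl2_conj _) => //; exact: inl2_shift.
have sus : summ (fun n => (s n)%:C%C * u n).
  exists (C * (wt k * A)); apply: (sumle_scale C0 su2) => // n.
  rewrite modulusM modulusC mulrA ler_wpM2r ?modulus_ge0//.
  apply: le_trans (freq2_sub_le n k) _; rewrite -/C expr2 mulrA ler_peMr ?mulr_ge0 ?wt_ge0//.
  exact: wt_ge1.
have u0 : csum u = 0 by exact: a0.
set Z := csum (fun n => (s n)%:C%C * u n).
have Zt t : `|t| * modulus Z <= t ^+ 2 * D.
  have E : csum (fun n => (cis (t * s n) - 1 - 'i%C * (t * s n)%:C%C) * u n) = - ('i%C * t%:C%C) * Z.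
    have c1 : csum (fun n => cis (t * s n) * u n) = 0.
      rewrite -(ct t k k0); apply: eq_csum => n.
      rewrite /u /s conjcM conj_cis mulrBr cisD; ring.
    have sc : summ (fun n => cis (t * s n) * u n).
      have [B hB] := su; exists B; apply: sumle_le hB => n.
      by rewrite modulusM modulus_cis mul1r.
    transitivity (csum (fun n => cis (t * s n) * u n - u n - ('i%C * t%:C%C) * ((s n)%:C%C * u n))).
      by apply: eq_csum => n; rewrite realcM; ring.
    rewrite csumB; [|exact: summB|exact: summZ].
    by rewrite csumB// c1 u0 csumZ// subrr sub0r mulNr.
  have : modulus (- ('i%C * t%:C%C) * Z) <= t ^+ 2 * D.
    rewrite -E; apply: csum_le.
    apply: (sumle_scale (k := 2 * C ^+ 2 * t ^+ 2) _ su2).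
    - by apply: mulr_ge0; [apply: mulr_ge0|]; rewrite ?sqr_ge0.
    - move=> n; rewrite modulusM mulrA ler_wpM2r ?modulus_ge0//.
      apply: le_trans (cis_taylor1 _) _.
      have : s n ^+ 2 <= (C * wt n) ^+ 2.
        rewrite -[s n ^+ 2]real_normK ?num_real// ler_pXn2r ?nnegrE ?mulr_ge0 ?wt_ge0//.
        exact: freq2_sub_le.
      move=> /(ler_wpM2l (sqr_ge0 t)); rewrite !exprMn; lra.
    - by rewrite /D; lra.
  by rewrite modulusM modulusN modulusM modulus_i mul1r modulusC.
have Z0 : Z = 0.
  apply: modulus_eq0; apply/eqP; rewrite eq_le modulus_ge0 andbT.
  apply/ler_addgt0Pr => e e0; rewrite add0r.
  have D0 : 0 <= D by rewrite /D !mulr_ge0 ?sqr_ge0 ?wt_ge0 ?(sumle_ge0 aA).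
  pose t := e / (D + 1).
  have t0 : 0 < t by rewrite divr_gt0// ltr_wpDl.
  have := Zt t; rewrite gtr0_norm// expr2 -mulrA ler_pM2l// => h; apply: le_trans h _.
  rewrite /t mulrAC ler_pdivrMr ?ltr_wpDl//; nra.
have : 2 * ((k.1%:~R)%:C%C * cmul a (moment a (fun n => n.1%:~R)) k +
            (k.2%:~R)%:C%C * cmul a (moment a (fun n => n.2%:~R)) k) = 0.
  rewrite -[RHS]addr0 -{1}Z0 -[X in _ = _ + X](mulr0 ((freq2 k)%:C%C)) -u0 /Z.
  have s1 := cmul_summ aA k (moment_l2 aA l1_wt).
  have s2 := cmul_summ aA k (moment_l2 aA l2_wt).
  rewrite /cmul -!csumZ//.
  rewrite -!csumD//; try exact: summZ.
  rewrite -csumZ; last by apply: summD; exact: summZ.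
  apply: eq_csum => n; rewrite /u /s /moment freq2D !(realcB, realcM, realcD).
  have -> : (1 : R)%:C%C = 1 :> R[i] by [].
  ring.
by move=> /eqP; rewrite mulf_eq0 pnatr_eq0 => /eqP.
Qed.

End FreeUnimodular.

(** * Integration over the torus *)

Section TorusIntegration.
Context {R : realType}.

Notation T1 := (measurableTypeR R).
Notation T2 := (measurableTypeR R * measurableTypeR R)%type.
Notation mu1 := (@lebesgue_measure R).
Notation mu := (@lebesgue2 R).
Notation Q := (@fundamental_square R).
Notation side := (`[0, 2 * pi[%classic : set R).

Lemma pi2_gt0 : 0 < 2 * pi :> R.
Proof. by rewrite mulr_gt0// pi_gt0. Qed.

Lemma measurable_side : measurable (side : set T1).
Proof. exact: measurable_itv. Qed.

Lemma measurable_square : measurable (Q : set T2).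
Proof. by apply: measurableX; exact: measurable_side. Qed.

Lemma mu1_side : mu1 side = (2 * pi)%:E.
Proof. by rewrite lebesgue_measure_itv/= lte_fin pi2_gt0 -EFinB subr0. Qed.

Lemma mu_square : mu Q = ((2 * pi) ^+ 2)%:E.
Proof.
transitivity (mu1 side * mu1 side)%E.
  by apply: product_measure1E; exact: measurable_side.
by rewrite mu1_side -EFinM -expr2.
Qed.

Lemma mu_square_fin : (mu Q < +oo)%E.
Proof. by rewrite mu_square ltry. Qed.

Definition qint (f : R * R -> R) := mu.-integrable Q (EFin \o (f : T2 -> R)).

Notation mfun f := (measurable_fun [set: T2] (f : T2 -> R)).

Lemma mfun_sub (f : R * R -> R) : mfun f -> measurable_fun (Q : set T2) (f : T2 -> R).
Proof. by move=> mf; apply: measurable_funS mf. Qed.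

Lemma qint_bounded (f : R * R -> R) M : mfun f -> (forall x, `|f x| <= M) -> qint f.
Proof.
move=> mf fM; apply: measurable_bounded_integrable.
- exact: measurable_square.
- exact: mu_square_fin.
- exact: mfun_sub.
- by exists M; split; rewrite ?num_real// => N MN x _; apply: le_trans (fM x) (ltW MN).
Qed.

Lemma qint_le (f g : R * R -> R) : mfun f -> qint g -> (forall x, Q x -> `|f x| <= g x) -> qint f.
Proof.
move=> mf ig fg; apply: le_integrable ig; first exact: measurable_square.
  by apply/measurable_EFinP; exact: mfun_sub.
move=> x Qx /=; rewrite lee_fin; apply: le_trans (fg x Qx) (ler_norm _).
Qed.

Lemma qint_mulb (f h : R * R -> R) M : qint f -> mfun h -> (forall x, `|h x| <= M) ->
  qint (fun x => f x * h x).
Proof.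
move=> fi mh hM; rewrite /qint.
have := integrableMl measurable_square fi (mfun_sub mh); apply.
by exists M; split; rewrite ?num_real// => N MN x _; apply: le_trans (hM x) (ltW MN).
Qed.

Lemma mfun_cos (f : R * R -> R) : mfun f -> mfun (fun x => cos (f x)).
Proof.
move=> mf; apply: (@measurableT_comp _ _ _ _ _ _ (cos : T1 -> T1)) => //.
by apply: continuous_measurable_fun; exact: continuous_cos.
Qed.

Lemma mfun_dotp n : mfun (dotp n).
Proof.
by apply: measurable_funD; apply: measurable_funM.
Qed.

Lemma mfun_sin (f : R * R -> R) : mfun f -> mfun (fun x => sin (f x)).
Proof.
move=> mf; apply: (@measurableT_comp _ _ _ _ _ _ (sin : T1 -> T1)) => //.
by apply: continuous_measurable_fun; exact: continuous_sin.
Qed.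

Lemma mfun_wave b n : mfun (fun x => cos (b + dotp n x)).
Proof. by apply: mfun_cos; apply: measurable_funD => //; exact: mfun_dotp. Qed.

Lemma cos_norm (x : R) : `|cos x| <= 1.
Proof. by rewrite ler_norml cos_geN1 cos_le1. Qed.

Lemma sin_norm (x : R) : `|sin x| <= 1.
Proof. by rewrite ler_norml sin_geN1 sin_le1. Qed.

Lemma integral_cos1 (b : R) (k : int) : k != 0 ->
  (\int[mu1]_(y in side) (cos (b + k%:~R * y))%:E = 0)%E.
Proof.
move=> k0.
have kR : k%:~R != 0 :> R by rewrite intr_eq0.
rewrite integral_itv_bndo_bndc; last first.
  apply/measurable_EFinP; apply: measurable_funTS.
  apply: (@measurableT_comp _ _ _ _ _ _ (cos : T1 -> T1)).
    by apply: continuous_measurable_fun; exact: continuous_cos.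
  by apply: measurable_funD => //; exact: measurable_funM.
pose g (y : R) := b + k%:~R * y.
have dg (y : R) : is_derive y (1 : R) g k%:~R.
  rewrite /g; apply: is_derive_eq; rewrite add0r /GRing.scale /= mulr1.
  by rewrite mul1r.
pose F (y : R) := (k%:~R)^-1 * sin (g y).
have dF (y : R) : is_derive y (1 : R) F (cos (b + k%:~R * y)).
  have h := is_derive1_comp (is_derive_sin (g y)) (dg y).
  have -> : F = (k%:~R)^-1 *: (sin \o g) by [].
  by apply: is_derive_eq; rewrite /GRing.scale /= mulrC mulfK.
have cF : continuous F.
  by move=> y; exact/differentiable_continuous/derivable1_diffP.
rewrite (@continuous_FTC2 _ _ F) //.
- have := cis_periodic b k; rewrite /F /g mulr0 addr0 => -[_ ->].
  by rewrite subee.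
- exact: pi2_gt0.
- apply: continuous_subspaceT => y.
  have -> : (fun y : R => cos (b + k%:~R * y)) = cos \o g by [].
  apply: continuous_comp; last exact: continuous_cos.
  exact/differentiable_continuous/derivable1_diffP.
- split => //.
  + by apply: cvg_at_right_filter; exact: cF.
  + by apply: cvg_at_left_filter; exact: cF.
- by move=> y _; rewrite derive1E; have [_ <-] := dF y.
Qed.

Lemma qint_wave b n : qint (fun x => cos (b + dotp n x)).
Proof. by apply: (qint_bounded (M := 1)) => [|x]; [exact: mfun_wave|exact: cos_norm]. Qed.

Lemma Rintegral_wave b (n : int * int) : n != 0 ->
  Rintegral mu Q (fun x => cos (b + dotp n x)) = 0.
Proof.
move=> n0; rewrite /Rintegral integral_mkcond.
set f := (X in integral _ _ X).
have fi : mu.-integrable [set: T2] f.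
  by apply/(integrable_mkcond _ measurable_square); exact: qint_wave.
have in_side (x y : R) : ((x, y) \in (Q : set T2)) = (x \in side) && (y \in side).
  by apply/idP/andP; rewrite !inE => -[].
have [n2|n2] := eqVneq n.2 0.
  have n1 : n.1 != 0.
    by apply: contra_neq n0; move: n2; case: (n) => ? ? /= -> ->.
  rewrite -(integral21_prod_meas1 fi) integral0_eq// => y _.
  rewrite /fubini_G /f; have [ys|ys] := boolP (y \in side).
    transitivity (\int[mu1]_(x in side) (cos (b + n.1%:~R * x))%:E)%E; last exact: integral_cos1.
    rewrite [RHS]integral_mkcond; apply: eq_integral => x _.
    by rewrite !patchE in_side ys andbT /= /dotp /= n2 mul0r addr0.
  by rewrite integral0_eq// => x _; rewrite patchE in_side (negPf ys) andbF.
rewrite -(integral12_prod_meas1 fi) integral0_eq// => x _.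
rewrite /fubini_F /f; have [xs|xs] := boolP (x \in side).
  transitivity (\int[mu1]_(y in side) (cos ((b + n.1%:~R * x) + n.2%:~R * y))%:E)%E; last exact: integral_cos1.
  rewrite [RHS]integral_mkcond; apply: eq_integral => y _.
  by rewrite !patchE in_side xs /= /dotp /= addrA.
by rewrite integral0_eq// => y _; rewrite patchE in_side (negPf xs).
Qed.

(** ** Complex integrals *)

Definition cqint (f : R * R -> R[i]) :=
  qint (fun x => complex.Re (f x)) /\ qint (fun x => complex.Im (f x)).

Definition cmfun (f : R * R -> R[i]) :=
  mfun (fun x => complex.Re (f x)) /\ mfun (fun x => complex.Im (f x)).

Lemma qintD (f g : R * R -> R) : qint f -> qint g -> qint (fun x => f x + g x).
Proof. by move=> fi gi; have := integrableD measurable_square fi gi. Qed.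

Lemma qintB (f g : R * R -> R) : qint f -> qint g -> qint (fun x => f x - g x).
Proof. by move=> fi gi; have := integrableB measurable_square fi gi. Qed.

Lemma qintZ k (f : R * R -> R) : qint f -> qint (fun x => k * f x).
Proof. by move=> fi; have := integrableZl measurable_square k fi. Qed.

Lemma cqintD f g : cqint f -> cqint g -> cqint (fun x => f x + g x).
Proof.
move=> [f1 f2] [g1 g2]; split.
  by have := qintD f1 g1; congr qint; apply/funext => x; case: (f x) (g x) => ? ? [].
by have := qintD f2 g2; congr qint; apply/funext => x; case: (f x) (g x) => ? ? [].
Qed.

Lemma cqintZ k f : cqint f -> cqint (fun x => k * f x).
Proof.
move=> [f1 f2]; case: k => u v; split.
  have := qintB (qintZ u f1) (qintZ v f2); congr qint; apply/funext => x.
  by case: (f x).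
have := qintD (qintZ u f2) (qintZ v f1); congr qint; apply/funext => x.
by case: (f x).
Qed.

Lemma torus_integralD f g : cqint f -> cqint g ->
  torus_integral (fun x => f x + g x) = torus_integral f + torus_integral g.
Proof.
move=> [f1 f2] [g1 g2]; rewrite /torus_integral; simpc.
rewrite -(RintegralD measurable_square f1 g1) -(RintegralD measurable_square f2 g2).
by congr Complex; apply: eq_Rintegral => x _; case: (f x) (g x) => ? ? [].
Qed.

Lemma torus_integralZ k f : cqint f ->
  torus_integral (fun x => k * f x) = k * torus_integral f.
Proof.
move=> [f1 f2]; case: k => u v; rewrite /torus_integral; simpc.
rewrite -!(RintegralZl _ measurable_square f1) -!(RintegralZl _ measurable_square f2).
rewrite -(RintegralB measurable_square (qintZ u f1) (qintZ v f2)).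
rewrite -(RintegralD measurable_square (qintZ u f2) (qintZ v f1)).
by congr Complex; apply: eq_Rintegral => x _; case: (f x).
Qed.

Lemma cqint_sum {T : Type} (s : seq T) (F : T -> R * R -> R[i]) :
  (forall i, cqint (F i)) ->
  cqint (fun x => \sum_(i <- s) F i x) /\
  torus_integral (fun x => \sum_(i <- s) F i x) = \sum_(i <- s) torus_integral (F i).
Proof.
move=> Fi; elim: s => [|i s [IH1 IH2]].
  have -> : (fun x : R * R => \sum_(i <- [::]) F i x) = fun=> 0.
    by apply/funext => x; rewrite big_nil.
  have z : qint (fun=> 0) by apply: (qint_bounded (M := 0)) => // x; rewrite normr0.
  split; first by split.
  by rewrite big_nil /torus_integral /= Rintegral_cst ?mul0r//; exact: measurable_square.
have -> : (fun x : R * R => \sum_(j <- i :: s) F j x) = fun x => F i x + \sum_(j <- s) F j x.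
  by apply/funext => x; rewrite big_cons.
split; first exact: cqintD.
by rewrite torus_integralD// IH2 big_cons.
Qed.

Definition wave n (x : R * R) : R[i] := cis (dotp n x).

Lemma cqint_wave n : cqint (wave n).
Proof.
split; rewrite /wave /=.
  by have := qint_wave 0 n; congr qint; apply/funext => x; rewrite add0r.
have := qint_wave (- (pi / 2)) n; congr qint; apply/funext => x.
by rewrite addrC cosBpihalf.
Qed.

Lemma dotpD n m (x : R * R) : dotp (n + m) x = dotp n x + dotp m x.
Proof. by rewrite /dotp /= !rmorphD /=; ring. Qed.

Lemma dotpN n (x : R * R) : dotp (- n) x = - dotp n x.
Proof. by rewrite /dotp /= !rmorphN /=; ring. Qed.

Lemma waveD n m x : wave (n + m) x = wave n x * wave m x.
Proof. by rewrite /wave dotpD cisD. Qed.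

Lemma conj_wave n x : (wave n x)^*%C = wave (- n) x.
Proof. by rewrite /wave conj_cis dotpN. Qed.

Lemma wave0 x : wave 0 x = 1.
Proof. by rewrite /wave /dotp /= !mul0r addr0 cis0. Qed.

Lemma torus_integral_wave n :
  torus_integral (wave n) = ((2 * pi) ^+ 2)%:C%C * (n == 0)%:R.
Proof.
have [->|n0] := eqVneq n 0.
  rewrite mulr1; have -> : wave 0 = fun=> 1 by apply/funext => x; exact: wave0.
  rewrite /torus_integral /= !Rintegral_cst; try exact: measurable_square.
  by rewrite mul0r mul1r [X in fine X]mu_square.
rewrite mulr0 /torus_integral /wave /=; congr Complex.
  rewrite -[RHS](Rintegral_wave 0 n0); apply: eq_Rintegral => x _; by rewrite add0r.
rewrite -[RHS](Rintegral_wave (- (pi / 2)) n0); apply: eq_Rintegral => x _.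
by rewrite addrC cosBpihalf.
Qed.

End TorusIntegration.

(** ** Trigonometric polynomials *)

Section TrigPoly.
Context {R : realType}.
Notation mu := (@lebesgue2 R).
Notation Q := (@fundamental_square R).
Implicit Types (s : seq lattice) (c : lattice -> R[i]).

Definition trig s c (x : R * R) : R[i] := \sum_(n <- s) c n * wave n x.

Lemma fourierE f n : fourier f n =
  (((2 * pi) ^+ 2)^-1)%:C%C * torus_integral (fun x => wave (- n) x * f x) :> R[i].
Proof.
rewrite /fourier; congr (_ * torus_integral _); apply/funext => x.
by rewrite /wave dotpN.
Qed.

Lemma pi2sq_neq0 : ((2 * pi) ^+ 2)%:C%C != 0 :> R[i].
Proof.
apply/eqP => /complexI/eqP; rewrite sqrf_eq0; apply/negP.
by rewrite gt_eqF// pi2_gt0.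
Qed.

Lemma realcV (x : R) : (x^-1)%:C%C = (x%:C%C)^-1 :> R[i].
Proof. exact: fmorphV. Qed.

Lemma cqint_cwave (k : R[i]) n : cqint (fun x => k * wave n x).
Proof. by apply: cqintZ; exact: cqint_wave. Qed.

Lemma trig_cqint s c : cqint (trig s c).
Proof. by have [] := cqint_sum s (fun n => cqint_cwave (c n) n). Qed.

Lemma fourier_trig s c m : uniq s -> (forall n, n \notin s -> c n = 0) ->
  fourier (trig s c) m = c m.
Proof.
move=> us cs; rewrite fourierE.
have -> : (fun x => wave (- m) x * trig s c x) = fun x => \sum_(n <- s) c n * wave (n - m) x.
  apply/funext => x; rewrite /trig mulr_sumr; apply: eq_bigr => n _.
  by rewrite waveD; ring.
have [_ ->] := cqint_sum s (fun n => cqint_cwave (c n) (n - m)).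
have h n : torus_integral (fun x => c n * wave (n - m) x) =
    ((2 * pi) ^+ 2)%:C%C * (c n * (n == m)%:R).
  rewrite torus_integralZ; last exact: cqint_wave.
  by rewrite torus_integral_wave subr_eq0; ring.
under eq_bigr do rewrite h.
rewrite -mulr_sumr mulrA realcV mulVf ?pi2sq_neq0// mul1r.
have [ms|ms] := boolP (m \in s).
  rewrite (bigD1_seq m)//= eqxx mulr1 big1 ?addr0// => n nm.
  by rewrite (negPf nm) mulr0.
rewrite (cs m ms) big_seq big1// => n ns.
by rewrite (_ : n == m = false) ?mulr0//; apply: contraNF ms => /eqP <-.
Qed.

Let triples s := allpairs pair s (allpairs pair s s).

Lemma cubicE f (x : R * R) : cubic f x = f x * (f x)^*%C * f x :> R[i].
Proof. by rewrite /cubic mulJc. Qed.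

Lemma cubic_trig s c x : cubic (trig s c) x =
  \sum_(z <- triples s) (c z.1 * (c z.2.1)^*%C * c z.2.2) * wave (z.1 - z.2.1 + z.2.2) x.
Proof.
rewrite /triples big_allpairs cubicE -mulrA {1}/trig mulr_suml; apply: eq_bigr => p _.
rewrite big_allpairs /trig conjc_sum mulr_suml mulr_sumr; apply: eq_bigr => q _.
rewrite !mulr_sumr; apply: eq_bigr => r _ /=.
by rewrite conjcM conj_wave !waveD; ring.
Qed.

Lemma fourier_cubic_trig s c m : uniq s -> (forall n, n \notin s -> c n = 0) ->
  fourier (cubic (trig s c)) m = cub c m.
Proof.
move=> us cs; rewrite fourierE.
pose k (z : lattice * (lattice * lattice)) := c z.1 * (c z.2.1)^*%C * c z.2.2.
have -> : (fun x => wave (- m) x * cubic (trig s c) x) =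
    fun x => \sum_(z <- triples s) k z * wave (z.1 - z.2.1 + z.2.2 - m) x.
  apply/funext => x; rewrite cubic_trig mulr_sumr; apply: eq_bigr => z _.
  by rewrite (waveD _ (- m)) /k; ring.
have [_ ->] := cqint_sum (triples s) (fun z => cqint_cwave (k z) (z.1 - z.2.1 + z.2.2 - m)).
have h z : torus_integral (fun x => k z * wave (z.1 - z.2.1 + z.2.2 - m) x) =
    ((2 * pi) ^+ 2)%:C%C * (k z * (z.2.2 == m - z.1 + z.2.1)%:R).
  rewrite torus_integralZ; last exact: cqint_wave.
  rewrite torus_integral_wave.
  have -> : (z.1 - z.2.1 + z.2.2 - m == 0) = (z.2.2 == m - z.1 + z.2.1).
    by rewrite -[RHS]subr_eq0; congr (_ == 0); ring.
  by ring.
under eq_bigr do rewrite h.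
rewrite -mulr_sumr mulrA realcV mulVf ?pi2sq_neq0// mul1r.
rewrite /cub /tri (csum_seq (s := allpairs pair s s)).
- rewrite /triples !big_allpairs; apply: eq_bigr => p _; rewrite big_allpairs; apply: eq_bigr => q _.
  rewrite /k /=; set r := m - p + q.
  have [rs|rs] := boolP (r \in s).
    rewrite (bigD1_seq r)//= eqxx mulr1 big1 ?addr0// => n nm.
    by rewrite (negPf nm) mulr0.
  rewrite (cs r rs) mulr0 big_seq big1// => n ns.
  by rewrite (_ : n == r = false) ?mulr0//; apply: contraNF rs => /eqP <-.
- by apply: allpairs_uniq => // -[? ?] [? ?] _ _ [-> ->].
- move=> [p q] pq /=.
  have [ps|ps] := boolP (p \in s); last by rewrite (cs p ps) !mul0r.
  have [qs|qs] := boolP (q \in s); last by rewrite (cs q qs) conjc0 mulr0 mul0r.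
  by exfalso; move/negP: pq; apply; apply/allpairsP; exists (p, q).
Qed.

Lemma mfun_trig s c : cmfun (trig s c).
Proof.
have h n : cmfun (wave n : R * R -> R[i]).
  split; rewrite /wave /=; [apply: mfun_cos|apply: mfun_sin]; exact: mfun_dotp.
elim: s => [|n s [IH1 IH2]].
  have -> : trig [::] c = fun=> 0 by apply/funext => x; rewrite /trig big_nil.
  by split => /=.
have -> : trig (n :: s) c = fun x => c n * wave n x + trig s c x.
  by apply/funext => x; rewrite /trig big_cons.
have [h1 h2] := h n; case: (c n) => u v; split.
  apply: (eq_measurable_fun _ _ (measurable_funD (measurable_funB (measurable_funM (measurable_cst u) h1)
    (measurable_funM (measurable_cst v) h2)) IH1)) => x _ /=.
  by rewrite /wave /cis; case: (trig s c x).
apply: (eq_measurable_fun _ _ (measurable_funD (measurable_funD (measurable_funM (measurable_cst u) h2)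
  (measurable_funM (measurable_cst v) h1)) IH2)) => x _ /=.
by rewrite /wave /cis; case: (trig s c x).
Qed.

Lemma trig_bounded s c x : modulus (trig s c x) <= \sum_(n <- s) modulus (c n).
Proof.
rewrite /trig; apply: le_trans (modulus_sum _ _) _; apply: ler_sum => n _.
by rewrite modulusM /wave modulus_cis mulr1.
Qed.

(** The fourth power integral of a trigonometric polynomial is a quartic sum of
    its coefficients, hence controlled in [H^1]. *)
Lemma trig_L4 s c A : uniq s -> (forall n, n \notin s -> c n = 0) -> inh1 c A ->
  qint (fun x => modulus (trig s c x) ^+ 4) /\
  Rintegral mu Q (fun x => modulus (trig s c x) ^+ 4) <= ((2 * pi) ^+ 2) * ((1 + kappa) * A ^+ 2).
Proof.
move=> us cs cA.
pose F x := (trig s c x)^*%C * cubic (trig s c) x.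
have FE x : F x = (modulus (trig s c x) ^+ 4)%:C%C.
  by rewrite /F /cubic mulrCA [_^*%C * _]mulrC mulJc -realcM -exprD.
have FS x : F x = \sum_(m <- s) (c m)^*%C * (wave (- m) x * cubic (trig s c) x).
  rewrite /F {1}/trig conjc_sum mulr_suml; apply: eq_bigr => m _.
  by rewrite conjcM conj_wave; ring.
have Gi m : cqint (fun x => wave (- m) x * cubic (trig s c) x).
  have -> : (fun x => wave (- m) x * cubic (trig s c) x) = fun x =>
    \sum_(z <- triples s) (c z.1 * (c z.2.1)^*%C * c z.2.2) * wave (z.1 - z.2.1 + z.2.2 - m) x.
    apply/funext => x; rewrite cubic_trig mulr_sumr; apply: eq_bigr => z _.
    by rewrite (waveD _ (- m)); ring.
  by have [] := cqint_sum (triples s) (fun z => cqint_cwave (c z.1 * (c z.2.1)^*%C * c z.2.2) (z.1 - z.2.1 + z.2.2 - m)).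
have [Fi FI] := cqint_sum s (fun m => cqintZ (c m)^*%C (Gi m)).
have FF : F = fun x => \sum_(m <- s) (c m)^*%C * (wave (- m) x * cubic (trig s c) x).
  by apply/funext => x; exact: FS.
rewrite -FF in Fi FI.
split; first by have [+ _] := Fi; congr qint; apply/funext => x; rewrite FE.
have A0 := sumle_ge0 cA.
have c2 := inh1_l2 cA.
have E : torus_integral F = ((2 * pi) ^+ 2)%:C%C * csum (fun m => (c m)^*%C * cub c m).
  rewrite FI (csum_seq us); last by move=> m /cs ->; rewrite conjc0 mul0r.
  rewrite mulr_sumr; apply: eq_bigr => m _; rewrite torus_integralZ//.
  rewrite -(fourier_cubic_trig m us cs) fourierE realcV.
  by rewrite [RHS]mulrCA mulVKf ?pi2sq_neq0.
have -> : Rintegral mu Q (fun x => modulus (trig s c x) ^+ 4) = complex.Re (torus_integral F).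
  by rewrite /torus_integral /=; apply: eq_Rintegral => x _; rewrite FE.
apply: le_trans (ler_norm _) _; apply: le_trans (Re_le_modulus _) _.
rewrite E modulusM modulusC ger0_norm ?sqr_ge0// ler_wpM2l ?sqr_ge0//.
apply: le_trans (csum_le (inl2_mul (inl2_conj c2) (cub_l2 cA))) _.
have k0 := kappa_ge0 (R := R).
rewrite -ler_sqr ?nnegrE ?mulr_ge0 ?sqrtr_ge0 ?addr_ge0 ?sqr_ge0//.
rewrite sqr_sqrtM ?mulr_ge0//.
have : 0 <= A ^+ 4 by rewrite exprn_ge0.
have -> : A * (kappa * (A * A * A)) = kappa * A ^+ 4 by ring.
have -> : ((1 + kappa) * A ^+ 2) ^+ 2 = (1 + kappa) ^+ 2 * A ^+ 4 by ring.
by move=> a4; rewrite ler_wpM2r//; nra.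
Qed.

End TrigPoly.

(** ** Uniqueness of Fourier coefficients *)

Section Uniqueness.
Context {R : realType}.
Notation mu := (@lebesgue2 R).
Notation Q := (@fundamental_square R).
Notation T1 := (measurableTypeR R).
Notation T2 := (measurableTypeR R * measurableTypeR R)%type.
Notation mfun f := (measurable_fun [set: T2] (f : T2 -> R)).

(** Real trigonometric polynomials in phase-shift form; this presentation makes
    the closure under products a consequence of the product-to-sum formula. *)
Definition tpoly (p : R * R -> R) := exists s : seq (R * R * lattice),
  forall x, p x = \sum_(i <- s) i.1.1 * cos (i.1.2 + dotp i.2 x).

Lemma tpoly_wave b n : tpoly (fun x => cos (b + dotp n x)).
Proof. by exists [:: (1, b, n)] => x; rewrite big_seq1 mul1r. Qed.

Lemma tpoly_cst k : tpoly (fun=> k).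
Proof.
by exists [:: (k, 0, 0)] => x; rewrite big_seq1 /dotp /= !mul0r !addr0 cos0 mulr1.
Qed.

Lemma tpolyD p q : tpoly p -> tpoly q -> tpoly (fun x => p x + q x).
Proof. by move=> [s ps] [r qr]; exists (s ++ r) => x; rewrite big_cat /= -ps -qr. Qed.

Lemma tpolyZ k p : tpoly p -> tpoly (fun x => k * p x).
Proof.
move=> [s ps]; exists [seq (k * i.1.1, i.1.2, i.2) | i <- s] => x.
by rewrite big_map ps mulr_sumr; apply: eq_bigr => i _; rewrite /= mulrA.
Qed.

Lemma cos_mul (x y : R) : cos x * cos y = 2^-1 * cos (x + y) + 2^-1 * cos (x - y).
Proof. by rewrite cosD cosB; field. Qed.

Lemma tpolyM p q : tpoly p -> tpoly q -> tpoly (fun x => p x * q x).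
Proof.
move=> [s ps] [r qr].
pose f i j : R * R * lattice := (2^-1 * (i.1.1 * j.1.1), i.1.2 + j.1.2, i.2 + j.2).
pose g i j : R * R * lattice := (2^-1 * (i.1.1 * j.1.1), i.1.2 - j.1.2, i.2 - j.2).
exists (allpairs f s r ++ allpairs g s r) => x.
rewrite big_cat !big_allpairs_dep /= -big_split/= ps qr mulr_suml; apply: eq_bigr => i _.
rewrite mulr_sumr -big_split/=; apply: eq_bigr => j _.
rewrite !dotpD !dotpN mulrACA cos_mul.
have -> : i.1.2 + dotp i.2 x + (j.1.2 + dotp j.2 x) = i.1.2 + j.1.2 + (dotp i.2 x + dotp j.2 x) by ring.
have -> : i.1.2 + dotp i.2 x - (j.1.2 + dotp j.2 x) = i.1.2 - j.1.2 + (dotp i.2 x - dotp j.2 x) by ring.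
ring.
Qed.

Lemma tpolyX p k : tpoly p -> tpoly (fun x => p x ^+ k).
Proof.
move=> tp; elim: k => [|k IH]; first by under eq_fun do rewrite expr0; exact: tpoly_cst.
by under eq_fun do rewrite exprS; exact: tpolyM.
Qed.

Lemma tpoly_mfun p : tpoly p -> mfun p.
Proof.
move=> [s ps]; have -> : p = fun x => \sum_(i <- s) i.1.1 * cos (i.1.2 + dotp i.2 x) by exact/funext.
elim: s {ps} => [|i s IH].
  by rewrite (_ : (fun x : R * R => _) = cst 0)//; apply/funext => x; rewrite big_nil.
rewrite (_ : (fun x : R * R => _) =
    (fun x => i.1.1 * cos (i.1.2 + dotp i.2 x) + \sum_(j <- s) j.1.1 * cos (j.1.2 + dotp j.2 x))); last first.
  by apply/funext => x; rewrite big_cons.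
by apply: measurable_funD => //; apply: measurable_funM => //; exact: mfun_wave.
Qed.

(** [step N] approximates the indicator function of [x < 1/2] on the unit
    interval; the exponent [N * 2 ^ N] gives the value [0] in the limit at
    [1/2] as well. *)
Definition step (N : nat) (x : R) : R := (1 - x ^+ N) ^+ (N * 2 ^ N).

Lemma tpoly_step p N : tpoly p -> tpoly (fun x => step N (p x)).
Proof.
move=> tp; apply: tpolyX.
have := tpolyD (tpoly_cst 1) (tpolyZ (-1) (tpolyX N tp)).
by congr tpoly; apply/funext => x; rewrite mulN1r.
Qed.

Lemma step_itv N x : 0 <= x <= 1 -> 0 <= step N x <= 1.
Proof.
move=> /andP[x0 x1]; have h : 0 <= 1 - x ^+ N <= 1.
  by rewrite subr_ge0 exprn_ile1//= gerBl exprn_ge0.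
by move: h => /andP[h0 h1]; rewrite /step exprn_ge0//= exprn_ile1.
Qed.

Lemma bernoulli (y : R) n : 0 <= y <= 1 -> 1 - n%:R * y <= (1 - y) ^+ n.
Proof.
move=> /andP[y0 y1]; elim: n => [|n IH]; first by rewrite mul0r subr0 expr0.
rewrite exprS; have := ler_wpM2l (_ : 0 <= 1 - y) IH; rewrite subr_ge0 => /(_ y1).
apply: le_trans; rewrite -natr1.
have : 0 <= n%:R * y * y by rewrite !mulr_ge0.
by rewrite -subr_ge0; nra.
Qed.

Lemma bernoulli_inv (y : R) n : 0 <= y <= 1 -> (1 - y) ^+ n * (1 + n%:R * y) <= 1.
Proof.
move=> /andP[y0 y1]; elim: n => [|n IH]; first by rewrite mul0r addr0 mulr1.
have h : 0 <= (1 - y) ^+ n by rewrite exprn_ge0// subr_ge0.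
apply: le_trans IH; rewrite exprS -natr1.
have -> : (1 - y) * (1 - y) ^+ n * (1 + (n%:R + 1) * y) =
  (1 - y) ^+ n * ((1 - y) * (1 + (n%:R + 1) * y)) by ring.
apply: ler_wpM2l => //.
have : 0 <= n%:R * y * y by rewrite !mulr_ge0.
have : 0 <= y * y by rewrite mulr_ge0.
nra.
Qed.

Lemma natr_geo (z : R) : 0 <= z < 1 -> (N%:R * z ^+ N) @[N --> \oo] --> (0 : R).
Proof.
move=> /andP[z0 z1]; pose w := Num.sqrt z.
have w0 : 0 <= w by exact: sqrtr_ge0.
have w1 : w < 1 by rewrite -sqrtr1 ltr_sqrt.
have w2 : z = w * w by rewrite -expr2 sqr_sqrtr.
apply: (@squeeze_cvgr _ _ _ _ (fun=> 0) (fun N => (1 - w)^-1 * w ^+ N)).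
- apply: nearW => N; rewrite mulr_ge0 ?exprn_ge0//=.
  have : 0 <= 1 - w <= 1 by apply/andP; split; lra.
  move=> /bernoulli_inv -/(_ N); rewrite opprB addrCA subrr addr0 => h.
  have wN : 0 <= w ^+ N by rewrite exprn_ge0.
  rewrite w2 exprMn mulrA ler_wpM2r// -[(1 - w)^-1]mul1r ler_pdivlMr ?subr_gt0//.
  by apply: le_trans h; lra.
- exact: cvg_cst.
- rewrite -[X in _ --> X](mulr0 (1 - w)^-1); apply: cvgMr => //; apply: cvg_expr.
  by rewrite ger0_norm.
Qed.

(** Bernoulli's inequality bounds [step] from below for [x < 1/2] and from above
    otherwise. *)
Lemma step_cvg (x : R) : 0 <= x <= 1 -> (fun N => step N x) @ \oo --> (if x < 2^-1 then 1 else 0 : R).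
Proof.
move=> /andP[x0 x1].
have xN (N : nat) : 0 <= x ^+ N <= 1 by rewrite exprn_ge0//= exprn_ile1.
have [h|h] := ltP x 2^-1.
  have z : 0 <= 2 * x < 1 by apply/andP; split; lra.
  apply: (@squeeze_cvgr _ _ _ _ (fun N => 1 - N%:R * (2 * x) ^+ N) (fun=> 1)).
  - apply: nearW => N; have /andP[_ ->] := step_itv N (introT andP (conj x0 x1)).
    rewrite andbT; have := bernoulli (N * 2 ^ N) (xN N).
    by rewrite natrM natrX exprMn mulrA.
  - rewrite -[X in _ --> X]subr0; apply: cvgB; [exact: cvg_cst|exact: natr_geo].
  - exact: cvg_cst.
apply: (@squeeze_cvgr _ _ _ _ (fun=> 0) (fun N : nat => N%:R^-1)).
- near=> N; have /andP[-> _] := step_itv N (introT andP (conj x0 x1)).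
  have N0 : 0 < N%:R :> R by rewrite ltr0n; near: N; exists 1%N.
  rewrite andTb; have := bernoulli_inv (N * 2 ^ N) (xN N); rewrite -/(step N x).
  rewrite natrM natrX -mulrA -exprMn.
  have e1 : 1 <= (2 * x) ^+ N by apply: exprn_ege1; lra.
  have /andP[s0 s1] := step_itv N (introT andP (conj x0 x1)).
  move=> h2; rewrite -[N%:R^-1]mul1r ler_pdivlMr//; apply: le_trans h2.
  apply: ler_wpM2l => //; nra.
- exact: cvg_cst.
- by rewrite -cvg_shiftS; exact: cvg_harmonic.
Unshelve. all: by end_near.
Qed.

Lemma ae_imp (P P' : R * R -> Prop) : (forall x, P x -> P' x) ->
  {ae mu, forall x, P x} -> {ae mu, forall x, P' x}.
Proof. exact: (@filterS _ _ (ae_filter_ringOfSetsType mu)). Qed.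

Lemma ae_and (P P' : R * R -> Prop) : {ae mu, forall x, P x} ->
  {ae mu, forall x, P' x} -> {ae mu, forall x, P x /\ P' x}.
Proof. exact: (@filterI _ _ (ae_filter_ringOfSetsType mu)). Qed.

Lemma qint_dct (F : nat -> R * R -> R) (f g : R * R -> R) :
  (forall n, mfun (F n)) -> mfun f -> qint g ->
  {ae mu, forall x, Q x -> F n x @[n --> \oo] --> f x} ->
  {ae mu, forall x, Q x -> forall n, `|F n x| <= g x} ->
  qint f /\ Rintegral mu Q (F n) @[n --> \oo] --> Rintegral mu Q f.
Proof.
move=> mF mf ig Ff Fg.
have [] := @dominated_convergence _ _ _ mu Q measurable_square
  (fun n => EFin \o (F n : T2 -> R)) (EFin \o (f : T2 -> R)) (EFin \o (g : T2 -> R)).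
- by move=> n; apply/measurable_EFinP; exact: mfun_sub.
- by apply/measurable_EFinP; exact: mfun_sub.
- by move: Ff; apply: ae_imp => x h Qx; apply: cvg_EFin; [exact: nearW|exact: h].
- exact: ig.
- by move: Fg; apply: ae_imp => x h n Qx; rewrite /= lee_fin h.
move=> fi _ lim; split => //.
by apply: fine_cvg; rewrite fineK//; exact: (integrable_fin_num measurable_square fi).
Qed.

(** For [0 <= y < 2 pi], the shifted cosine [cos (y - r / 2)] is less than
    [cos (r / 2)] exactly when [r < y]. *)
Lemma ray_tpoly (e : lattice) (pr : R * R -> R) (r : R) :
  (forall x, dotp e x = pr x) -> (forall x, Q x -> 0 <= pr x < 2 * pi) ->
  exists p, [/\ tpoly p, forall x, 0 <= p x <= 1 &
    forall x, Q x -> (p x < 2^-1) = (r < pr x)].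
Proof.
move=> ep Qpr; have pi0 := pi_gt0 R.
have [r0|r0] := ltP r 0.
  exists (fun=> 0); split => [|x|x /Qpr/andP[h _]]; first exact: tpoly_cst.
    by rewrite lexx ler01.
  by rewrite (lt_le_trans r0 h) invr_gt0 ltr0n.
have [r1|r1] := leP (2 * pi) r.
  exists (fun=> 1); split => [|x|x /Qpr/andP[_ h]]; first exact: tpoly_cst.
    by rewrite lexx ler01.
  by rewrite [RHS]ltNge (ltW (lt_le_trans h r1)); apply/negbTE; rewrite -leNgt; lra.
pose s := r / 2.
have s0 : 0 <= s by rewrite /s; lra.
have s1 : s < pi by rewrite /s; lra.
exists (fun x => 2^-1 + (cos (pr x - s) - cos s) / 4); split.
- have := tpolyD (tpoly_cst (2^-1 - cos s / 4)) (tpolyZ (4^-1) (tpoly_wave (- s) e)).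
  by congr tpoly; apply/funext => x; rewrite ep [- s + _]addrC; lra.
- move=> x; have := cos_geN1 (pr x - s); have := cos_le1 (pr x - s).
  by have := cos_geN1 s; have := cos_le1 s; move=> *; apply/andP; split; lra.
move=> x /Qpr /andP[y0 y1]; set y := pr x in y0 y1 *.
have -> : (2^-1 + (cos (y - s) - cos s) / 4 < 2^-1) = (cos (y - s) < cos s).
  by apply/idP/idP; lra.
have si : s \in `[0, pi] by rewrite in_itv/= s0 ltW.
have ry : (r < y) = (s < y - s) by rewrite /s; apply/idP/idP; lra.
rewrite ry; have [h|h] := leP (y - s) pi.
  have [h'|h'] := leP 0 (y - s).
    by rewrite ltr_cos// in_itv/= h' h.
  rewrite -[cos (y - s)]cosN -[in RHS](opprK (y - s)).
  have yi : - (y - s) \in `[0, pi] by rewrite in_itv/=; apply/andP; split; lra.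
  rewrite ltr_cos//; apply/idP/idP; lra.
have <- : cos (2 * pi - (y - s)) = cos (y - s).
  have := cis_periodic (- (y - s)) 1; rewrite mul1r => -[+ _].
  by rewrite cosN addrC.
have yi : 2 * pi - (y - s) \in `[0, pi] by rewrite in_itv/=; apply/andP; split; lra.
rewrite ltr_cos//; apply/idP/idP; first lra.
by move=> _; rewrite /s; lra.
Qed.

Lemma Q_fst x : Q x -> 0 <= x.1 < 2 * (pi : R).
Proof. by move=> [/=]; rewrite in_itv. Qed.

Lemma Q_snd x : Q x -> 0 <= x.2 < 2 * (pi : R).
Proof. by move=> [_ /=]; rewrite in_itv. Qed.

Section Orthogonal.
Variable f : R * R -> R.
Hypothesis mf : mfun f.
Hypothesis fi : qint f.
Hypothesis forth : forall b n, Rintegral mu Q (fun x => f x * cos (b + dotp n x)) = 0.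

Lemma orth_tpoly p : tpoly p -> Rintegral mu Q (fun x => f x * p x) = 0.
Proof.
move=> [s ps].
have -> : (fun x => f x * p x) = fun x => \sum_(i <- s) i.1.1 * (f x * cos (i.1.2 + dotp i.2 x)).
  by apply/funext => x; rewrite ps mulr_sumr; apply: eq_bigr => i _; ring.
have wi b n : qint (fun x => f x * cos (b + dotp n x)).
  by apply: (qint_mulb (M := 1)) => // [|x]; [exact: mfun_wave|exact: cos_norm].
suff [_ ->//] : qint (fun x => \sum_(i <- s) i.1.1 * (f x * cos (i.1.2 + dotp i.2 x))) /\
  Rintegral mu Q (fun x => \sum_(i <- s) i.1.1 * (f x * cos (i.1.2 + dotp i.2 x))) = 0.
elim: s {ps} => [|i s [IH1 IH2]].
  rewrite (_ : (fun x : R * R => _) = cst 0); last by apply/funext => x; rewrite big_nil.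
  split; first by apply: (qint_bounded (M := 0)) => // x; rewrite normr0.
  by rewrite Rintegral_cst ?mul0r//; exact: measurable_square.
rewrite (_ : (fun x : R * R => _) = fun x => i.1.1 * (f x * cos (i.1.2 + dotp i.2 x)) +
    \sum_(j <- s) j.1.1 * (f x * cos (j.1.2 + dotp j.2 x))); last first.
  by apply/funext => x; rewrite big_cons.
have hi := qintZ i.1.1 (wi i.1.2 i.2).
split; first exact: qintD.
rewrite (RintegralD measurable_square hi IH1) IH2 addr0.
by rewrite (RintegralZl _ measurable_square (wi _ _)) forth mulr0.
Qed.

(** The polynomials [step N p] converge boundedly to the indicator of the set
    where [p] is less than [1/2]. *)
Lemma orth_sublevel p q : tpoly p -> tpoly q ->
  (forall x, 0 <= p x <= 1) -> (forall x, 0 <= q x <= 1) ->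
  Rintegral mu Q (fun x => f x * ((if p x < 2^-1 then 1 else 0) * (if q x < 2^-1 then 1 else 0))) = 0.
Proof.
move=> tp tq p1 q1.
pose F N x := f x * (step N (p x) * step N (q x)).
have mF N : mfun (F N).
  by apply: measurable_funM => //; apply: tpoly_mfun; apply: tpolyM; exact: tpoly_step.
have Fc x : F N x @[N --> \oo] -->
    f x * ((if p x < 2^-1 then 1 else 0) * (if q x < 2^-1 then 1 else 0)).
  by apply: cvgMr; apply: cvgM; exact: step_cvg.
have [||||_] := @qint_dct F (fun x => f x * ((if p x < 2^-1 then 1 else 0) * (if q x < 2^-1 then 1 else 0)))
   (fun x => `|f x|) mF.
- by apply: (measurable_fun_cvg _ (fun x _ => Fc x)) => N; exact: mF.
- by have := integrable_norm fi.
- by apply: nearW => x _; exact: Fc.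
- apply: nearW => x _ N; rewrite /F normrM ler_piMr//.
  have /andP[h1 h2] := step_itv N (p1 x); have /andP[h3 h4] := step_itv N (q1 x).
  by rewrite ger0_norm ?mulr_ge0// mulr_ile1.
have -> : (fun N => Rintegral mu Q (F N)) = cst 0.
  by apply/funext => N; apply: orth_tpoly; apply: tpolyM; exact: tpoly_step.
by move=> h; apply: (cvg_unique (@Rhausdorff R) h); exact: cvg_cst.
Qed.

Let P (E : set T2) := (\int[mu]_(x in Q `&` E) (f x)%:E = 0)%E.

Let fE (E : set T2) : measurable E -> mu.-integrable (Q `&` E) (EFin \o (f : T2 -> R)).
Proof.
move=> mE; apply: integrableS fi; first exact: measurable_square.
  by apply: measurableI => //; exact: measurable_square.
exact: subIsetl.
Qed.

Let P_diff (E F : set T2) : measurable E -> measurable F -> E `<=` F -> P E -> P F -> P (F `\` E).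
Proof.
move=> mE mF EF; rewrite /P => PE PF.
have := @integral_setU _ _ _ mu (Q `&` E) (Q `&` (F `\` E)) (EFin \o (f : T2 -> R)).
have -> : (Q `&` E) `|` (Q `&` (F `\` E)) = Q `&` F.
  rewrite -setIUr; congr (_ `&` _); apply/seteqP; split => x /=.
    by move=> [/EF|[]].
  by move=> Fx; have [Ex|nEx] := pselect (E x); [left|right].
rewrite /= PE PF add0e => <- //.
- by apply: measurableI => //; exact: measurable_square.
- by apply: measurableI; [exact: measurable_square|exact: measurableD].
- by apply: measurable_int (fE mF).
- by apply/disj_setPS => x [[_ Ex] [_ [_ nEx]]].
Qed.

Let P_bigcup (F : (set T2)^nat) : (forall n, measurable (F n)) -> trivIset setT F ->
  (forall n, P (F n)) -> P (\bigcup_k F k).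
Proof.
move=> mF tF PF; rewrite /P setI_bigcupr integral_bigcup.
- by rewrite eseries0// => n _ _; exact: PF.
- by apply: trivIset_setIl.
- by move=> k; apply: measurableI => //; exact: measurable_square.
- by rewrite -setI_bigcupr; apply: fE; exact: bigcupT_measurable.
Qed.

Definition rays : set (set T1) := [set A | A = setT \/ exists r : R, A = `]r, +oo[%classic].

Let measurable_ray A : rays A -> measurable A.
Proof. by move=> [->//|[r ->]]; exact: measurable_itv. Qed.

Let P_rays A B : rays A -> rays B -> P (A `*` B).
Proof.
have key (e : lattice) (pr : R * R -> R) A' : rays A' -> (forall x, dotp e x = pr x) ->
    (forall x, Q x -> 0 <= pr x < 2 * pi) ->
    exists p, [/\ tpoly p, forall x, 0 <= p x <= 1 & forall x, Q x -> (p x < 2^-1) = (pr x \in A')].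
  move=> [->|[r ->]] ep Qpr.
    exists (fun=> 0); split; first exact: tpoly_cst.
      by move=> x; rewrite lexx ler01.
    by move=> x _; rewrite in_setT invr_gt0 ltr0n.
  have [p [h1 h2 h3]] := ray_tpoly r ep Qpr; exists p; split => // x Qx.
  by rewrite h3//; apply/idP/idP; rewrite inE/= in_itv/= andbT.
move=> rA rB.
have e1 (x : R * R) : dotp (1, 0) x = x.1 by rewrite /dotp /= mul1r mul0r addr0.
have e2 (x : R * R) : dotp (0, 1) x = x.2 by rewrite /dotp /= mul1r mul0r add0r.
have [p [p1 p2 p3]] := key (1, 0) fst A rA e1 Q_fst.
have [q [q1 q2 q3]] := key (0, 1) snd B rB e2 Q_snd.
have := orth_sublevel p1 q1 p2 q2.
have mAB : measurable (A `*` B : set T2) by apply: measurableX; exact: measurable_ray.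
have fin : (\int[mu]_(x in Q `&` (A `*` B)) (f x)%:E \is a fin_num)%E.
  apply: (integrable_fin_num _ (fE mAB)).
  by apply: measurableI => //; exact: measurable_square.
move=> h; rewrite /P -(fineK fin); congr EFin; rewrite -[RHS]h.
rewrite integral_mkcondr /Rintegral; congr fine; apply: eq_integral => x; rewrite inE => Qx.
rewrite patchE (p3 x Qx) (q3 x Qx).
have -> : (x \in A `*` B) = (x.1 \in A) && (x.2 \in B).
  by apply/idP/andP; rewrite !inE.
by case: (x.1 \in A); case: (x.2 \in B); rewrite /= ?mul1r ?mul0r ?mulr0 ?mulr1.
Qed.

Let rays_gen : @measurable _ T1 = <<s rays >>.
Proof.
rewrite eqEsubset; split => A.
  have -> : @measurable _ T1 = <<s [set A : set R | exists x : R, A = `]x, +oo[%classic] >>.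
    exact: RGenOInfty.measurableE.
  apply: smallest_sub; first exact: smallest_sigma_algebra.
  by move=> B [r ->]; apply: sub_sigma_algebra; right; exists r.
apply: smallest_sub; first exact: sigma_algebra_measurable.
exact: measurable_ray.
Qed.

Let rays_setI : setI_closed rays.
Proof.
move=> A B [->|[r ->]] [->|[s ->]]; rewrite ?setTI ?setIT; [by left|by right; exists s|by right; exists r|].
right; exists (Num.max r s); apply/seteqP; split => x /=; rewrite !in_itv/= !andbT gt_max.
  by move=> [-> ->].
by move=> /andP[].
Qed.

Let P_left A B : measurable A -> rays B -> P (A `*` B).
Proof.
move=> mA rB; have mB := measurable_ray rB; move: mA; rewrite rays_gen.
apply: (@dynkin_induction _ T1 rays (fun A => P (A `*` B)) rays_gen rays_setI).
- by apply: P_rays => //; left.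
- by move=> A' rA'; exact: P_rays.
- move=> S mS PS; have -> : (~` S) `*` B = (setT `*` B) `\` (S `*` B).
    by apply/seteqP; split => -[x y] /=; tauto.
  apply: P_diff => //; [exact: measurableX|exact: measurableX|by move=> [x y] []|].
  by apply: P_rays => //; left.
- move=> F mF tF PF; have -> : (\bigcup_k F k) `*` B = \bigcup_k (F k `*` B).
    apply/seteqP; split => -[x y] /=; first by move=> [[k _ ?] ?]; exists k.
    by move=> [k _ [? ?]]; split => //; exists k.
  apply: P_bigcup => //.
  + by move=> n; exact: measurableX.
  + by move=> i j _ _ [[x y] [[/= Fi _] [/= Fj _]]]; apply: tF => //; exists x.
Qed.

Let P_prod A B : measurable A -> measurable B -> P (A `*` B).
Proof.
move=> mA; rewrite rays_gen.
apply: (@dynkin_induction _ T1 rays (fun B => P (A `*` B)) rays_gen rays_setI).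
- by apply: P_left => //; left.
- by move=> B' rB'; exact: P_left.
- move=> S mS PS; have -> : A `*` (~` S) = (A `*` setT) `\` (A `*` S).
    by apply/seteqP; split => -[x y] /=; tauto.
  apply: P_diff => //; [exact: measurableX|exact: measurableX|by move=> [x y] []|].
  by apply: P_left => //; left.
- move=> F mF tF PF; have -> : A `*` (\bigcup_k F k) = \bigcup_k (A `*` F k).
    apply/seteqP; split => -[x y] /=; first by move=> [? [k _ ?]]; exists k.
    by move=> [k _ [? ?]]; split => //; exists k.
  apply: P_bigcup => //.
  + by move=> n; exact: measurableX.
  + by move=> i j _ _ [[x y] [[/= _ Fi] [/= _ Fj]]]; apply: tF => //; exists y.
Qed.

Let P_all E : measurable E -> P E.
Proof.
rewrite measurable_prod_measurableType.
apply: (@dynkin_induction _ T2 _ P (measurable_prod_measurableType _ _)).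
- move=> _ _ [A mA [B mB <-]] [A' mA' [B' mB' <-]].
  exists (A `&` A'); first exact: measurableI.
  by exists (B `&` B'); [exact: measurableI|rewrite setXI].
- by rewrite -setXTT; exact: P_prod.
- by move=> _ [A mA [B mB <-]]; exact: P_prod.
- move=> S mS PS; rewrite -setTD; apply: P_diff => //.
  by rewrite -setXTT; exact: P_prod.
- exact: P_bigcup.
Qed.

(** Products of rays generate the Borel sets of the plane, and the sets on which
    [f] integrates to zero form a Dynkin class. *)
Lemma orth_ae0 : {ae mu, forall x, Q x -> f x = 0}.
Proof.
have := @integral_ae_eq _ _ _ mu Q measurable_square (cst 0%E) (EFin \o (f : T2 -> R)) fi.
move=> /(_ (measurable_cst _)) h.
have : ae_eq mu Q (EFin \o (f : T2 -> R)) (cst 0%E).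
  apply: h => E EQ mE; rewrite integral0.
  have := P_all mE; rewrite /P; have -> // : Q `&` E = E by exact: setIidr.
by apply: ae_imp => x hx Qx; have := hx Qx => -[].
Qed.

End Orthogonal.

End Uniqueness.

(** ** Periodic functions with vanishing Fourier coefficients *)

Section Translation.
Context {R : realType}.
Notation T1 := (measurableTypeR R).
Notation T2 := (measurableTypeR R * measurableTypeR R)%type.
Notation mu1 := (@lebesgue_measure R).
Notation mu := (@lebesgue2 R).
Notation Q := (@fundamental_square R).

Definition translate (k : R) (x : T1) : T1 := x + k.

Let measurable_translate k : measurable_fun [set: T1] (translate k).
Proof. exact: measurable_funD. Qed.

HB.instance Definition _ k := isMeasurableFun.Build _ _ _ _ (translate k)
  (measurable_translate k).

Definition translate2 (k l : R) (x : T2) : T2 := (x.1 + k, x.2 + l).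

Let measurable_translate2 k l : measurable_fun [set: T2] (translate2 k l).
Proof. by apply/measurable_fun_pairP; split; apply: measurable_funD. Qed.

HB.instance Definition _ k l := isMeasurableFun.Build _ _ _ _ (translate2 k l)
  (measurable_translate2 k l).

Lemma lebesgue_measure_translate k (A : set T1) : measurable A ->
  mu1 (translate k @^-1` A) = mu1 A.
Proof.
move=> mA; apply/esym; apply: (lebesgue_measure_unique (mu := pushforward mu1 (translate k))) => //=.
move=> _ [[a b]] _ <-; rewrite /pushforward.
have -> : translate k @^-1` `]a, b]%classic = `]a - k, b - k]%classic.
  by apply/seteqP; split => x /=; rewrite !in_itv/= ltrBlDr lerBrDr.
rewrite !lebesgue_measure_itv/= !lte_fin ltrD2r.
by case: ifP => // _; rewrite -!EFinB; congr EFin; ring.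
Qed.

Lemma lebesgue2_translate k l (A : set T2) : measurable A ->
  mu (translate2 k l @^-1` A) = mu A.
Proof.
move=> mA; apply/esym.
apply: (product_measure_unique (m' := pushforward mu (translate2 k l))) => // B C mB mC.
rewrite /pushforward.
transitivity (mu ((translate k @^-1` B) `*` (translate l @^-1` C))); first by [].
have mm m (D : set T1) : measurable D -> measurable (translate m @^-1` D).
  by move=> mD; rewrite -[X in measurable X]setTI; exact: measurable_translate.
transitivity (mu1 (translate k @^-1` B) * mu1 (translate l @^-1` C))%E.
  by apply: product_measure1E; exact: mm.
by rewrite (lebesgue_measure_translate k mB) (lebesgue_measure_translate l mC).
Qed.

Lemma periodic2_int (f : R * R -> R[i]) (k l : int) x : periodic2 f ->
  f (x.1 + k%:~R * (2 * pi), x.2 + l%:~R * (2 * pi)) = f x.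
Proof.
move=> pf; case: x => x y /=.
have h1 (n : nat) u v : f (u + n%:R * (2 * pi), v) = f (u, v).
  elim: n u => [|n IH] u; first by rewrite mul0r addr0.
  by rewrite -natr1 mulrDl mul1r addrA (pf _ _).1.
have h2 (n : nat) u v : f (u, v + n%:R * (2 * pi)) = f (u, v).
  elim: n v => [|n IH] v; first by rewrite mul0r addr0.
  by rewrite -natr1 mulrDl mul1r addrA (pf _ _).2.
have k1 u v : f (u + k%:~R * (2 * pi), v) = f (u, v).
  case: (intP k) => [|n|n]; [by rewrite mul0r addr0|exact: h1|].
  by rewrite -[LHS](h1 n.+1) -addrA -mulrDl mulrNz addNr mul0r addr0.
rewrite k1; case: (intP l) => [|n|n]; [by rewrite mul0r addr0|exact: h2|].
by rewrite -[LHS](h2 n.+1) -addrA -mulrDl mulrNz addNr mul0r addr0.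
Qed.

(** The translates of the square by periods cover the plane, and a countable
    union of null sets is null. *)
Lemma ae_periodic (f : R * R -> R[i]) : cmfun f -> periodic2 f ->
  {ae mu, forall x, Q x -> f x = 0} -> {ae mu, forall x, f x = 0}.
Proof.
move=> [m1 m2] pf fQ.
pose E : set T2 := Q `&` [set x | f x <> 0].
have mE : measurable E.
  apply: measurableI; first exact: measurable_square.
  have -> : [set x | f x <> 0] = ~` (((fun x => complex.Re (f x)) @^-1` [set 0]) `&`
      ((fun x => complex.Im (f x)) @^-1` [set 0])).
    apply/seteqP; split => x /=; first by move=> h [h1 h2]; apply: h; move: h1 h2; case: (f x) => /= ? ? -> ->.
    by move=> h fx; apply: h; rewrite fx.
  apply: measurableC; apply: measurableI; rewrite -[X in measurable X]setTI.
    by apply: m1.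
  by apply: m2.
have E0 : mu E = 0%E.
  apply/negligibleP => //; move: fQ; apply: negligibleS => x [Qx fx] /= h.
  exact: fx (h Qx).
have Ek k l : mu.-negligible (translate2 k l @^-1` E).
  apply/negligibleP; last by have := lebesgue2_translate k l mE; rewrite E0.
  by rewrite -[X in measurable X]setTI; exact: measurable_translate2.
pose S (i : nat) : set T2 := if unpickle i is Some kl then
  translate2 ((kl : int * int).1%:~R * (2 * pi)) (kl.2%:~R * (2 * pi)) @^-1` E else set0.
have : mu.-negligible (\bigcup_i S i).
  apply: negligible_bigcup => i; rewrite /S; case: unpickle => [kl|]; first exact: Ek.
  exact: negligible_set0.
apply: negligibleS => x /= fx.
have p2 := pi2_gt0 (R := R).
have red (y : R) : exists k : int, 0 <= y + k%:~R * (2 * pi) < 2 * pi.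
  exists (- Num.floor (y / (2 * pi))).
  have /andP[h1 h2] := real_floor_itv (num_real (y / (2 * pi))).
  move: h1 h2; rewrite ler_pdivlMr// ltr_pdivrMr// rmorphN /= rmorphD /= => h1 h2.
  by apply/andP; split; lra.
have [k kx] := red x.1; have [l lx] := red x.2.
have SE : S (pickle (k, l)) = translate2 (k%:~R * (2 * pi)) (l%:~R * (2 * pi)) @^-1` E.
  by rewrite /S pickleK.
exists (pickle (k, l)); [exact: I|rewrite SE; split].
  by split => /=; rewrite in_itv.
by rewrite /= /translate2 periodic2_int.
Qed.

End Translation.

Section FourierUniqueness.
Context {R : realType}.
Notation T2 := (measurableTypeR R * measurableTypeR R)%type.
Notation mu := (@lebesgue2 R).
Notation Q := (@fundamental_square R).
Implicit Types (f g : R * R -> R[i]).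

Lemma cqint_wavel n f : cqint f -> cqint (fun x => wave n x * f x).
Proof.
move=> [f1 f2].
have [w1 w2] : cmfun (wave n : R * R -> R[i]).
  by split; rewrite /wave /=; [apply: mfun_cos|apply: mfun_sin]; exact: mfun_dotp.
have b1 (x : R * R) : `|complex.Re (wave n x)| <= 1 by exact: cos_norm.
have b2 (x : R * R) : `|complex.Im (wave n x)| <= 1 by exact: sin_norm.
split.
  have := qintB (qint_mulb f1 w1 b1) (qint_mulb f2 w2 b2).
  by congr qint; apply/funext => x; rewrite /wave /cis; case: (f x) => u v /=; ring.
have := qintD (qint_mulb f2 w1 b1) (qint_mulb f1 w2 b2).
by congr qint; apply/funext => x; rewrite /wave /cis; case: (f x) => u v /=; ring.
Qed.

Lemma fourierD f g n : cqint f -> cqint g ->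
  fourier (fun x => f x + g x) n = fourier f n + fourier g n.
Proof.
move=> fi gi; rewrite !fourierE -mulrDr -torus_integralD; try exact: cqint_wavel.
by congr (_ * torus_integral _); apply/funext => x; rewrite mulrDr.
Qed.

Lemma fourierZ k f n : cqint f -> fourier (fun x => k * f x) n = k * fourier f n.
Proof.
move=> fi; rewrite !fourierE mulrCA -(torus_integralZ _ (cqint_wavel _ fi)).
by congr (_ * torus_integral _); apply/funext => x; rewrite mulrCA.
Qed.

Lemma fourierB f g n : cqint f -> cqint g ->
  fourier (fun x => f x - g x) n = fourier f n - fourier g n.
Proof.
move=> fi gi; have -> : (fun x => f x - g x) = fun x => f x + (-1) * g x.
  by apply/funext => x; rewrite mulN1r.
by rewrite fourierD ?fourierZ ?mulN1r//; exact: cqintZ.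
Qed.

Lemma cqintB f g : cqint f -> cqint g -> cqint (fun x => f x - g x).
Proof.
move=> fi gi; have -> : (fun x => f x - g x) = fun x => f x + (-1) * g x.
  by apply/funext => x; rewrite mulN1r.
by apply: cqintD => //; exact: cqintZ.
Qed.

(** The coefficients at [n] and [- n] determine the four real integrals of [Re f]
    and [Im f] against [cos] and [sin]. *)
Lemma fourier_ae0 f : cmfun f -> cqint f -> (forall n, fourier f n = 0) ->
  {ae mu, forall x, Q x -> f x = 0}.
Proof.
move=> [m1 m2] [f1 f2] f0.
pose g x := complex.Re (f x); pose h x := complex.Im (f x).
pose c n (x : R * R) := cos (dotp n x); pose s n (x : R * R) := sin (dotp n x).
have mc n : measurable_fun [set: T2] (c n : T2 -> R) by apply: mfun_cos; exact: mfun_dotp.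
have ms n : measurable_fun [set: T2] (s n : T2 -> R) by apply: mfun_sin; exact: mfun_dotp.
have ci (k : R * R -> R) n : qint k -> qint (fun x => k x * c n x).
  by move=> ki; apply: (qint_mulb (M := 1)) => // x; exact: cos_norm.
have si (k : R * R -> R) n : qint k -> qint (fun x => k x * s n x).
  by move=> ki; apply: (qint_mulb (M := 1)) => // x; exact: sin_norm.
pose I k := Rintegral mu Q k.
have key n : I (fun x => g x * c n x) + I (fun x => h x * s n x) = 0 /\
             I (fun x => h x * c n x) - I (fun x => g x * s n x) = 0.
  have : torus_integral (fun x => wave (- n) x * f x) = 0.
    apply: (mulfI (_ : (((2 * pi) ^+ 2)^-1)%:C%C != 0 :> R[i])).
      by rewrite realcV invr_eq0 pi2sq_neq0.
    by rewrite -fourierE f0 mulr0.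
  rewrite /torus_integral => -[e1 e2]; split.
    rewrite /I -(RintegralD measurable_square (ci _ n f1) (si _ n f2)) -[RHS]e1.
    apply: eq_Rintegral => x _; rewrite /g /h /c /s /wave /cis dotpN cosN sinN.
    by case: (f x) => u v /=; ring.
  rewrite /I -(RintegralB measurable_square (ci _ n f2) (si _ n f1)) -[RHS]e2.
  apply: eq_Rintegral => x _; rewrite /g /h /c /s /wave /cis dotpN cosN sinN.
  by case: (f x) => u v /=; ring.
have cN n : c (- n) = c n by apply/funext => x; rewrite /c dotpN cosN.
have sN (k : R * R -> R) n : qint k -> I (fun x => k x * s (- n) x) = - I (fun x => k x * s n x).
  move=> ki; rewrite -[RHS]mulN1r -(RintegralZl (-1) measurable_square (si _ n ki)).
  by apply: eq_Rintegral => x _; rewrite /s dotpN sinN mulrN mulN1r.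
have all4 n : [/\ I (fun x => g x * c n x) = 0, I (fun x => h x * s n x) = 0,
   I (fun x => h x * c n x) = 0 & I (fun x => g x * s n x) = 0].
  have [k1 k2] := key n; have [] := key (- n); rewrite !cN !sN// => k3 k4.
  by split; lra.
have orth (k : R * R -> R) : qint k -> (forall n, I (fun x => k x * c n x) = 0) ->
    (forall n, I (fun x => k x * s n x) = 0) ->
    forall b n, Rintegral mu Q (fun x => k x * cos (b + dotp n x)) = 0.
  move=> ki kc ks b n.
  have e : 0 = cos b * I (fun x => k x * c n x) - sin b * I (fun x => k x * s n x) :> R.
    by rewrite kc ks !mulr0 subrr.
  rewrite [RHS]e /I -(RintegralZl (cos b) measurable_square (ci _ n ki)).
  rewrite -(RintegralZl (sin b) measurable_square (si _ n ki)).
  rewrite -(RintegralB measurable_square (qintZ _ (ci _ n ki)) (qintZ _ (si _ n ki))).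
  by apply: eq_Rintegral => x _; rewrite cosD /c /s; ring.
have g0 := orth_ae0 m1 f1 (orth g f1 (fun n => let: And4 e _ _ _ := all4 n in e)
  (fun n => let: And4 _ _ _ e := all4 n in e)).
have h0 := orth_ae0 m2 f2 (orth h f2 (fun n => let: And4 _ _ e _ := all4 n in e)
  (fun n => let: And4 _ e _ _ := all4 n in e)).
move: (ae_and g0 h0); apply: ae_imp => x [hg hh] Qx.
by move: (hg Qx) (hh Qx); case: (f x) => /= ? ? -> ->.
Qed.

Lemma inL2_cmfun f : inL2 f -> cmfun f.
Proof. by case. Qed.

Lemma cmfunB f g : cmfun f -> cmfun g -> cmfun (fun x => f x - g x).
Proof.
move=> [f1 f2] [g1 g2]; split.
  apply: (eq_measurable_fun _ _ (measurable_funB f1 g1)) => x _ /=.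
  by case: (f x) (g x) => ? ? [].
apply: (eq_measurable_fun _ _ (measurable_funB f2 g2)) => x _ /=.
by case: (f x) (g x) => ? ? [].
Qed.

Lemma mfun_modulus f : cmfun f -> measurable_fun [set: T2] ((fun x => modulus (f x)) : T2 -> R).
Proof.
move=> [m1 m2].
have -> : (fun x => modulus (f x)) = fun x => Num.sqrt (complex.Re (f x) ^+ 2 + complex.Im (f x) ^+ 2).
  by apply/funext => x; rewrite -sqr_modulus sqrtr_sqr ger0_norm// modulus_ge0.
apply: (@measurableT_comp _ _ _ _ _ _ (Num.sqrt : measurableTypeR R -> measurableTypeR R)).
  by apply: continuous_measurable_fun; exact: sqrt_continuous.
by apply: measurable_funD; exact: measurable_funX.
Qed.

Lemma inL2_qint f : inL2 f -> qint (fun x => modulus (f x) ^+ 2).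
Proof.
move=> [_ m1 m2 fin]; apply/integrableP; split.
  apply/measurable_EFinP; apply: mfun_sub; apply: measurable_funX.
  by apply: mfun_modulus; split.
apply: le_lt_trans fin; rewrite le_eqVlt; apply/orP; left; apply/eqP.
by apply: eq_integral => x _ /=; rewrite ger0_norm ?sqr_ge0.
Qed.

Lemma cqint_le f (g : R * R -> R) : cmfun f -> qint g ->
  (forall x, Q x -> modulus (f x) <= g x) -> cqint f.
Proof.
move=> [m1 m2] gi fg; split; apply: qint_le gi _ => // x Qx.
  exact: le_trans (Re_le_modulus _) (fg x Qx).
exact: le_trans (Im_le_modulus _) (fg x Qx).
Qed.

Lemma qint_cst k : qint (fun=> k : R).
Proof. by apply: (qint_bounded (M := `|k|)). Qed.

Lemma inL2_cqint f : inL2 f -> cqint f.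
Proof.
move=> fL; apply: (cqint_le (inL2_cmfun fL) (qintD (qint_cst 1) (inL2_qint fL))) => x _.
have := sqr_ge0 (modulus (f x) - 1); have := modulus_ge0 (f x); nra.
Qed.

Lemma fourier_inj f g : cmfun f -> cmfun g -> cqint f -> cqint g ->
  (forall n, fourier f n = fourier g n) -> {ae mu, forall x, Q x -> f x = g x}.
Proof.
move=> mf mg fi gi fg.
have h : {ae mu, forall x, Q x -> f x - g x = 0}.
  by apply: (fourier_ae0 (cmfunB mf mg) (cqintB fi gi)) => n; rewrite fourierB// fg subrr.
by move: h; apply: ae_imp => x hx Qx; apply/eqP; rewrite -subr_eq0 hx.
Qed.

End FourierUniqueness.

(** ** The Fourier coefficients of the cubic nonlinearity *)

Section ComplexLimits.
Context {R : realType}.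
Implicit Types (z w : nat -> R[i]) (l : R[i]).

Definition ccvg z l := complex.Re (z j) @[j --> \oo] --> complex.Re l /\
  complex.Im (z j) @[j --> \oo] --> complex.Im l.

Lemma ccvg_cst l : ccvg (fun=> l) l.
Proof. by split; exact: cvg_cst. Qed.

Lemma ccvgM z w k l : ccvg z k -> ccvg w l -> ccvg (fun j => z j * w j) (k * l).
Proof.
move=> [z1 z2] [w1 w2]; split.
  have -> : complex.Re (k * l) = complex.Re k * complex.Re l - complex.Im k * complex.Im l.
    by case: k {z1 z2} => ? ?; case: l {w1 w2}.
  have -> : (fun j => complex.Re (z j * w j)) = fun j =>
      complex.Re (z j) * complex.Re (w j) - complex.Im (z j) * complex.Im (w j).
    by apply/funext => j; case: (z j) (w j) => ? ? [].
  by apply: cvgB; apply: cvgM.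
have -> : complex.Im (k * l) = complex.Re k * complex.Im l + complex.Im k * complex.Re l.
  by case: k {z1 z2} => ? ?; case: l {w1 w2}.
have -> : (fun j => complex.Im (z j * w j)) = fun j =>
    complex.Re (z j) * complex.Im (w j) + complex.Im (z j) * complex.Re (w j).
  by apply/funext => j; case: (z j) (w j) => ? ? [].
by apply: cvgD; apply: cvgM.
Qed.

Lemma ccvg_conj z l : ccvg z l -> ccvg (fun j => (z j)^*%C) l^*%C.
Proof.
move=> [z1 z2]; split.
  have -> : complex.Re l^*%C = complex.Re l by case: l {z1 z2}.
  by have -> : (fun j => complex.Re (z j)^*%C) = fun j => complex.Re (z j)
    by apply/funext => j; case: (z j).
have -> : complex.Im l^*%C = - complex.Im l by case: l {z1 z2}.
have -> : (fun j => complex.Im (z j)^*%C) = fun j => - complex.Im (z j)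
  by apply/funext => j; case: (z j).
exact: cvgN.
Qed.

Lemma ccvg_unique z k l : ccvg z k -> ccvg z l -> k = l.
Proof.
case: k l => k1 k2 [l1 l2] [/= z1 z2] [/= z3 z4]; congr Complex.
  exact: (cvg_unique (@Rhausdorff R) z1 z3).
exact: (cvg_unique (@Rhausdorff R) z2 z4).
Qed.

Lemma ccvg_le z l (e : nat -> R) : (forall j, modulus (l - z j) <= e j) ->
  e j @[j --> \oo] --> 0 -> ccvg z l.
Proof.
move=> ze e0.
have key (u : nat -> R) v : (forall j, `|v - u j| <= e j) -> u j @[j --> \oo] --> v.
  move=> ue; apply/cvgrPdist_le => d d0.
  move/cvgrPdist_le: e0 => /(_ d d0); apply: filterS => j; rewrite sub0r normrN => h.
  by apply: le_trans (ue j) _; apply: le_trans (ler_norm _) h.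
split; apply: key => j; apply: le_trans (ze j).
  by apply: le_trans (Re_le_modulus _); case: l {ze} (z j) => ? ? [].
by apply: le_trans (Im_le_modulus _); case: l {ze} (z j) => ? ? [].
Qed.

Lemma geometric_cvg (x : R^nat) k : (forall j, `|x j.+1 - x j| <= k * (2^-1) ^+ j) -> cvgn x.
Proof.
move=> xk; suff : cvgn (series (telescope x)).
  have xE : (fun n => x 0%N + series (telescope x) n) = x.
    by apply/funext => n; rewrite -eq_sum_telescope.
  move=> c; rewrite -xE; exact: (is_cvgD (is_cvg_cst (x 0%N)) c).
apply: normed_cvg; apply: (@series_le_cvg _ _ (geometric k 2^-1)) => [n|n|n|].
- exact: normr_ge0.
- by apply: le_trans (xk n).
- exact: xk.
- by apply: is_cvg_geometric_series; rewrite ger0_norm; lra.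
Qed.

Lemma sum_geometric (x : R^nat) k : (forall j, x j.+1 - x j <= k * (2^-1) ^+ j) ->
  forall n, x n <= x 0%N + 2 * k * (1 - (2^-1) ^+ n).
Proof.
move=> xk; elim=> [|n IH]; first by rewrite expr0 subrr mulr0 addr0.
by have := xk n; rewrite exprS; move: IH; set q := _ ^+ n; lra.
Qed.

Lemma ccvg_geometric z k : (forall j, modulus (z j.+1 - z j) <= k * (2^-1) ^+ j) ->
  (exists l, ccvg z l) /\ forall j, modulus (z j) <= modulus (z 0%N) + 2 * k.
Proof.
move=> zk.
have k0 : 0 <= k by have := le_trans (modulus_ge0 _) (zk 0%N); rewrite expr0 mulr1.
have c1 : cvgn (fun j => complex.Re (z j)).
  apply: (geometric_cvg (k := k)) => j; apply: le_trans (zk j); apply: le_trans (Re_le_modulus _).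
  by case: (z j) (z j.+1) => ? ? [].
have c2 : cvgn (fun j => complex.Im (z j)).
  apply: (geometric_cvg (k := k)) => j; apply: le_trans (zk j); apply: le_trans (Im_le_modulus _).
  by case: (z j) (z j.+1) => ? ? [].
split.
  by exists (Complex (limn (fun j => complex.Re (z j))) (limn (fun j => complex.Im (z j)))).
move=> j; apply: le_trans (sum_geometric (x := fun j => modulus (z j)) (k := k) _ j) _.
  move=> i; apply: le_trans (zk i); rewrite lerBlDr.
  by apply: le_trans (modulusD _ _); rewrite subrK.
by rewrite lerD2l -[leRHS]mulr1 ler_wpM2l ?mulr_ge0// gerBl exprn_ge0.
Qed.

End ComplexLimits.

Section FourierCubic.
Context {R : realType}.
Notation T2 := (measurableTypeR R * measurableTypeR R)%type.
Notation mu := (@lebesgue2 R).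
Notation Q := (@fundamental_square R).
Notation mfun f := (measurable_fun [set: T2] (f : T2 -> R)).
Implicit Types (f g : R * R -> R[i]).

Lemma cmfunM f g : cmfun f -> cmfun g -> cmfun (fun x => f x * g x).
Proof.
move=> [f1 f2] [g1 g2]; split.
  apply: (eq_measurable_fun _ _ (measurable_funB (measurable_funM f1 g1) (measurable_funM f2 g2))) => x _ /=.
  by case: (f x) (g x) => ? ? [].
apply: (eq_measurable_fun _ _ (measurable_funD (measurable_funM f1 g2) (measurable_funM f2 g1))) => x _ /=.
by case: (f x) (g x) => ? ? [].
Qed.

Lemma cmfun_wave n : cmfun (wave n : R * R -> R[i]).
Proof. by split; rewrite /wave /=; [apply: mfun_cos|apply: mfun_sin]; exact: mfun_dotp. Qed.

Lemma cmfun_conj f : cmfun f -> cmfun (fun x => (f x)^*%C).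
Proof.
move=> [f1 f2]; split.
  by apply: (eq_measurable_fun _ _ f1) => x _ /=; case: (f x).
have -> : (fun x => complex.Im (f x)^*%C) = fun x => 0 - complex.Im (f x).
  by apply/funext => x; case: (f x) => ? ?; rewrite sub0r.
exact: measurable_funB.
Qed.

Lemma cmfun_cubic f : cmfun f -> cmfun (cubic f).
Proof.
move=> mf; have -> : cubic f = fun x => f x * (f x)^*%C * f x by apply/funext => x; exact: cubicE.
by apply: cmfunM => //; apply: cmfunM => //; exact: cmfun_conj.
Qed.

Lemma modulus_cubic f x : modulus (cubic f x) = modulus (f x) ^+ 3.
Proof. by rewrite /cubic modulusM modulusC ger0_norm ?sqr_ge0// -exprSr. Qed.

Lemma fourier_dct (F : nat -> R * R -> R[i]) f (g : R * R -> R) :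
  (forall j, cmfun (F j)) -> cmfun f -> qint g ->
  {ae mu, forall x, Q x -> ccvg (fun j => F j x) (f x)} ->
  {ae mu, forall x, Q x -> forall j, modulus (F j x) <= g x} ->
  cqint f /\ forall n, ccvg (fun j => fourier (F j) n) (fourier f n).
Proof.
move=> mF mf gi Ff Fg.
have key (G : nat -> R * R -> R[i]) h : (forall j, cmfun (G j)) -> cmfun h ->
    {ae mu, forall x, Q x -> ccvg (fun j => G j x) (h x)} ->
    {ae mu, forall x, Q x -> forall j, modulus (G j x) <= g x} ->
    cqint h /\ ccvg (fun j => torus_integral (G j)) (torus_integral h).
  move=> mG [h1 h2] Gh Gg.
  have [|||i1 l1] := qint_dct (F := fun j x => complex.Re (G j x)) _ h1 gi.
  - by move=> j; have [] := mG j.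
  - by move: Gh; apply: ae_imp => x e Qx; have [] := e Qx.
  - by move: Gg; apply: ae_imp => x e Qx j; exact: le_trans (Re_le_modulus _) (e Qx j).
  have [|||i2 l2] := qint_dct (F := fun j x => complex.Im (G j x)) _ h2 gi.
  - by move=> j; have [] := mG j.
  - by move: Gh; apply: ae_imp => x e Qx; have [] := e Qx.
  - by move: Gg; apply: ae_imp => x e Qx j; exact: le_trans (Im_le_modulus _) (e Qx j).
  by [].
split; first by have [] := key F f mF mf Ff Fg.
move=> n; have [||||_ h] := key (fun j x => wave (- n) x * F j x) (fun x => wave (- n) x * f x).
- by move=> j; apply: cmfunM => //; exact: cmfun_wave.
- by apply: cmfunM => //; exact: cmfun_wave.
- by move: Ff; apply: ae_imp => x h Qx; apply: ccvgM (ccvg_cst _) (h Qx).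
- move: Fg; apply: ae_imp => x h Qx j; rewrite modulusM /wave modulus_cis mul1r; exact: h.
rewrite fourierE; under [X in ccvg X _]funext => j do rewrite fourierE.
exact: ccvgM (ccvg_cst _) h.
Qed.

Lemma fourier_ae_eq f g n : cmfun f -> cmfun g -> {ae mu, forall x, Q x -> f x = g x} ->
  fourier f n = fourier g n.
Proof.
move=> mf mg fg; rewrite !fourierE; congr (_ * _); rewrite /torus_integral.
have [f1 f2] := cmfunM (cmfun_wave (- n)) mf.
have [g1 g2] := cmfunM (cmfun_wave (- n)) mg.
congr Complex; congr fine; apply: ae_eq_integral; try exact: measurable_square.
- by apply/measurable_EFinP; exact: mfun_sub.
- by apply/measurable_EFinP; exact: mfun_sub.
- by move: fg; apply: ae_imp => x h Qx; rewrite /= h.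
- by apply/measurable_EFinP; exact: mfun_sub.
- by apply/measurable_EFinP; exact: mfun_sub.
- by move: fg; apply: ae_imp => x h Qx; rewrite /= h.
Qed.

(** By monotone convergence the sum of the [G j] is integrable. *)
Lemma qint_sum_dominated (G : nat -> R * R -> R) (b : nat -> R) B :
  (forall j, mfun (G j)) -> (forall j x, 0 <= G j x) -> (forall j, qint (G j)) ->
  (forall j, Rintegral mu Q (G j) <= b j) -> (forall n, \sum_(j < n) b j <= B) ->
  exists2 H, qint H & {ae mu, forall x, Q x -> forall j, G j x <= H x}.
Proof.
move=> mG G0 Gi Gb bB.
pose S (x : T2) := (\sum_(0 <= j <oo) (G j x)%:E)%E.
have S0 x : (0 <= S x)%E by apply: nneseries_ge0 => j _ _; rewrite lee_fin.
have mS : measurable_fun Q S.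
  apply: (ge0_emeasurable_sum (P := xpredT)) => [j x _ _|j _]; first by rewrite lee_fin.
  by apply/measurable_EFinP; exact: mfun_sub.
have iS : mu.-integrable Q S.
  apply/integrableP; split => //.
  apply: (@le_lt_trans _ _ B%:E); last by rewrite ltry.
  rewrite (eq_integral S); last by move=> x _; rewrite gee0_abs.
  rewrite /S integral_nneseries//; first last.
  - by move=> j x _; rewrite lee_fin.
  - by move=> j; apply/measurable_EFinP; exact: mfun_sub.
  - exact: measurable_square.
  apply: lime_le.
    by apply: is_cvg_nneseries => j _ _; apply: integral_ge0 => x _; rewrite lee_fin.
  apply: nearW => n; rewrite big_mkord; apply: le_trans (_ : (\sum_(j < n) (b j)%:E <= _)%E).
    apply: lee_sum => j _.
    rewrite -(fineK (integrable_fin_num measurable_square (Gi j))) lee_fin; exact: Gb.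
  by rewrite sumEFin lee_fin.
exists (fun x => fine (S x)).
  apply: le_integrable iS; first exact: measurable_square.
    apply/measurable_EFinP; apply: (measurableT_comp (fine_measurable measurableT) mS).
  move=> x _ /=; rewrite (gee0_abs (S0 x)) ger0_norm ?fine_ge0//.
  by case: (S x) (S0 x).
have := integrable_ae measurable_square iS; apply: ae_imp => x fx Qx j.
rewrite -lee_fin fineK; last exact: fx.
apply: le_trans (nneseries_lim_ge j.+1 _) => [|i _ _]; last by rewrite lee_fin.
rewrite big_nat_recr//= leeDr// sumEFin lee_fin; exact: sumr_ge0.
Qed.

Definition trunc (s : seq lattice) (a : lattice -> R[i]) n := if n \in s then a n else 0.

Lemma trunc_approx (a : lattice -> R[i]) A e : inh1 a A -> 0 < e ->
  exists2 s, uniq s & inh1 (fun n => a n - trunc s a n) e.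
Proof.
move=> aA e0; have [s us h] := nsum_approx (fun n => sqr_ge0 _) aA e0.
exists s => //; apply: sumle_le h => n; rewrite /trunc; case: ifP => _.
  by rewrite subrr modulus0 mulr0 expr0n.
by rewrite subr0.
Qed.

Lemma inh1_trunc (s : seq lattice) (a : lattice -> R[i]) A : inh1 a A -> inh1 (trunc s a) A.
Proof.
apply: sumle_le => n; rewrite /trunc; case: ifP => // _.
by rewrite modulus0 mulr0 expr0n sqr_ge0.
Qed.

Lemma trig_sub (s r : seq lattice) (c : lattice -> R[i]) x : uniq s -> uniq r ->
  (forall n, n \notin s -> c n = 0) -> {subset s <= r} -> trig s c x = trig r c x.
Proof.
move=> us ur cs sr; rewrite /trig [RHS](bigID (mem s))/= [X in _ + X]big1 ?addr0; last first.
  by move=> n /cs ->; rewrite mul0r.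
rewrite -[RHS]big_filter; apply: perm_big; apply: uniq_perm => //; first exact: filter_uniq.
by move=> n; rewrite mem_filter; case: (boolP (n \in s)) => // /sr ->.
Qed.

Lemma trig_trunc_sub (s r : seq lattice) (a : lattice -> R[i]) : uniq s -> uniq r ->
  exists2 p, uniq p /\ (forall n, n \notin p -> trunc r a n - trunc s a n = 0) &
  forall x, trig r (trunc r a) x - trig s (trunc s a) x = trig p (fun n => trunc r a n - trunc s a n) x.
Proof.
move=> us ur; exists (undup (s ++ r)).
  split; first exact: undup_uniq.
  by move=> n; rewrite mem_undup mem_cat negb_or /trunc => /andP[/negPf -> /negPf ->]; rewrite subrr.
have z q n : n \notin q -> trunc q a n = 0 by rewrite /trunc => /negPf ->.
move=> x; rewrite (trig_sub x ur (undup_uniq (s ++ r)) (z r)); last first.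
  by move=> n nr; rewrite mem_undup mem_cat nr orbT.
rewrite (trig_sub x us (undup_uniq (s ++ r)) (z s)); last first.
  by move=> n ns; rewrite mem_undup mem_cat ns.
by rewrite /trig -sumrB; apply: eq_bigr => n _; rewrite mulrBl.
Qed.

Lemma pow4_le (m h : R) : 0 <= m -> 0 <= h -> (m + 2 * h) ^+ 4 <= 8 * m ^+ 4 + 128 * h ^+ 4.
Proof.
move=> m0 h0; have sq (x y : R) : (x + y) ^+ 2 <= 2 * x ^+ 2 + 2 * y ^+ 2.
  by have := sqr_ge0 (x - y); rewrite !expr2; nra.
have -> : (m + 2 * h) ^+ 4 = ((m + 2 * h) ^+ 2) ^+ 2 by rewrite -exprM.
apply: le_trans (_ : (2 * m ^+ 2 + 2 * (2 * h) ^+ 2) ^+ 2 <= _).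
  by rewrite ler_sqr ?nnegrE ?sqr_ge0//= addr_ge0 ?mulr_ge0 ?sqr_ge0.
apply: le_trans (sq _ _) _.
by rewrite le_eqVlt; apply/orP; left; apply/eqP; ring.
Qed.

(** The truncated Fourier series of [f], taken along a fast subsequence,
    converge almost everywhere with a dominating function in [L^4]; the limit
    has the Fourier coefficients of [f], hence is [f]. *)
Lemma fourier_cubic f A m : inL2 f -> inh1 (fourier f) A ->
  fourier (cubic f) m = cub (fourier f) m.
Proof.
move=> fL aA; set a := fourier f in aA *.
(* [8 ^- j] beats the fourth power of the weight [2 ^ j] in [G], which makes the
   increments of the partial sums geometric *)
have e0 (j : nat) : 0 < (8^-1 : R) ^+ j by rewrite exprn_gt0// invr_gt0.
have ch (j : nat) : exists s, uniq s /\ inh1 (fun n => a n - trunc s a n) ((8^-1) ^+ j).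
  by have [s us h] := trunc_approx aA (e0 j); exists s.
pose s j := sval (cid (ch j)).
have us j : uniq (s j) by have [] := svalP (cid (ch j)).
have hs j : inh1 (fun n => a n - trunc (s j) a n) ((8^-1) ^+ j).
  by have [] := svalP (cid (ch j)).
pose t j := trig (s j) (trunc (s j) a).
have z q n : n \notin q -> trunc q a n = 0 by rewrite /trunc => /negPf ->.
have mt j : cmfun (t j) by exact: mfun_trig.
pose G j x := (2 ^+ j * modulus (t j.+1 x - t j x)) ^+ 4.
pose C : R := (2 * pi) ^+ 2 * (1 + kappa) * 16.
have C0 : 0 <= C.
  by rewrite /C; apply: mulr_ge0 => //; apply: mulr_ge0; [exact: sqr_ge0|apply: addr_ge0 => //; exact: kappa_ge0].
have dL4 j : qint (fun x => modulus (t j.+1 x - t j x) ^+ 4) /\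
    Rintegral mu Q (fun x => modulus (t j.+1 x - t j x) ^+ 4) <= C * ((8^-1) ^+ j) ^+ 2.
  have [p [up p0] pE] := trig_trunc_sub a (us j) (us j.+1).
  have pA : inh1 (fun n => trunc (s j.+1) a n - trunc (s j) a n) (4 * (8^-1) ^+ j).
    have h := inh1B (hs j) (hs j.+1).
    have : inh1 (fun n => trunc (s j.+1) a n - trunc (s j) a n)
      (2 * (8^-1) ^+ j + 2 * (8^-1) ^+ j.+1).
      apply: sumle_le h => n; rewrite le_eqVlt; apply/orP; left; apply/eqP.
      by congr ((_ * modulus _) ^+ 2); ring.
    apply: sumle_weak; rewrite exprS; have := ltW (e0 j); set q := _ ^+ j; lra.
  have [h1 h2] := trig_L4 up p0 pA.
  have E : (fun x => modulus (t j.+1 x - t j x) ^+ 4) = fun x =>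
      modulus (trig p (fun n => trunc (s j.+1) a n - trunc (s j) a n) x) ^+ 4.
    by apply/funext => x; rewrite /t pE.
  rewrite E; split => //; apply: le_trans h2 _; rewrite /C.
  by rewrite le_eqVlt; apply/orP; left; apply/eqP; ring.
have [|||||H Hi GH] := qint_sum_dominated (G := G) (b := fun j => C * (4^-1) ^+ j) (B := 2 * C).
- move=> j; apply: measurable_funX; apply: measurable_funM => //.
  apply: (mfun_modulus (f := fun x => t j.+1 x - t j x)).
  exact: cmfunB.
- by move=> j x; rewrite exprn_ge0// mulr_ge0 ?modulus_ge0// exprn_ge0.
- move=> j; have [h _] := dL4 j; have := qintZ ((2 ^+ j) ^+ 4) h.
  by congr qint; apply/funext => x; rewrite /G exprMn.
- move=> j; have [h1 h2] := dL4 j.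
  have -> : G j = fun x => (2 ^+ j) ^+ 4 * modulus (t j.+1 x - t j x) ^+ 4.
    by apply/funext => x; rewrite /G exprMn.
  rewrite (RintegralZl _ measurable_square h1).
  apply: le_trans (ler_wpM2l _ h2) _; first by rewrite !exprn_ge0.
  rewrite mulrCA ler_wpM2l// -!exprM mulnC [(_ * 2)%N]mulnC !exprM -exprMn.
  by rewrite lerXn2r ?nnegrE//; lra.
- move=> n; rewrite -mulr_sumr mulrC ler_wpM2r//.
  suff : \sum_(j < n) (4^-1) ^+ j <= 2 - 2 * (4^-1) ^+ n :> R.
    have : 0 <= (4^-1 : R) ^+ n by rewrite exprn_ge0// invr_ge0.
    lra.
  elim: n => [|n IH]; first by rewrite big_ord0 expr0; lra.
  rewrite big_ord_recr/= exprS; move: IH; set q := _ ^+ n; have : 0 <= q by rewrite exprn_ge0// invr_ge0.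
  by lra.
pose M := \sum_(n <- s 0%N) modulus (trunc (s 0%N) a n).
have M0 : 0 <= M by apply: sumr_ge0 => n _; exact: modulus_ge0.
pose h x := Num.sqrt (Num.sqrt (H x)).
have ptw : {ae mu, forall x, Q x -> (exists l, ccvg (fun j => t j x) l) /\
    forall j, modulus (t j x) ^+ 4 <= 8 * M ^+ 4 + 128 * H x}.
  move: GH; apply: ae_imp => x GHx Qx.
  have H0 : 0 <= H x.
    by apply: le_trans (GHx Qx 0%N); rewrite /G exprn_ge0// mulr_ge0 ?modulus_ge0// exprn_ge0.
  have h4 : h x ^+ 4 = H x by rewrite /h (exprM _ 2 2) !sqr_sqrtr// sqrtr_ge0.
  have h0 : 0 <= h x by exact: sqrtr_ge0.
  have [|l b] := @ccvg_geometric _ (fun j => t j x) (h x).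
    move=> j; have := GHx Qx j; rewrite /G -h4 ler_pXn2r ?nnegrE ?mulr_ge0 ?modulus_ge0 ?exprn_ge0//.
    by move=> k; rewrite exprVn ler_pdivlMr ?exprn_gt0// mulrC.
  split => // j; apply: le_trans (_ : (M + 2 * h x) ^+ 4 <= _); last first.
    by rewrite -h4; exact: pow4_le.
  rewrite lerXn2r ?nnegrE ?modulus_ge0 ?addr_ge0 ?mulr_ge0//.
  by apply: le_trans (b j) _; rewrite lerD2r; exact: trig_bounded.
pose lr (p : R[i] -> R) (x : T2) := fine (limn_esup (fun j => (p (t j x))%:E)).
pose g (x : R * R) := Complex (lr (@complex.Re _) x) (lr (@complex.Im _) x).
have mg : cmfun g.
  split; apply: (measurableT_comp (fine_measurable measurableT)) => //;
    apply: measurable_fun_limn_esup => j; apply/measurable_EFinP; by have [] := mt j.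
have tg : {ae mu, forall x, Q x -> ccvg (fun j => t j x) (g x)}.
  move: ptw; apply: ae_imp => x hx Qx; have [[l [l1 l2]] _] := hx Qx.
  have E (p : R[i] -> R) : p (t j x) @[j --> \oo] --> p l -> lr p x = p l.
    move=> pl.
    have : (p (t j x))%:E @[j --> \oo] --> (p l)%:E by apply: cvg_EFin => //; exact: nearW.
    by move=> /cvg_limn_einf_sup [_ e]; rewrite /lr e.
  by split; rewrite /= E.
(* the [1] covers the powers below four where the modulus is less than one *)
pose D x := 1 + (8 * M ^+ 4 + 128 * H x).
have Di : qint D by apply: qintD (qint_cst 1) (qintD (qint_cst _) (qintZ _ Hi)).
have dom k : (k <= 4)%N -> {ae mu, forall x, Q x -> forall j, modulus (t j x) ^+ k <= D x}.
  move=> k4; move: ptw; apply: ae_imp => x hx Qx j; have [_ /(_ j) hj] := hx Qx.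
  rewrite /D; move: hj; set y := modulus _ => hj; have y0 : 0 <= y by exact: modulus_ge0.
  have [y1|y1] := leP y 1.
    have : 0 <= y ^+ 4 by rewrite exprn_ge0.
    have : y ^+ k <= 1 by rewrite exprn_ile1.
    by lra.
  apply: le_trans (_ : y ^+ 4 <= _); last lra.
  by rewrite ler_weXn2l// ltW.
have small : (8^-1 : R) ^+ j @[j --> \oo] --> 0.
  by apply: cvg_expr; rewrite ger0_norm; lra.
have sqsmall k : 0 <= k -> Num.sqrt (k * (8^-1 : R) ^+ j) @[j --> \oo] --> 0.
  move=> k0; rewrite -[X in _ --> X]sqrtr0 -[X in Num.sqrt X](mulr0 k).
  by apply: (continuous_cvg _ (@sqrt_continuous R _)); apply: cvgMr.
have [gi gl] := fourier_dct mt mg Di tg (dom 1%N isT).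
have ga n : fourier g n = a n.
  apply: ccvg_unique (gl n) _.
  apply: (ccvg_le (e := fun j => Num.sqrt (1 * (8^-1) ^+ j))); last exact: sqsmall.
  move=> j; rewrite (fourier_trig _ (us j) (z (s j))) mul1r; apply: modulus_le_sqrt.
  exact: sumle_term (inh1_l2 (hs j)).
have fg := fourier_inj (inL2_cmfun fL) mg (inL2_cqint fL) gi (fun n => esym (ga n)).
rewrite (fourier_ae_eq m (cmfun_cubic (inL2_cmfun fL)) (cmfun_cubic mg)); last first.
  by move: fg; apply: ae_imp => x e Qx; rewrite /cubic e.
have [||_ cl] := fourier_dct (fun j => cmfun_cubic (mt j)) (cmfun_cubic mg) Di.
- move: tg; apply: ae_imp => x hx Qx; have c := hx Qx; rewrite cubicE.
  under [X in ccvg X _]funext => j do rewrite cubicE.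
  by apply: ccvgM => //; apply: ccvgM => //; exact: ccvg_conj.
- by move: (dom 3%N isT); apply: ae_imp => x hx Qx j; rewrite modulus_cubic; exact: hx.
apply: ccvg_unique (cl m) _.
have A0 := sumle_ge0 aA.
apply: (ccvg_le (e := fun j => Num.sqrt ((9 * kappa * A ^+ 2) * (8^-1) ^+ j))); last first.
  by apply: sqsmall; rewrite !mulr_ge0 ?kappa_ge0 ?sqr_ge0.
move=> j; rewrite (fourier_cubic_trig _ (us j) (z (s j))); apply: modulus_le_sqrt.
exact: sumle_term (cub_diff aA (inh1_trunc _ aA) (hs j)).
Qed.

End FourierCubic.

(** * From functions to Fourier coefficients *)

Section Interface.
Context {R : realType}.
Implicit Types (a : lattice -> R[i]) (n : lattice).

Lemma sobolev_sumle (s : int) a e : 0 <= e -> (sobolev_norm s a <= e%:E)%E ->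
  sumle (fun n => (1 + freq2 n) ^ s * modulus (a n) ^+ 2) (e ^+ 2).
Proof.
move=> e0 h; apply/sumle_esum; move: h; rewrite /sobolev_norm.
have f0 n : 0 <= (1 + freq2 n) ^ s * modulus (a n) ^+ 2 :> R.
  by rewrite mulr_ge0 ?sqr_ge0// exprz_ge0// addr_ge0// freq2_ge0.
set S := esum _ _; have S0 : (0 <= S)%E by apply: esum_ge0 => n _; rewrite lee_fin.
move: S0; case: S => [x||]//.
  rewrite lee_fin => x0; rewrite poweR_EFin powR12_sqrt// !lee_fin => h.
  by rewrite -(sqr_sqrtr x0) ler_sqr ?nnegrE ?sqrtr_ge0.
by move=> _; rewrite poweRyr// invr_eq0 pnatr_eq0.
Qed.

Lemma wt_sobolev n : wt n ^+ 2 <= 2 * (1 + freq2 n) :> R.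
Proof.
have : (sz n).+1%:R ^+ 2 <= 2 * (1 + (sz n)%:R ^+ 2) :> R.
  by rewrite -natr1; have := sqr_ge0 ((sz n)%:R - 1 : R); rewrite !expr2; nra.
move=> /le_trans; apply; rewrite ler_wpM2l// lerD2l /freq2.
rewrite rmorphD !rmorphXn/=.
have a2 (x : int) : (`|x|%N%:R) ^+ 2 = (x%:~R) ^+ 2 :> R.
  by rewrite natr_absz intr_norm real_normK ?num_real.
rewrite -!a2 /sz; have [h|h] := leqP `|n.1|%N `|n.2|%N.
  by rewrite lerDr sqr_ge0.
by rewrite lerDl sqr_ge0.
Qed.

Lemma sobolev_inh1 a e : 0 <= e -> (sobolev_norm 1 a <= e%:E)%E -> inh1 a (2 * e ^+ 2).
Proof.
move=> e0 /(sobolev_sumle e0) h.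
apply: sumle_le (sumleZ (ler0n _ 2) h) => n; rewrite expr1z exprMn [leRHS]mulrA.
by rewrite ler_wpM2r ?sqr_ge0// wt_sobolev.
Qed.

Lemma sobolev_fin_inh1 a : (sobolev_norm 1 a < +oo)%E -> exists A, inh1 a A.
Proof.
have : (0 <= sobolev_norm 1 a)%E by exact: poweR_ge0.
case E : (sobolev_norm 1 a) => [e||]// e0 _.
by exists (2 * e ^+ 2); apply: sobolev_inh1; rewrite ?E.
Qed.

Lemma ereal_cvg0 {T : Type} (F : set_system T) {FF : Filter F} (f : T -> \bar R) :
  f t @[t --> F] --> 0%E -> forall e, 0 < e -> \forall t \near F, (f t <= e%:E)%E.
Proof.
move=> f0 e e0.
have : nbhs (0%E : \bar R) [set y | (y <= e%:E)%E].
  rewrite /nbhs/=; exists e => //= y /=; rewrite sub0r normrN lee_fin => h.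
  by apply: le_trans (ler_norm _) (ltW h).
by move=> /f0.
Qed.

Lemma sobolev_cvg_inh1 {T : Type} (F : set_system T) {FF : Filter F} (x : T -> lattice -> R[i]) :
  sobolev_norm 1 (x t) @[t --> F] --> 0%E ->
  forall e, 0 < e -> \forall t \near F, inh1 (x t) e.
Proof.
move=> x0 e e0; pose d := Num.sqrt (e / 2).
have d0 : 0 < d by rewrite sqrtr_gt0; lra.
apply: (@filterS _ F FF _ _ _ (ereal_cvg0 x0 d0)) => t h.
have := sobolev_inh1 (ltW d0) h; rewrite sqr_sqrtr; last by lra.
by rewrite mulrCA divff ?mulr1.
Qed.

Lemma sobolev_cvg_mode {T : Type} (F : set_system T) {FF : Filter F} (x : T -> lattice -> R[i]) :
  sobolev_norm (-1) (x t) @[t --> F] --> 0%E ->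
  forall n e, 0 < e -> \forall t \near F, modulus (x t n) <= e.
Proof.
move=> x0 n e e0; have f0 : 0 < 1 + freq2 n :> R by rewrite ltr_pwDl ?freq2_ge0.
pose d := e / Num.sqrt (1 + freq2 n); have s0 : 0 < Num.sqrt (1 + freq2 n) :> R by rewrite sqrtr_gt0.
have d0 : 0 < d by rewrite divr_gt0.
apply: (@filterS _ F FF _ _ _ (ereal_cvg0 x0 d0)) => t h.
have := sumle_term n (sobolev_sumle (ltW d0) h).
have -> : d ^+ 2 = e ^+ 2 / (1 + freq2 n) by rewrite /d exprMn exprVn sqr_sqrtr// ltW.
rewrite exprN1 mulrC ler_pM2r ?invr_gt0//.
by rewrite ler_sqr// nnegrE ?modulus_ge0// ltW.
Qed.

Lemma inh1_addr a b A B : inh1 (fun n => a n - b n) A -> inh1 b B -> inh1 a (2 * A + 2 * B).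
Proof.
move=> h1 h2; have := inh1D h1 h2; apply: sumle_le => n; by rewrite subrK.
Qed.

End Interface.

(** * Time evolution of the Fourier coefficients *)

Section ComplexDerivative.
Context {R : realType}.
Implicit Types (f g : R -> R[i]) (t : R) (d : R[i]).

Definition cderive f t d :=
  is_derive t (1 : R) (fun s => complex.Re (f s)) (complex.Re d) /\
  is_derive t (1 : R) (fun s => complex.Im (f s)) (complex.Im d).

Lemma cderive_eq f t d d' : d = d' -> cderive f t d -> cderive f t d'.
Proof. by move=> ->. Qed.

Lemma cderive_cst k t : cderive (fun=> k) t 0.
Proof. by split; exact: is_derive_cst. Qed.

Lemma cderiveD f g t d e : cderive f t d -> cderive g t e ->
  cderive (fun s => f s + g s) t (d + e).
Proof.
move=> [f1 f2] [g1 g2]; split.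
  have -> : (fun s => complex.Re (f s + g s)) = (fun s => complex.Re (f s)) \+ (fun s => complex.Re (g s)).
    by apply/funext => s /=; case: (f s) (g s) => ? ? [].
  by apply: is_derive_eq; case: d {f1 f2} => ? ?; case: e {g1 g2}.
have -> : (fun s => complex.Im (f s + g s)) = (fun s => complex.Im (f s)) \+ (fun s => complex.Im (g s)).
  by apply/funext => s /=; case: (f s) (g s) => ? ? [].
by apply: is_derive_eq; case: d {f1 f2} => ? ?; case: e {g1 g2}.
Qed.

Lemma cderiveM f g t d e : cderive f t d -> cderive g t e ->
  cderive (fun s => f s * g s) t (d * g t + f t * e).
Proof.
move=> [f1 f2] [g1 g2].
pose fr s := complex.Re (f s); pose fi s := complex.Im (f s).
pose gr s := complex.Re (g s); pose gi s := complex.Im (g s).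
split.
  have -> : (fun s => complex.Re (f s * g s)) = (fr \* gr) \- (fi \* gi).
    by apply/funext => s /=; rewrite /fr /fi /gr /gi; case: (f s) (g s) => ? ? [].
  apply: is_derive_eq; rewrite /GRing.scale /= /fr /fi /gr /gi.
  by case: d {f1 f2} => ? ?; case: e {g1 g2} => ? ?; case: (f t) (g t) => ? ? [? ?] /=; ring.
have -> : (fun s => complex.Im (f s * g s)) = (fr \* gi) \+ (fi \* gr).
  by apply/funext => s /=; rewrite /fr /fi /gr /gi; case: (f s) (g s) => ? ? [].
apply: is_derive_eq; rewrite /GRing.scale /= /fr /fi /gr /gi.
by case: d {f1 f2} => ? ?; case: e {g1 g2} => ? ?; case: (f t) (g t) => ? ? [? ?] /=; ring.
Qed.

Lemma cderive_conj f t d : cderive f t d -> cderive (fun s => (f s)^*%C) t d^*%C.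
Proof.
move=> [f1 f2]; split.
  have -> : (fun s => complex.Re (f s)^*%C) = fun s => complex.Re (f s)
    by apply/funext => s; case: (f s).
  by apply: is_derive_eq; case: d {f1 f2}.
have -> : (fun s => complex.Im (f s)^*%C) = - (fun s => complex.Im (f s))
  by apply/funext => s; rewrite opprfctE; case: (f s).
by apply: is_derive_eq; case: d {f1 f2}.
Qed.

Lemma cderive_sum {T : Type} (s : seq T) (F : T -> R -> R[i]) (D : T -> R[i]) t :
  (forall i, cderive (F i) t (D i)) ->
  cderive (fun x => \sum_(i <- s) F i x) t (\sum_(i <- s) D i).
Proof.
move=> FD; elim: s => [|i s IH].
  have -> : (fun x : R => \sum_(i <- [::]) F i x) = fun=> 0 by apply/funext => x; rewrite big_nil.
  by rewrite big_nil; exact: cderive_cst.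
have -> : (fun x : R => \sum_(j <- i :: s) F j x) = fun x => F i x + \sum_(j <- s) F j x.
  by apply/funext => x; rewrite big_cons.
by rewrite big_cons; exact: cderiveD.
Qed.

Lemma cderive_cis k t : cderive (fun s => cis (s * k)) t ('i%C * k%:C%C * cis (t * k)).
Proof.
have d : is_derive t (1 : R) (fun s : R => s * k) k.
  apply: is_derive_eq; rewrite /GRing.scale /= mulr1 mulr0 ?add0r ?addr0//.
split => /=.
  have := @is_derive1_comp _ cos (fun s : R => s * k) _ _ _ (is_derive_cos (t * k)) d.
  by rewrite [X in _ -> is_derive _ _ _ X](_ : _ = - sin (t * k) * k)//; ring.
have := @is_derive1_comp _ sin (fun s : R => s * k) _ _ _ (is_derive_sin (t * k)) d.
by rewrite [X in _ -> is_derive _ _ _ X](_ : _ = cos (t * k) * k)//; ring.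
Qed.

Lemma is_derive_le (p : R -> R) t (d e : R) : is_derive t (1 : R) p d ->
  (forall h, `|h| <= 1 -> `|p (t + h) - p t| <= e * `|h|) -> `|d| <= e.
Proof.
move=> [dp <-] pe; apply/ler_addgt0Pr => eta eta0.
have : (fun h => h^-1 *: (p (h *: (1 : R) + t) - p t)) @ 0^' --> 'D_1 p t by exact: dp.
move=> /cvgrPdist_le /(_ eta eta0) H.
have N : \forall h \near (0 : R)^', `|h| <= 1 /\ h != 0.
  near=> h; split; last by near: h; exact: nbhs_dnbhs_neq.
  near: h; apply: nbhs_dnbhs; exists 1 => //= y /=; rewrite sub0r normrN; exact: ltW.
have [h [h1 [h2 h0]]] := filter_ex (filterI H N).
rewrite -[X in `|X|](subrK (h^-1 *: (p (h *: (1 : R) + t) - p t))).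
apply: le_trans (ler_normD _ _) _; rewrite addrC lerD//.
rewrite /GRing.scale /= mulr1 normrM normfV mulrC ler_pdivrMr ?normr_gt0//.
by rewrite [h + t]addrC; exact: pe.
Unshelve. all: by end_near.
Qed.

(** A convergent function has asymptotically vanishing increments; if its
    derivative is asymptotically periodic, the increments at time [t] differ
    little from those at much later times, so the derivative tends to [0]. *)
Lemma asymptotically_periodic_derivative (p dp G : R -> R) L :
  (forall t, is_derive t (1 : R) p (dp t)) ->
  (forall t (k : nat), G (t + k%:R * (2 * pi)) = G t) ->
  (forall e, 0 < e -> exists T, forall t, T <= t -> `|dp t - G t| <= e) ->
  (forall e, 0 < e -> exists T, forall t, T <= t -> `|p t - L| <= e) ->
  forall t, G t = 0.
Proof.
move=> pd GP dG pL t0; apply/eqP; rewrite -normr_eq0 eq_le normr_ge0 andbT.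
apply/ler_addgt0Pr => e e0; rewrite add0r.
have e3 : 0 < e / 3 by lra.
have [T HT] := dG _ e3.
have far (x y : R) : exists k : nat, y <= x + k%:R * (2 * pi).
  have p2 := pi2_gt0 (R := R).
  have [k hk] : exists k : nat, `|(y - x) / (2 * pi)| <= k%:R.
    by exists (Num.truncn `|(y - x) / (2 * pi)|).+1; apply/ltW/truncnS_gt.
  exists k; rewrite -lerBlDl -ler_pdivrMr//.
  by apply: le_trans (ler_norm _) hk.
have [k hk] := far t0 (T + 1).
set t1 := t0 + _ in hk; rewrite -(GP t0 k) -/t1.
have D1 : `|dp t1| <= 2 * (e / 3).
  apply: (is_derive_le (pd t1)) => h h1.
  apply/ler_addgt0Pr => d d0.
  have d2 : 0 < d / 2 by lra.
  have [T' HT'] := pL _ d2.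
  have [j hj] := far t1 (T' + 1); set J := j%:R * (2 * pi) in hj.
  have J0 : 0 <= J by rewrite mulr_ge0// ltW// pi2_gt0.
  have dJ (z : R) : is_derive z (1 : R) (fun s => p (s + J) - p s) (dp (z + J) - dp z).
    have dsh : is_derive z (1 : R) (fun s : R => s + J) 1.
      by apply: is_derive_eq; rewrite addr0.
    have := @is_derive1_comp _ p (fun s : R => s + J) _ _ _ (pd (z + J)) dsh; rewrite mulr1 => h2.
    by have := is_deriveB h2 (pd z).
  have := @mvt_bound R (fun s => p (s + J) - p s) (fun z => dp (z + J) - dp z) (2 * (e / 3)) t1 (t1 + h) dJ.
  rewrite [t1 + h - t1]addrC addKr => M.
  have {}M : `|p (t1 + h + J) - p (t1 + h) - (p (t1 + J) - p t1)| <= 2 * (e / 3) * `|h|.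
    apply: M => z zh.
    have hz : T <= z.
      have : `|z - t1| <= 1 by exact: le_trans zh h1.
      by rewrite ler_norml => /andP[a _]; lra.
    have := HT z hz; have := HT (z + J) (le_trans hz _); rewrite lerDl => /(_ J0).
    rewrite (GP z j) => a b.
    have -> : dp (z + J) - dp z = (dp (z + J) - G z) - (dp z - G z) by ring.
    by apply: le_trans (ler_normB _ _) _; lra.
  have a1 : `|p (t1 + J) - L| <= d / 2 by apply: HT'; lra.
  have a2 : `|p (t1 + h + J) - L| <= d / 2.
    apply: HT'; have : - 1 <= h by move: h1; rewrite ler_norml => /andP[].
    by lra.
  have -> : p (t1 + h) - p t1 = (p (t1 + h + J) - L) - (p (t1 + J) - L)
      - (p (t1 + h + J) - p (t1 + h) - (p (t1 + J) - p t1)) by ring.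
  apply: le_trans (ler_normB _ _) _; rewrite addrC lerD//.
  by apply: le_trans (ler_normB _ _) _; lra.
have D2 := HT t1 (_ : T <= t1); rewrite -[X in `|X|](subrK (dp t1)).
apply: le_trans (ler_normD _ _) _; rewrite distrC.
by have := D2 (ltac:(lra)); lra.
Qed.

End ComplexDerivative.

(** ** The asymptotic state *)

Section Asymptotics.
Context {R : realType}.
Implicit Types (a b : lattice -> R[i]) (n m k : lattice) (v : R -> lattice -> R[i]).

(** The equation mode by mode: a derivative in [H^-1] is in particular a derivative
    of each coefficient. *)
Definition nls v := [/\ forall t, exists A, inh1 (v t) A,
  forall t0 e, 0 < e -> \forall t \near t0, inh1 (fun n => v t n - v t0 n) e &
  forall t n, cderive (fun s => v s n) t ('i%C * (cub (v t) n + (freq2 n)%:C%C * v t n))].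

(** The phase may depend on the time in an arbitrary way. *)
Definition asymptotic v (w : R -> lattice -> R[i]) := forall e, 0 < e -> exists T : R,
  forall t, T <= t -> exists y : R, inh1 (fun n => v t n - cis y * w t n) e.

Lemma inh1_cis (y : lattice -> R) a A : inh1 a A -> inh1 (fun n => cis (y n) * a n) A.
Proof. by apply: sumle_le => n; rewrite modulusM modulus_cis mul1r. Qed.

Lemma cub_cis y a A n : inh1 a A -> cub (fun n => cis y * a n) n = cis y * cub a n.
Proof.
move=> aA; rewrite /cub /tri -csumZ; last exact: (tri_summ aA aA aA).
apply: eq_csum => pq; rewrite conjcM conj_cis.
have := cisNK y (R := R); set c := cis y; set d := cis (- y) => e.
have -> : c * a pq.1 * (d * (a pq.2)^*%C) * (c * a (n - pq.1 + pq.2)) =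
  (c * d) * (c * (a pq.1 * (a pq.2)^*%C * a (n - pq.1 + pq.2))) by ring.
by rewrite e mul1r.
Qed.

Lemma free_propagator_periodic t (k : nat) a :
  free_propagator (t + k%:R * (2 * pi)) a = free_propagator t a.
Proof.
apply/funext => n; rewrite /free_propagator; congr (_ * _).
rewrite mulrDl /freq2 mulrAC -(cis_periodic (t * _) (k%:Z * (n.1 ^+ 2 + n.2 ^+ 2))).
by rewrite rmorphM.
Qed.

Let inh1_le a A n : inh1 a A -> modulus (a n) <= Num.sqrt A.
Proof. by move=> aA; apply: modulus_le_sqrt; exact: sumle_term (inh1_l2 aA). Qed.

Let mul_close (x y z w : R[i]) M d1 d2 : modulus (x - z) <= d1 -> modulus (y - w) <= d2 ->
  modulus y <= M -> modulus z <= M -> modulus (x * y^*%C - z * w^*%C) <= M * (d1 + d2).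
Proof.
move=> h1 h2 h3 h4.
have -> : x * y^*%C - z * w^*%C = (x - z) * y^*%C + z * (y - w)^*%C.
  by rewrite conjcB; ring.
apply: le_trans (modulusD _ _) _; rewrite !modulusM !modulusJ mulrDr [M * d1]mulrC.
by apply: lerD; apply: ler_pM => //; exact: modulus_ge0.
Qed.

Let exchange a n m : R[i] := cub a n * (a m)^*%C - a n * (cub a m)^*%C.

Let close_estimate A n m : 0 <= A -> exists2 K, 0 < K & forall D, 0 <= D <= 1 -> forall b z,
  inh1 z A -> inh1 (fun n => b n - z n) D ->
  modulus (b n * (b m)^*%C - z n * (z m)^*%C) <= K * Num.sqrt D /\
  modulus (exchange b n m - exchange z n m) <= K * Num.sqrt D.
Proof.
move=> A0; pose B := 2 + 2 * A.
have B0 : 0 <= B by rewrite /B; lra.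
have k0 := kappa_ge0 (R := R).
pose M := Num.sqrt B + Num.sqrt (kappa * (B * B * B)).
pose L := Num.sqrt (9 * kappa * B ^+ 2) + 1.
have M1 : Num.sqrt B <= M by rewrite /M lerDl sqrtr_ge0.
have M2 : Num.sqrt (kappa * (B * B * B)) <= M by rewrite /M lerDr sqrtr_ge0.
have M0 : 0 <= M by apply: le_trans M1; exact: sqrtr_ge0.
have L1 : 1 <= L by rewrite /L lerDr sqrtr_ge0.
exists (4 * M * L + 1); first by rewrite ltr_wpDl// mulr_ge0 ?mulr_ge0//; lra.
move=> D /andP[D0 D1] b z zA bz; set s := Num.sqrt D.
have s0 : 0 <= s by exact: sqrtr_ge0.
have zB : inh1 z B by apply: sumle_weak zA; rewrite /B; lra.
have bB : inh1 b B by have := inh1_addr bz zA; apply: sumle_weak; rewrite /B; lra.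
have db j : modulus (b j - z j) <= s by exact: (inh1_le j bz).
have dc j : modulus (cub b j - cub z j) <= (L - 1) * s.
  rewrite /L addrK /s -sqrtrM ?mulr_ge0 ?sqr_ge0//; apply: modulus_le_sqrt.
  exact: sumle_term (cub_diff bB zB bz).
have b1 j : modulus (b j) <= M by exact: le_trans (inh1_le j bB) M1.
have z1 j : modulus (z j) <= M by exact: le_trans (inh1_le j zB) M1.
have cb j : modulus (cub b j) <= M.
  by apply: le_trans M2; apply: modulus_le_sqrt; exact: sumle_term (cub_l2 bB).
have cz j : modulus (cub z j) <= M.
  by apply: le_trans M2; apply: modulus_le_sqrt; exact: sumle_term (cub_l2 zB).
have MLs : 0 <= M * L * s by rewrite !mulr_ge0//; lra.
have Ms : M * s <= M * L * s by rewrite -mulrA ler_wpM2l// ler_peMl.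
split.
  apply: le_trans (mul_close (db n) (db m) (b1 m) (z1 n)) _.
  have -> : M * (s + s) = 2 * (M * s) by ring.
  have -> : (4 * M * L + 1) * s = 4 * (M * L * s) + s by ring.
  lra.
have -> : exchange b n m - exchange z n m =
  (cub b n * (b m)^*%C - cub z n * (z m)^*%C) - (b n * (cub b m)^*%C - z n * (cub z m)^*%C).
  by rewrite /exchange; ring.
apply: le_trans (modulusB _ _) _.
have h1 := mul_close (dc n) (db m) (b1 m) (cz n).
have h2 := mul_close (db n) (dc m) (cb m) (z1 n).
apply: le_trans (lerD h1 h2) _.
have -> : M * ((L - 1) * s + s) + M * (s + (L - 1) * s) = 2 * (M * L * s) by ring.
have -> : (4 * M * L + 1) * s = 4 * (M * L * s) + s by ring.
lra.
Qed.

(** The quantity [v n * conj (v m)], freed of its linear oscillation, converges,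
    and its derivative is the difference of the two sides below up to a
    unimodular factor, asymptotically [2 * pi]-periodic because all frequencies
    are integers.  The unknown phase cancels throughout. *)
Lemma asymptotic_exchange v a A : nls v -> inh1 a A ->
  asymptotic v (fun t => free_propagator t a) -> forall t n m,
  cub (free_propagator t a) n * (free_propagator t a m)^*%C =
  free_propagator t a n * (cub (free_propagator t a) m)^*%C.
Proof.
move=> [_ _ dv] aA va t n m; have A0 := sumle_ge0 aA.
pose w t := free_propagator t a.
have wA s : inh1 (w s) A by apply: (inh1_cis (fun n => s * freq2 n)).
pose om : R := freq2 n - freq2 m.
pose q s := v s n * (v s m)^*%C * cis (s * (- om)).
pose dq s := 'i%C * exchange (v s) n m * cis (s * (- om)).
pose G s := 'i%C * exchange (w s) n m * cis (s * (- om)).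
pose L := a n * (a m)^*%C.
have qd s : cderive q s (dq s).
  apply: (cderive_eq _ (cderiveM (cderiveM (dv s n) (cderive_conj (dv s m))) (cderive_cis (- om) s))).
  rewrite /dq /exchange /om !conjcM conjcD conjcM !conjcR.
  have -> : (- (freq2 n - freq2 m))%:C%C = - ((freq2 n)%:C%C - (freq2 m)%:C%C) :> R[i].
    by rewrite -realcB; exact: rmorphN.
  have -> : ('i%C : R[i])^*%C = - 'i%C by rewrite /=; simpc.
  by ring.
have [K K0 HK] := close_estimate n m A0.
have close e : 0 < e -> exists T, forall s, T <= s -> modulus (q s - L) <= e /\ modulus (dq s - G s) <= e.
  move=> e0; pose D := Num.min 1 ((e / K) ^+ 2).
  have eK : 0 < e / K by rewrite divr_gt0.
  have D0 : 0 < D by rewrite lt_min ltr01 exprn_gt0.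
  have D1 : D <= 1 by rewrite ge_min lexx.
  have De : K * Num.sqrt D <= e.
    rewrite -ler_pdivlMl// mulrC.
    have h : D <= (e / K) ^+ 2 by rewrite ge_min lexx orbT.
    by apply: le_trans (ler_wsqrtr h) _; rewrite sqrtr_sqr ger0_norm// ltW.
  have [T HT] := va D D0; exists T => s sT; have [y hy] := HT s sT.
  have [h1 h2] := HK D (introT andP (conj (ltW D0) D1)) (v s) (fun n => cis y * w s n)
    (inh1_cis (fun=> y) (wA s)) hy.
  have yy := cisNK y (R := R).
  have E1 : exchange (fun n => cis y * w s n) n m = exchange (w s) n m.
    transitivity (cis y * cis (- y) * exchange (w s) n m); last by rewrite yy mul1r.
    rewrite /exchange !(cub_cis y _ (wA s)) (conjcM _ (w s m)) (conjcM _ (cub _ m)) !conj_cis.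
    by ring.
  have E2 : cis y * w s n * (cis y * w s m)^*%C * cis (s * (- om)) = L.
    have om0 : cis (s * freq2 n) * cis (- (s * freq2 m)) * cis (s * - om) = 1 :> R[i].
      by rewrite -!cisD (_ : _ + _ = 0) ?cis0// /om; ring.
    rewrite /w /free_propagator /L !conjcM !conj_cis.
    set c := cis y in yy *; set d := cis (- y) in yy *.
    set c1 := cis (s * freq2 n) in om0 *; set c2 := cis (- (s * freq2 m)) in om0 *; set c3 := cis (s * - om) in om0 *.
    have -> : c * (c1 * a n) * (d * (c2 * (a m)^*%C)) * c3 = (c * d) * (c1 * c2 * c3) * (a n * (a m)^*%C) by ring.
    by rewrite yy om0 !mul1r.
  split; apply: le_trans De.
    by rewrite -E2 /q -mulrBl modulusM modulus_cis mulr1.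
  by rewrite /dq /G -E1 -mulrBl -mulrBr !modulusM modulus_cis modulus_i mulr1 mul1r.
have Gper s (k : nat) : G (s + k%:R * (2 * pi)) = G s.
  rewrite /G /w free_propagator_periodic; congr (_ * _).
  rewrite mulrDl mulrAC.
  have -> : - om = (- ((n.1 ^+ 2 + n.2 ^+ 2) - (m.1 ^+ 2 + m.2 ^+ 2)))%:~R :> R.
    by rewrite rmorphN rmorphB.
  set z := (- _ : int); rewrite -[RHS](cis_periodic _ (k%:Z * z)).
  by rewrite rmorphM.
have GRe := asymptotically_periodic_derivative (p := fun s => complex.Re (q s))
  (dp := fun s => complex.Re (dq s)) (G := fun s => complex.Re (G s)) (L := complex.Re L).
have GIm := asymptotically_periodic_derivative (p := fun s => complex.Im (q s))
  (dp := fun s => complex.Im (dq s)) (G := fun s => complex.Im (G s)) (L := complex.Im L).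
have reB (x y : R[i]) : complex.Re x - complex.Re y = complex.Re (x - y) by case: x y => ? ? [].
have imB (x y : R[i]) : complex.Im x - complex.Im y = complex.Im (x - y) by case: x y => ? ? [].
have G0 : G t = 0.
  have r0 : complex.Re (G t) = 0.
    apply: GRe => [s|s k|e e0|e e0].
    - by have [] := qd s.
    - by rewrite Gper.
    - have [T HT] := close e e0; exists T => s sT; have [_ h] := HT s sT.
      by rewrite reB; exact: le_trans (Re_le_modulus _) h.
    - have [T HT] := close e e0; exists T => s sT; have [h _] := HT s sT.
      by rewrite reB; exact: le_trans (Re_le_modulus _) h.
  have i0 : complex.Im (G t) = 0.
    apply: GIm => [s|s k|e e0|e e0].
    - by have [] := qd s.
    - by rewrite Gper.
    - have [T HT] := close e e0; exists T => s sT; have [_ h] := HT s sT.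
      by rewrite imB; exact: le_trans (Im_le_modulus _) h.
    - have [T HT] := close e e0; exists T => s sT; have [h _] := HT s sT.
      by rewrite imB; exact: le_trans (Im_le_modulus _) h.
  by move: r0 i0; case: (G t) => ? ? /= -> ->.
have : modulus (exchange (w t) n m) = 0.
  by rewrite -(modulus0 (R := R)) -G0 /G !modulusM modulus_i modulus_cis mul1r mulr1.
by move=> /modulus_eq0/eqP; rewrite subr_eq0 => /eqP.
Qed.

(** [|f|^2 f] is the product of [|f|^2] with [f]: the pairs with a given difference
    are summed first. *)
Lemma cub_corr a A n : inh1 a A -> cub a n = csum (fun k => corr a k * a (n - k)) /\
  summ (fun k => corr a k * a (n - k)).
Proof.
move=> aA; have s0 := tri_summ aA aA aA n.
pose e (x : lattice * lattice) : lattice * lattice := (x.2, x.2 - x.1).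
have be : bijective e.
  by exists (fun x => (x.1 - x.2, x.1)) => -[p q]; rewrite /e /=; congr (_, _); ring.
pose H k p := a p * (a (p - k))^*%C * a (n - k).
have E : (fun pq => a pq.1 * (a pq.2)^*%C * a (n - pq.1 + pq.2)) \o e = fun x => H x.1 x.2.
  by apply/funext => -[k p]; rewrite /H /e /=; congr (_ * a _); ring.
have sE : summ (fun x => H x.1 x.2) by rewrite -E; apply: summ_inj s0; exact: bij_inj be.
have a2 := inh1_l2 aA.
have cs k : summ (fun p => a p * (a (p - k))^*%C).
  by exists (Num.sqrt A * Num.sqrt A); apply: inl2_mul a2 (inl2_conj (inl2_shift (- k) a2)).
have HE k : csum (H k) = corr a k * a (n - k).
  by rewrite mulrC /corr -csumZ//; apply: eq_csum => p; rewrite /H mulrC.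
split.
  rewrite /cub /tri -(csum_bij _ be) E (csum_pair sE).
  by apply: eq_csum => k; exact: HE.
have [B hB] := sE; exists B.
have [_ + _] := nsum_pair (F := fun k p => modulus (H k p)) (fun _ _ => modulus_ge0 _) hB.
apply: sumle_le => k; rewrite -HE; apply: csum_le.
apply: (sumle_nsum (A := B)); first by move=> ?; exact: modulus_ge0.
by have := sumle_inj (e := fun p => (k, p)) _ hB; apply => x y [].
Qed.

End Asymptotics.

Section Potential.
Context {R : realType}.
Implicit Types (a b : lattice -> R[i]) (n m k : lattice) (v : R -> lattice -> R[i]).

Definition potential a : R := nsum (fun k => modulus (corr a k) ^+ 2).

(** [conj f * |f|^2 f = | |f|^2 |^2], and [corr a] are the Fourier coefficients
    of [|f|^2]. *)
Lemma quartic_potential a A : inh1 a A ->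
  [/\ sumle (fun k => modulus (corr a k) ^+ 2) (potential a),
      summ (fun n => (a n)^*%C * cub a n) &
      csum (fun n => (a n)^*%C * cub a n) = (potential a)%:C%C].
Proof.
move=> aA; have a2 := inh1_l2 aA; have [t [t0 ht tt]] := tri_dom aA aA aA.
pose F n (pq : lattice * lattice) := (a n)^*%C * (a pq.1 * (a pq.2)^*%C * a (n - pq.1 + pq.2)).
have sF : summ (fun x => F x.1 x.2).
  exists (Num.sqrt A * Num.sqrt (kappa * (A * A * A))).
  apply: (sumle_pair (F := fun n pq => modulus (F n pq)) (g := fun n => modulus (a n) * t n)).
  - by move=> *; exact: modulus_ge0.
  - move=> n; apply: sumle_le (sumleZ (modulus_ge0 (a n)) (ht n)) => pq.
    by rewrite [in leLHS]modulusM modulusJ.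
  - exact: sumle_cauchy_schwarz a2 tt.
have E1 : csum (fun x => F x.1 x.2) = csum (fun n => (a n)^*%C * cub a n).
  rewrite (csum_pair sF); apply: eq_csum => n; rewrite csumZ//; exact: (tri_summ aA aA aA n).
pose e (x : lattice * (lattice * lattice)) : lattice * (lattice * lattice) :=
  (x.2.1, (x.2.2, x.2.2 - x.1)).
have be : bijective e.
  exists (fun x => (x.2.1 - x.2.2, (x.1, x.2.1))) => -[n [p q]]; rewrite /e /=; congr (_, (_, _)); ring.
pose H k (np : lattice * lattice) :=
  ((a np.1)^*%C * a (np.1 - k)) * (a np.2 * (a (np.2 - k))^*%C).
have EH : (fun x => F x.1 x.2) \o e = fun x => H x.1 x.2.
  apply/funext => -[k [n p]]; rewrite /F /H /e /=.
  have -> : n - p + (p - k) = n - k by ring.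
  by ring.
have sH : summ (fun x => H x.1 x.2) by rewrite -EH; apply: summ_inj sF; exact: bij_inj be.
have cs k : summ (fun p => a p * (a (p - k))^*%C).
  by exists (Num.sqrt A * Num.sqrt A); apply: inl2_mul a2 (inl2_conj (inl2_shift (- k) a2)).
have HE k : csum (H k) = (modulus (corr a k) ^+ 2)%:C%C.
  have sHk : summ (H k) by have := summ_inj (e := fun np => (k, np)) _ sH; apply => x y [].
  rewrite (csum_pair (F := fun n p => H k (n, p)) sHk) -mulJc mulrC -csum_conj.
  rewrite mulrC -csumZ; last first.
    have [B hB] := cs k; exists B; by apply: sumle_le hB => p; rewrite modulusJ.
  apply: eq_csum => n; rewrite /H /= csumZ//.
  by rewrite -/(corr a k) mulrC conjcM conjcK.
have sC : sumle (fun k => modulus (corr a k) ^+ 2) (potential a).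
  have [B hB] := sH; apply: (sumle_nsum (A := B)); first by move=> k; exact: sqr_ge0.
  have [_ + _] := nsum_pair (F := fun k np => modulus (H k np)) (fun _ _ => modulus_ge0 _) hB.
  apply: sumle_le => k.
  have -> : modulus (corr a k) ^+ 2 = modulus (csum (H k)).
    by rewrite HE modulusC ger0_norm// sqr_ge0.
  apply: csum_le; apply: (sumle_nsum (A := B)); first by move=> ?; exact: modulus_ge0.
  by have := sumle_inj (e := fun p => (k, p)) _ hB; apply => x y [].
split => //.
  exists (Num.sqrt A * Num.sqrt (kappa * (A * A * A))).
  exact: (inl2_mul (inl2_conj a2) (cub_l2 aA)).
rewrite -E1 -(csum_bij _ be) EH (csum_pair sH).
rewrite -(csum_ge0E (fun k => sqr_ge0 _) sC).
by apply: eq_csum => k; exact: HE.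
Qed.

(** Jensen's inequality for [|f|^2], by keeping the zero frequency only. *)
Lemma sqr_mass_le_potential a A : inh1 a A -> mass a ^+ 2 <= potential a.
Proof.
move=> aA; have [h _ _] := quartic_potential aA.
by have := sumle_term 0 h; rewrite (corr0 aA) modulusC real_normK// num_real.
Qed.

Lemma mass_term a A n : inh1 a A -> modulus (a n) ^+ 2 <= mass a.
Proof.
move=> aA; exact: (sumle_term n (sumle_nsum (fun _ => sqr_ge0 _) (inh1_l2 aA))).
Qed.

(** Division by one nonzero coefficient makes [cub a] proportional to [a].  The
    factor is real by the hypothesis at [n = m], and nonzero because the potential
    is positive, so that [corr_delta] applies. *)
Lemma exchange_corr a A k : inh1 a A ->
  (forall n m, cub a n * (a m)^*%C = a n * (cub a m)^*%C) -> k != 0 -> corr a k = 0.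
Proof.
move=> aA ex k0.
have [a0|/existsNP[m0 am0]] := pselect (forall n, a n = 0).
  rewrite /corr (csum_seq (s := [::]))// => [|i _]; first by rewrite big_nil.
  by rewrite a0 mul0r.
have cm0 : (a m0)^*%C != 0 by rewrite conjc_eq0; apply/eqP.
pose c := (cub a m0)^*%C / (a m0)^*%C.
have ac n : cub a n = c * a n.
  by apply: (mulIf cm0); rewrite ex [c * _]mulrC -[RHS]mulrA /c divfK.
have cr : c = (complex.Re c)%:C%C.
  have : c^*%C = c.
    have := ex m0 m0; rewrite ac (conjcM c) => h.
    apply: (mulIf cm0); apply: (mulIf (_ : a m0 != 0)); first exact/eqP.
    by rewrite [LHS]mulrC [RHS]mulrAC h mulrA.
  by case: (c) => x y /= [] h; congr Complex; lra.
apply: (corr_delta (c := complex.Re c) aA) => //; first by move=> n; rewrite -cr.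
apply/eqP => c0; rewrite c0 in cr.
have [_ _] := quartic_potential aA.
rewrite (csum_seq (s := [::]))//; last by move=> i _; rewrite ac cr mul0r mulr0.
rewrite big_nil => -[] p0.
have m2 := sqr_mass_le_potential aA.
have mt := mass_term m0 aA.
have : 0 < modulus (a m0).
  rewrite lt_neqAle modulus_ge0 andbT eq_sym; apply/eqP => /modulus_eq0; exact: am0.
move=> h; have : 0 < modulus (a m0) ^+ 2 by rewrite exprn_gt0.
by rewrite -p0 in m2; nra.
Qed.

Lemma asymptotic_single_mode v a A : nls v -> inh1 a A ->
  asymptotic v (fun t => free_propagator t a) -> exists n0, forall n, n != n0 -> a n = 0.
Proof.
move=> vn aA va; apply: (free_single_mode aA) => t k k0.
have wA : inh1 (free_propagator t a) A by exact: (inh1_cis (fun n => t * freq2 n) aA).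
by apply: exchange_corr wA _ k0 => n m; exact: asymptotic_exchange vn aA va t n m.
Qed.

End Potential.

(** * Conservation laws *)

Section HarmonicWeights.
Context {R : realType}.
Implicit Types (a : lattice -> R[i]) (n p q m : lattice).

Definition harm (N : nat) : R := \sum_(r < N) r.+1%:R^-1.

Lemma harm_ge0 N : 0 <= harm N.
Proof. by apply: sumr_ge0 => r _; rewrite invr_ge0. Qed.

Lemma harm_unbounded x : exists N, x <= harm N.
Proof.
apply: contrapT => /forallNP h; apply: (@dvg_harmonic R).
apply: nondecreasing_is_cvgn.
  apply/nondecreasing_seqP => n; rewrite /series /= big_nat_recr//= lerDl.
  by rewrite /harmonic invr_ge0.
exists x => _ [N _ <-]; have := h N; move/negP; rewrite -ltNge /series /= big_mkord.
exact: ltW.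
Qed.

Lemma harm_limit x y z : (forall N, harm N * x <= harm N * y + z) -> x <= y.
Proof.
move=> h; rewrite leNgt; apply/negP => yx.
have xy : 0 < x - y by rewrite subr_gt0.
have [N hN] := harm_unbounded ((`|z| + 1) / (x - y)).
have := h N; rewrite -lerBlDl -mulrBr.
move: hN; rewrite ler_pdivrMr// => h1 h2.
by have := ler_norm z; lra.
Qed.

Variable N : nat.

(** The radii below both [N] and the size of [n], relative to that size.  This ratio
    decreases with the size, so that the factor belonging to the largest of three
    frequencies can be shared between the two others. *)
Definition share n : R := Num.min (wt n) N%:R / wt n.

Lemma share_ge0 n : 0 <= share n.
Proof. by rewrite divr_ge0 ?wt_ge0// le_min wt_ge0 ler0n. Qed.

Lemma share_le n m : (sz n <= sz m)%N -> share m <= share n.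
Proof.
move=> nm; have w : wt n <= wt m :> R by rewrite /wt ler_nat.
rewrite /share ler_pdivrMr ?wt_gt0// mulrAC ler_pdivlMr ?wt_gt0//.
have n0 := wt_ge0 (R := R) n; have m0 := wt_ge0 (R := R) m; have N0 : 0 <= N%:R :> R by [].
rewrite !minEle; case: ifP => h1; case: ifP => h2.
- by rewrite mulrC.
- by move/negbT: h2; rewrite -ltNge => h2; move: h1 => h1; rewrite mulrC; nra.
- by rewrite mulrC ler_wpM2l//; lra.
- by rewrite ler_wpM2l.
Qed.

(** Two dimensions are critical: without the cutoff at [N] the sum diverges
    logarithmically. *)
Lemma sumle_share : sumle (fun n => (Num.sqrt (share n) / wt n) ^+ 2) (8 * (harm N + 1)).
Proof.
pose psi (j : nat) : R := Num.min j.+1%:R N%:R / j.+1%:R ^+ 3.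
have psi0 j : 0 <= psi j by rewrite divr_ge0 ?exprn_ge0// le_min !ler0n.
have := @sumle_radial R psi (8 * (harm N + 1)) psi0.
have E n : (Num.sqrt (share n) / wt n) ^+ 2 = psi (sz n).
  rewrite exprMn sqr_sqrtr ?share_ge0// /share /psi -/(wt n) -[LHS]mulrA; congr (_ * _).
  by rewrite -exprS exprVn.
under [X in _ -> sumle X _]eq_fun do rewrite E.
apply => M.
have -> : \sum_(j < M) 8 * j.+1%:R * psi j = 8 * \sum_(j < M) Num.min j.+1%:R N%:R / j.+1%:R ^+ 2.
  rewrite mulr_sumr; apply: eq_bigr => j _; rewrite /psi; field.
  by rewrite ?pnatr_eq0 /= ?addr_eq0; apply/negP => /eqP h; have := ltr0Sn R j; rewrite -natr1; lra.
rewrite ler_wpM2l//.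
have small (k : nat) : (k <= N)%N ->
    \sum_(j < k) Num.min j.+1%:R N%:R / j.+1%:R ^+ 2 <= harm N.
  move=> kN; apply: le_trans (_ : harm k <= _).
    apply: ler_sum => j _; rewrite ler_pdivrMr ?exprn_gt0//.
    by rewrite expr2 mulrA mulVf ?mul1r ?pnatr_eq0// ge_min lexx.
  rewrite /harm -(subnKC kN) big_split_ord/= lerDl; apply: sumr_ge0 => j _.
  by rewrite invr_ge0.
have [MN|NM] := leqP M N.
  by apply: le_trans (small M MN) _; rewrite lerDl.
rewrite -(subnKC (ltnW NM)) big_split_ord/=; apply: lerD; first exact: small.
have [N0|N0] := posnP N.
  rewrite big1// => j _; have N0R : N%:R = 0 :> R by rewrite N0.
  by rewrite N0R (min_idPr (ler0n _ _)) mul0r.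
apply: le_trans (_ : N%:R * \sum_(i < M - N) ((N + i).+1%:R ^+ 2)^-1 <= _).
  rewrite mulr_sumr; apply: ler_sum => j _.
  by rewrite ler_wpM2r ?invr_ge0 ?exprn_ge0// ge_min lexx orbT.
apply: le_trans (ler_wpM2l (ler0n _ N) (sum_inv_sqr_tail (M - N) N0)) _.
have Np : 0 < N%:R :> R by rewrite ltr0n.
rewrite mulrBr mulfV ?gt_eqF// gerBl mulr_ge0// invr_ge0//.
Qed.

Definition maxsz p q m : nat := maxn (maxn (sz p) (sz q)) (sz m).

(** Each radius [r] with [sz n <= r] has weight at most [1 / wt n]. *)
Lemma radii_count n (M : nat) :
  wt n * (\sum_(r < N) (if (sz n <= r)%N && (r < M)%N then r.+1%:R^-1 else 0)) <=
  Num.min M%:R N%:R :> R.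
Proof.
rewrite mulr_sumr; apply: le_trans (_ : \sum_(r < N) (if (r < M)%N then 1 else 0) <= _).
  apply: ler_sum => r _; case: (leqP (sz n) r) => /= h; last by rewrite mulr0; case: ifP.
  case: ifP => _; last by rewrite mulr0.
  by rewrite ler_pdivrMr// mul1r /wt ler_nat.
rewrite -big_mkcond/= le_min; apply/andP; split.
  have [MN|NM] := leqP M N; first by rewrite -(big_ord_widen N (fun=> 1))// sumr_const card_ord.
  apply: le_trans (_ : \sum_(r < N) 1 <= _); last by rewrite sumr_const card_ord ler_nat ltnW.
  by rewrite big_mkcond/=; apply: ler_sum => r _; case: ifP.
apply: le_trans (_ : \sum_(r < N) 1 <= _); last by rewrite sumr_const card_ord.
by rewrite big_mkcond/=; apply: ler_sum => r _; case: ifP.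
Qed.

End HarmonicWeights.

Section FluxEstimates.
Context {R : realType}.
Implicit Types (a : lattice -> R[i]) (n p q m : lattice).
Notation lattice3 := (lattice * (lattice * lattice))%type.

Lemma sumle_prod3 (u Z : lattice -> R) U B : (forall n, 0 <= u n) -> (forall n, 0 <= Z n) ->
  sumle u U -> sumle Z B ->
  sumle (fun x : lattice3 => u x.1 * (Z x.2.1 * Z x.2.2)) (U * (B * B)).
Proof.
move=> u0 Z0 uU ZB.
have B0 := sumle_ge0 ZB.
have ZZ : sumle (fun y : lattice * lattice => Z y.1 * Z y.2) (B * B).
  apply: (sumle_pair (F := fun i j => Z i * Z j) (g := fun i => Z i * B)).
  - by move=> i j; rewrite mulr_ge0.
  - by move=> i; exact: sumleZ.
  - by have := sumleZ B0 ZB; apply: sumle_le => i; rewrite mulrC.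
apply: (sumle_pair (F := fun n y => u n * (Z y.1 * Z y.2)) (g := fun n => u n * (B * B))).
- by move=> i j; rewrite !mulr_ge0.
- by move=> i; exact: sumleZ.
- by rewrite [U * _]mulrC; apply: sumle_le (sumleZ (mulr_ge0 B0 B0) uU) => i; rewrite [u i * _]mulrC.
Qed.

(** Cauchy-Schwarz, with the summable factor [Z * Z] split evenly. *)
Lemma sumle_quartic (y Y Z : lattice -> R) A D B (i j : lattice3 -> lattice3) :
  (forall n, 0 <= Z n) ->
  sumle (fun n => y n ^+ 2) A -> sumle (fun n => Y n ^+ 2) D -> sumle Z B ->
  injective i -> injective j -> (forall x, (i x).2 = (j x).2) ->
  sumle (fun x => y (i x).1 * Y (j x).1 * (Z (i x).2.1 * Z (i x).2.2))
    (Num.sqrt A * Num.sqrt D * (B * B)).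
Proof.
move=> Z0 yA YD ZB ii jj ij.
have B0 := sumle_ge0 ZB; have A0 := sumle_ge0 yA; have D0 := sumle_ge0 YD.
have h1 := sumle_inj ii (sumle_prod3 (fun n => sqr_ge0 (y n)) Z0 yA ZB).
have h2 := sumle_inj jj (sumle_prod3 (fun n => sqr_ge0 (Y n)) Z0 YD ZB).
pose f x := y (i x).1 * Num.sqrt (Z (i x).2.1 * Z (i x).2.2).
pose g x := Y (j x).1 * Num.sqrt (Z (j x).2.1 * Z (j x).2.2).
have ZZ x : 0 <= Z (i x).2.1 * Z (i x).2.2 by rewrite mulr_ge0.
have ZZ' x : 0 <= Z (j x).2.1 * Z (j x).2.2 by rewrite mulr_ge0.
have f2 : sumle (fun x => f x ^+ 2) (A * (B * B)).
  by apply: sumle_le h1 => x; rewrite /f exprMn sqr_sqrtr.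
have g2 : sumle (fun x => g x ^+ 2) (D * (B * B)).
  by apply: sumle_le h2 => x; rewrite /g exprMn sqr_sqrtr.
apply: (sumle_weak _ (sumle_le _ (sumle_cauchy_schwarz f2 g2))).
  have sB : Num.sqrt (B * B) = B by rewrite -expr2 sqrtr_sqr ger0_norm.
  by rewrite (sqrtrM _ A0) (sqrtrM _ D0) sB mulrACA.
by move=> x; rewrite /f /g -ij [leRHS]mulrACA -expr2 sqr_sqrtr.
Qed.

Section Shares.
Variables (a : lattice -> R[i]) (A tau : R) (K N : nat).
Hypothesis aA : inh1 a A.
Hypothesis aK : inh1 (fun n => a n - trunc (box K) a n) tau.

Let y n := wt n * modulus (a n).
Let Y n := wt n * modulus (a n - trunc (box K) a n).
Let Z n := Num.sqrt (share N n) * modulus (a n).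
Let B := Num.sqrt (8 * (harm N + 1)) * Num.sqrt A.

Let y0 n : 0 <= y n. Proof. by rewrite mulr_ge0 ?wt_ge0 ?modulus_ge0. Qed.
Let Y0 n : 0 <= Y n. Proof. by rewrite mulr_ge0 ?wt_ge0 ?modulus_ge0. Qed.
Let Z0 n : 0 <= Z n. Proof. by rewrite mulr_ge0 ?sqrtr_ge0 ?modulus_ge0. Qed.

Let ZB : sumle Z B.
Proof.
have := sumle_cauchy_schwarz (sumle_share N) aA; apply: sumle_le => n.
by rewrite mulrA divfK// wt_neq0.
Qed.

Let share_sqrt n p q : (sz p <= sz n)%N -> (sz q <= sz n)%N ->
  (share N n : R) <= Num.sqrt (share N p) * Num.sqrt (share N q).
Proof.
move=> pn qn; have s0 := @share_ge0 R N.
rewrite -[leLHS](sqr_sqrtr (s0 n)) expr2.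
by apply: ler_pM; rewrite ?sqrtr_ge0// ler_wsqrtr// share_le.
Qed.

(* the largest of the three frequencies carries the derivative *)
Let dominant n p q : (K < sz n)%N -> (sz p <= sz n)%N -> (sz q <= sz n)%N ->
  Num.min (sz n).+1%:R N%:R * (modulus (a n) * modulus (a p) * modulus (a q)) <= Y n * (Z p * Z q).
Proof.
move=> Kn pn qn.
have -> : Num.min (sz n).+1%:R N%:R = share N n * wt n :> R by rewrite /share divfK// wt_neq0.
have -> : Y n = wt n * modulus (a n).
  by rewrite /Y /trunc mem_box leqNgt Kn /= subr0.
have -> : share N n * wt n * (modulus (a n) * modulus (a p) * modulus (a q)) =
  share N n * (wt n * modulus (a n) * (modulus (a p) * modulus (a q))) by ring.
have -> : wt n * modulus (a n) * (Z p * Z q) = (Num.sqrt (share N p) * Num.sqrt (share N q)) *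
  (wt n * modulus (a n) * (modulus (a p) * modulus (a q))) by rewrite /Z; ring.
by rewrite ler_wpM2r ?share_sqrt// !mulr_ge0 ?wt_ge0 ?modulus_ge0.
Qed.

Let quartic_pointwise p q m :
  Num.min (maxsz p q m).+1%:R N%:R * (modulus (a p) * modulus (a q) * modulus (a m)) <=
  K.+1%:R * (modulus (a p) * modulus (a q) * modulus (a m)) +
  (Y p * (Z q * Z m) + Y q * (Z p * Z m) + Y m * (Z p * Z q)).
Proof.
have t0 : 0 <= modulus (a p) * modulus (a q) * modulus (a m) by rewrite !mulr_ge0 ?modulus_ge0.
have e0 i j k : 0 <= Y i * (Z j * Z k).
  by apply: mulr_ge0; [exact: Y0|apply: mulr_ge0; exact: Z0].
have e1 := e0 p q m; have e2 := e0 q p m; have e3 := e0 m p q.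
have [MK|KM] := leqP (maxsz p q m) K.
  apply: le_trans (_ : K.+1%:R * (modulus (a p) * modulus (a q) * modulus (a m)) <= _).
    by rewrite ler_wpM2r// ge_min ler_nat ltnS MK.
  by rewrite lerDl !addr_ge0.
have K0 : 0 <= K.+1%:R * (modulus (a p) * modulus (a q) * modulus (a m)) by rewrite mulr_ge0.
have pM : (sz p <= maxsz p q m)%N by rewrite /maxsz; lia.
have qM : (sz q <= maxsz p q m)%N by rewrite /maxsz; lia.
have mM : (sz m <= maxsz p q m)%N by rewrite /maxsz; lia.
have : [\/ maxsz p q m = sz p, maxsz p q m = sz q | maxsz p q m = sz m].
  rewrite /maxsz; case: (leqP (maxn (sz p) (sz q)) (sz m)) => h; first by constructor 3.
  by case: (leqP (sz p) (sz q)) => h'; [constructor 2|constructor 1].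
case=> E; rewrite E in KM pM qM mM *.
- have := dominant KM qM mM; lra.
- have := dominant KM pM mM.
  have -> : modulus (a q) * modulus (a p) * modulus (a m) = modulus (a p) * modulus (a q) * modulus (a m) by ring.
  lra.
- have := dominant KM pM qM.
  have -> : modulus (a m) * modulus (a p) * modulus (a q) = modulus (a p) * modulus (a q) * modulus (a m) by ring.
  lra.
Qed.

(** Of the two derivatives of the energy, one falls on the frequency [n] and one
    on the largest of the three others.  Beyond [K] the latter sees only the tail
    of [a]; the shares left to the two remaining frequencies cost [harm N]. *)
Lemma quartic_share :
  sumle (fun x : lattice3 => let m := x.1 - x.2.1 + x.2.2 in
    wt x.1 * modulus (a x.1) * (Num.min (maxsz x.2.1 x.2.2 m).+1%:R N%:R *
      (modulus (a x.2.1) * modulus (a x.2.2) * modulus (a m))))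
    (K.+1%:R * (Num.sqrt A * Num.sqrt (kappa * (A * A * A)))
     + 3 * (Num.sqrt A * Num.sqrt tau * (8 * (harm N + 1) * A))).
Proof.
have A0 := sumle_ge0 aA; have H0 := harm_ge0 (R := R) N.
have BB : B * B = 8 * (harm N + 1) * A.
  by rewrite /B mulrACA -!expr2 !sqr_sqrtr// mulr_ge0// addr_ge0.
pose M (x : lattice3) := x.1 - x.2.1 + x.2.2.
pose T (x : lattice3) := modulus (a x.2.1) * modulus (a x.2.2) * modulus (a (M x)).
have h0 : sumle (fun x : lattice3 => wt x.1 * modulus (a x.1) * T x)
    (Num.sqrt A * Num.sqrt (kappa * (A * A * A))).
  have [t1 t2] := trilinear_bound (fun n => modulus_ge0 (a n)) (fun n => modulus_ge0 (a n))
    (fun n => modulus_ge0 (a n)) aA aA aA.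
  apply: (sumle_pair (F := fun n (pq : lattice * lattice) => wt n * modulus (a n) *
     (modulus (a pq.1) * modulus (a pq.2) * modulus (a (n - pq.1 + pq.2))))).
  - by move=> *; rewrite !mulr_ge0 ?wt_ge0 ?modulus_ge0.
  - by move=> n; apply: sumleZ (t1 n); exact: y0.
  - exact: sumle_cauchy_schwarz aA t2.
have S (i j : lattice3 -> lattice3) : injective i -> injective j -> (forall x, (i x).2 = (j x).2) ->
    sumle (fun x => y (i x).1 * Y (j x).1 * (Z (i x).2.1 * Z (i x).2.2))
    (Num.sqrt A * Num.sqrt tau * (8 * (harm N + 1) * A)).
  by move=> ii jj ij; have := sumle_quartic Z0 aA aK ZB ii jj ij; rewrite BB.
have i1 : injective (fun x => (x.1, (x.2.2, M x))).
  apply: (can_inj (g := fun x => (x.1, (x.1 + x.2.1 - x.2.2, x.2.1)))) => -[n [p q]].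
  by rewrite /M /=; congr (_, (_, _)); ring.
have j1 : injective (fun x => (x.2.1, (x.2.2, M x))).
  apply: (can_inj (g := fun x => (x.2.2 + x.1 - x.2.1, (x.1, x.2.1)))) => -[n [p q]].
  by rewrite /M /=; congr (_, (_, _)); ring.
have i2 : injective (fun x => (x.1, (x.2.1, M x))).
  apply: (can_inj (g := fun x => (x.1, (x.2.1, x.2.2 - x.1 + x.2.1)))) => -[n [p q]].
  by rewrite /M /=; congr (_, (_, _)); ring.
have j2 : injective (fun x => (x.2.2, (x.2.1, M x))).
  apply: (can_inj (g := fun x => (x.2.2 + x.2.1 - x.1, (x.2.1, x.1)))) => -[n [p q]].
  by rewrite /M /=; congr (_, (_, _)); ring.
have i3 : injective (fun x : lattice3 => (x.1, (x.2.1, x.2.2))).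
  by apply: (can_inj (g := id)) => -[n [p q]].
have j3 : injective (fun x => (M x, (x.2.1, x.2.2))).
  apply: (can_inj (g := fun x => (x.1 + x.2.1 - x.2.2, x.2))) => -[n [p q]].
  by rewrite /M /=; congr (_, _); ring.
have h1 := S _ _ i1 j1 (fun=> erefl).
have h2 := S _ _ i2 j2 (fun=> erefl).
have h3 := S _ _ i3 j3 (fun=> erefl).
have K0 : 0 <= K.+1%:R :> R by [].
have H := sumleD (sumleZ K0 h0) (sumleD (sumleD h1 h2) h3).
apply: (sumle_weak _ (sumle_le _ H)).
  by rewrite le_eqVlt; apply/orP; left; apply/eqP; ring.
move=> x /=; apply: le_trans (ler_wpM2l (y0 x.1) (quartic_pointwise x.2.1 x.2.2 (M x))) _.
by rewrite le_eqVlt; apply/orP; left; apply/eqP; rewrite /T /y; ring.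
Qed.

End Shares.

Lemma nsum_comb {I : Type} {T : choiceType} (s : seq I) (c : I -> R) (f : I -> T -> R) (X : T -> R) B :
  (forall i, 0 <= c i) -> (forall i x, 0 <= f i x) -> (forall i, exists M, sumle (f i) M) ->
  (forall x, \sum_(i <- s) c i * f i x <= X x) -> sumle X B ->
  \sum_(i <- s) c i * nsum (f i) <= nsum X.
Proof.
move=> c0 f0 fM fX XB.
have [E [M HM]] : nsum (fun x => \sum_(i <- s) c i * f i x) = \sum_(i <- s) c i * nsum (f i) /\
    exists M, sumle (fun x => \sum_(i <- s) c i * f i x) M.
  elim: s {fX} => [|i s [IH [M HM]]].
    have -> : (fun x : T => \sum_(i <- [::]) c i * f i x) = fun=> 0 by apply/funext => x; rewrite big_nil.
    rewrite big_nil; split; last by exists 0; exact: sumle0.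
    by apply/eqP; rewrite eq_le nsum_ge0// andbT; apply: nsum_le => //; exact: sumle0.
  have [Mi HMi] := fM i.
  have -> : (fun x : T => \sum_(j <- i :: s) c j * f j x) = fun x => c i * f i x + \sum_(j <- s) c j * f j x.
    by apply/funext => x; rewrite big_cons.
  have h := sumleZ (c0 i) HMi.
  split; last by exists (c i * Mi + M); exact: sumleD.
  rewrite (nsumD _ _ h HM) ?big_cons ?IH ?(nsumZ _ _ HMi)//.
    by move=> x; rewrite mulr_ge0.
  by move=> x; apply: sumr_ge0 => j _; rewrite mulr_ge0.
rewrite -E; apply: nsum_le; first by move=> x; apply: sumr_ge0 => i _; rewrite mulr_ge0.
have X0 x : 0 <= X x by apply: le_trans (fX x); apply: sumr_ge0 => i _; rewrite mulr_ge0.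
by apply: sumle_le (sumle_nsum X0 XB).
Qed.

Lemma sum_box (r N : nat) (F : lattice -> R) : (r <= N)%N ->
  \sum_(n <- box r) F n = \sum_(n <- box N) (if (sz n <= r)%N then F n else 0).
Proof.
move=> rN; rewrite -big_mkcond/= -[RHS]big_filter; apply: perm_big; apply: uniq_perm.
- exact: uniq_box.
- by rewrite filter_uniq// uniq_box.
- move=> n; rewrite mem_filter !mem_box; case: leqP => //= h.
  by rewrite (leq_trans h rN).
Qed.

(** Only the radii between the size of [n] and that of the largest of the three
    other frequencies contribute, and their weights cancel one of the two factors
    [wt n] of the symbol.  The factor that remains in front of
    [harm N] is small with the tail of [a]. *)
Lemma energy_flux a A tau K N (g : lattice -> R) C : inh1 a A ->
  inh1 (fun n => a n - trunc (box K) a n) tau ->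
  (forall n, `|g n| <= C * wt n ^+ 2) -> 0 <= C ->
  \sum_(r < N) r.+1%:R^-1 * modulus (\sum_(n <- box r) (g n)%:C%C * ((a n)^*%C *
     (cub a n - cub (trunc (box r) a) n))) <=
  C * (K.+1%:R * (Num.sqrt A * Num.sqrt (kappa * (A * A * A)))
     + 3 * (Num.sqrt A * Num.sqrt tau * (8 * (harm N + 1) * A))).
Proof.
move=> aA aK gC C0.
pose t n (pq : lattice * lattice) := modulus (a pq.1) * modulus (a pq.2) * modulus (a (n - pq.1 + pq.2)).
pose M n (pq : lattice * lattice) := maxsz pq.1 pq.2 (n - pq.1 + pq.2).
pose f n r pq := if (r < M n pq)%N then t n pq else 0.
have t0 n pq : 0 <= t n pq by rewrite !mulr_ge0 ?modulus_ge0.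
have f0 n r pq : 0 <= f n r pq by rewrite /f; case: ifP.
have [t1 t2] := trilinear_bound (fun n => modulus_ge0 (a n)) (fun n => modulus_ge0 (a n))
    (fun n => modulus_ge0 (a n)) aA aA aA.
have fS n r : sumle (f n r) (nsum (t n)).
  by apply: sumle_le (t1 n) => pq; rewrite /f /t; case: ifP => // _; rewrite !mulr_ge0 ?modulus_ge0.
have diff n r : modulus (cub a n - cub (trunc (box r) a) n) <= nsum (f n r).
  have trA := inh1_trunc (box r) aA.
  rewrite /cub /tri -csumB; [|exact: (tri_summ aA aA aA n)|exact: (tri_summ trA trA trA n)].
  apply: csum_le; apply: sumle_le (sumle_nsum (f0 n r) (fS n r)) => pq.
  have tc q : (trunc (box r) a q)^*%C = if (sz q <= r)%N then (a q)^*%C else 0.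
    by rewrite /trunc mem_box; case: ifP => _ //; exact: conjc0.
  rewrite /f /M; case: ltnP => h; rewrite tc /trunc !mem_box; last first.
    move: h; rewrite /maxsz !geq_max => /andP[/andP[-> ->] ->].
    by rewrite subrr modulus0.
  rewrite /t; case: leqP => h1 /=; last by rewrite !mul0r subr0 !modulusM modulusJ.
  case: leqP => h2 /=; last by rewrite mulr0 mul0r subr0 !modulusM modulusJ.
  case: leqP => h3 /=; last by rewrite mulr0 subr0 !modulusM modulusJ.
  by move: h; rewrite /maxsz; lia.
pose X (x : lattice3) : R := C * (wt x.1 * modulus (a x.1) * (Num.min (M x.1 x.2).+1%:R N%:R * t x.1 x.2)).
have XB := sumleZ C0 (quartic_share N aA aK).
rewrite -/(X) in XB.
apply: le_trans (_ : \sum_(n <- box N) nsum (fun pq => X (n, pq)) <= _); last first.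
  have X0 n pq : 0 <= X (n, pq).
    by rewrite /X !mulr_ge0 ?wt_ge0 ?modulus_ge0// le_min !ler0n.
  have XB' : sumle (fun x : lattice3 => X (x.1, x.2)) (C * (K.+1%:R * (Num.sqrt A * Num.sqrt (kappa * (A * A * A)))
     + 3 * (Num.sqrt A * Num.sqrt tau * (8 * (harm N + 1) * A)))).
    by apply: sumle_le XB => -[n pq].
  have [_ h _] := nsum_pair (F := fun n pq => X (n, pq)) X0 XB'.
  by apply: h; exact: uniq_box.
apply: le_trans (_ : \sum_(r < N) \sum_(n <- box N) (if (sz n <= r)%N then
    r.+1%:R^-1 * (C * wt n ^+ 2 * modulus (a n) * nsum (f n r)) else 0) <= _).
  apply: ler_sum => r _.
  apply: le_trans (_ : r.+1%:R^-1 * \sum_(n <- box r) (C * wt n ^+ 2 * modulus (a n) * nsum (f n r)) <= _).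
    rewrite ler_wpM2l ?invr_ge0//.
    apply: le_trans (modulus_sum _ _) _; apply: ler_sum => n _.
    rewrite !modulusM modulusC modulusJ -mulrA; apply: ler_pM => //; rewrite ?mulr_ge0 ?modulus_ge0//.
    by rewrite ler_wpM2l ?modulus_ge0.
  by rewrite (sum_box _ (ltnW (ltn_ord r))) mulr_sumr; apply: ler_sum => n _; case: ifP; rewrite ?mulr0.
rewrite exchange_big/=; apply: ler_sum => n _.
rewrite -(big_mkord xpredT (fun r => if (sz n <= r)%N then r.+1%:R^-1 * (C * wt n ^+ 2 * modulus (a n) * nsum (f n r)) else 0)).
pose c (r : nat) : R := if (sz n <= r)%N then r.+1%:R^-1 * (C * wt n ^+ 2 * modulus (a n)) else 0.
rewrite (eq_bigr (fun r => c r * nsum (f n r))); last first.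
  by move=> r _; rewrite /c; case: ifP; rewrite ?mul0r// mulrA.
have w0 : 0 <= C * wt n ^+ 2 * modulus (a n) by rewrite !mulr_ge0 ?exprn_ge0 ?wt_ge0 ?modulus_ge0.
apply: (nsum_comb (B := C * (wt n * modulus (a n) * (N%:R * nsum (t n))))).
- by move=> r; rewrite /c; case: ifP => // _; rewrite mulr_ge0// invr_ge0.
- by move=> r pq; exact: f0.
- by move=> r; exists (nsum (t n)).
- move=> pq; rewrite /X /=.
  have := ler_wpM2l (_ : 0 <= C * (wt n * modulus (a n)) * t n pq) (radii_count N n (M n pq)).
  move=> /(_ _) h; apply: le_trans (_ : C * (wt n * modulus (a n)) * t n pq * (wt n *
      \sum_(r < N) (if (sz n <= r)%N && (r < M n pq)%N then r.+1%:R^-1 else 0)) <= _).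
    rewrite big_mkord mulrA mulr_sumr; apply: ler_sum => r _; rewrite /c /f.
    case: (leqP (sz n) r) => h1 /=; last by rewrite mul0r mulr0.
    case: ifP => _; last by rewrite !mulr0.
    by rewrite le_eqVlt; apply/orP; left; apply/eqP; ring.
  apply: le_trans (h _) _; first by rewrite !mulr_ge0 ?wt_ge0 ?modulus_ge0.
  rewrite [leLHS]mulrC mulrA [leRHS]mulrCA -!mulrA.
  rewrite [leRHS](_ : _ = Num.min (M n pq).+1%:R N%:R * (C * (wt n * (modulus (a n) * t n pq)))); last by ring.
  rewrite ler_wpM2r ?mulr_ge0 ?wt_ge0 ?modulus_ge0//.
  by rewrite le_min !ge_min ler_nat leqnSn lexx orbT.
- rewrite /X /=; apply: sumleZ => //; apply: sumleZ; first by rewrite mulr_ge0 ?wt_ge0 ?modulus_ge0.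
  apply: sumle_le (sumleZ (ler0n _ N) (t1 n)) => pq.
  by rewrite ler_wpM2r// ge_min lexx orbT.
Qed.

End FluxEstimates.

Section TruncatedEnergy.
Context {R : realType}.
Implicit Types (a b d : lattice -> R[i]) (n p q m k : lattice) (v : R -> lattice -> R[i]) (g : lattice -> R).

Lemma tail_subset a (s p : seq lattice) D : {subset s <= p} ->
  inh1 (fun n => a n - trunc s a n) D -> inh1 (fun n => a n - trunc p a n) D.
Proof.
move=> sp; apply: sumle_le => n; rewrite /trunc; case: (boolP (n \in p)) => np.
  by rewrite subrr modulus0 mulr0 expr0n sqr_ge0.
by rewrite (contraNF (sp n) np).
Qed.

Lemma tail_box a A e : inh1 a A -> 0 < e -> exists K, inh1 (fun n => a n - trunc (box K) a n) e.
Proof.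
move=> aA e0; have [s us hs] := trunc_approx aA e0.
exists (\max_(n <- s) sz n); apply: tail_subset hs => n ns.
by rewrite mem_box; exact: (leq_bigmax_seq n ns).
Qed.

Lemma tail_inh1 a A (s : seq lattice) : inh1 a A -> inh1 (fun n => a n - trunc s a n) A.
Proof.
apply: sumle_le => n; rewrite /trunc; case: ifP => _; last by rewrite subr0.
by rewrite subrr modulus0 mulr0 expr0n sqr_ge0.
Qed.

Lemma box_sub K r : (K <= r)%N -> {subset box K <= box r}.
Proof. by move=> Kr n; rewrite !mem_box => /leq_trans; apply. Qed.

Lemma potential_diff a b A D : inh1 a A -> inh1 b A -> inh1 (fun n => a n - b n) D ->
  `|potential a - potential b| <= Num.sqrt D * Num.sqrt (kappa * (A * A * A))
    + Num.sqrt A * Num.sqrt (9 * kappa * A ^+ 2 * D).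
Proof.
move=> aA bA abD.
have [_ s1 e1] := quartic_potential aA; have [_ s2 e2] := quartic_potential bA.
rewrite -modulusC realcB -e1 -e2 -csumB//; apply: csum_le.
have h1 := inl2_mul (inl2_conj (inh1_l2 abD)) (cub_l2 aA).
have h2 := inl2_mul (inl2_conj (inh1_l2 bA)) (cub_diff aA bA abD).
apply: sumle_le (sumleD h1 h2) => n.
have -> : (a n)^*%C * cub a n - (b n)^*%C * cub b n =
  (a n - b n)^*%C * cub a n + (b n)^*%C * (cub a n - cub b n) by rewrite conjcB; ring.
exact: modulusD.
Qed.

(** Energy, mass and momentum at once: [g] is the symbol of the quadratic part and
    [mu] the coefficient of the quartic part. *)
Definition energy g mu a : R := 2^-1 * nsum (fun n => g n * modulus (a n) ^+ 2) + mu / 4 * potential a.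

Definition energy_trunc g mu r a : R :=
  2^-1 * \sum_(n <- box r) g n * modulus (a n) ^+ 2 + mu / 4 * potential (trunc (box r) a).

Lemma sumle_symbol g C a A : (forall n, 0 <= g n <= C * wt n ^+ 2) -> 0 <= C -> inh1 a A ->
  sumle (fun n => g n * modulus (a n) ^+ 2) (C * A).
Proof.
move=> gC C0 aA; apply: sumle_le (sumleZ C0 aA) => n.
by have /andP[_ h] := gC n; rewrite exprMn [leRHS]mulrA ler_wpM2r// sqr_ge0.
Qed.

Lemma energy_trunc_close g mu C a A D r : (forall n, 0 <= g n <= C * wt n ^+ 2) -> 0 <= C ->
  inh1 a A -> inh1 (fun n => a n - trunc (box r) a n) D ->
  `|energy_trunc g mu r a - energy g mu a| <= C * D +
    `|mu| * (Num.sqrt D * Num.sqrt (kappa * (A * A * A))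
    + Num.sqrt A * Num.sqrt (9 * kappa * A ^+ 2 * D)).
Proof.
move=> gC C0 aA aD.
have g0 n : 0 <= g n by have /andP[] := gC n.
have tA := inh1_trunc (box r) aA.
have D0 := sumle_ge0 aD.
pose b n := a n - trunc (box r) a n.
have E : nsum (fun n => g n * modulus (a n) ^+ 2) =
    \sum_(n <- box r) g n * modulus (a n) ^+ 2 + nsum (fun n => g n * modulus (b n) ^+ 2).
  have -> : (fun n => g n * modulus (a n) ^+ 2) = fun n =>
      g n * modulus (trunc (box r) a n) ^+ 2 + g n * modulus (b n) ^+ 2.
    apply/funext => n; rewrite /b /trunc; case: ifP => _.
      by rewrite subrr modulus0 expr0n mulr0 addr0.
    by rewrite subr0 modulus0 expr0n mulr0 add0r.
  rewrite (nsumD _ _ (sumle_symbol gC C0 tA) (sumle_symbol gC C0 aD)).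
  - congr (_ + _); rewrite (nsum_seq (uniq_box r)).
    + rewrite big_seq [RHS]big_seq; apply: eq_bigr => n nb.
      by rewrite /trunc nb.
    + by move=> n; rewrite mulr_ge0 ?sqr_ge0.
    + by move=> n /negPf h; rewrite /trunc h modulus0 expr0n mulr0.
  - by move=> n; rewrite mulr_ge0 ?sqr_ge0.
  - by move=> n; rewrite mulr_ge0 ?sqr_ge0.
have h1 : `|nsum (fun n => g n * modulus (b n) ^+ 2)| <= C * D.
  rewrite ger0_norm; last by apply: nsum_ge0 => n; rewrite mulr_ge0 ?sqr_ge0.
  by apply: nsum_le (sumle_symbol gC C0 aD) => n; rewrite mulr_ge0 ?sqr_ge0.
have abD : inh1 (fun n => trunc (box r) a n - a n) D.
  by apply: sumle_le aD => n; rewrite -modulusN opprB.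
have h2 := potential_diff tA aA abD.
have -> : energy_trunc g mu r a - energy g mu a =
  mu / 4 * (potential (trunc (box r) a) - potential a) - 2^-1 * nsum (fun n => g n * modulus (b n) ^+ 2).
  by rewrite /energy_trunc /energy E; ring.
apply: le_trans (ler_normB _ _) _; rewrite addrC; apply: lerD.
  rewrite normrM ger0_norm//; have := normr_ge0 (nsum (fun n => g n * modulus (b n) ^+ 2)); lra.
rewrite normrM; apply: ler_pM => //.
by rewrite normrM normfV [`|4|]ger0_norm//; have := normr_ge0 mu; lra.
Qed.

Lemma weighted_sum_le (x : nat -> R) E e K N : 0 <= E -> 0 <= e -> (forall r, x r <= E) ->
  (forall r, (K <= r)%N -> x r <= e) -> \sum_(r < N) r.+1%:R^-1 * x r <= K%:R * E + e * harm N.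
Proof.
move=> E0 e0 xE xe.
apply: le_trans (_ : \sum_(r < N) ((if (r < K)%N then E else 0) + e * r.+1%:R^-1) <= _).
  apply: ler_sum => r _; have i0 : 0 <= r.+1%:R^-1 :> R by rewrite invr_ge0.
  have i1 : r.+1%:R^-1 <= 1 :> R by rewrite invf_le1// ler1n.
  case: ltnP => h; last by rewrite add0r mulrC ler_wpM2r// xe.
  apply: le_trans (_ : r.+1%:R^-1 * E <= _); first by rewrite ler_wpM2l.
  by apply: le_trans (ler_wpM2r E0 i1) _; rewrite mul1r lerDl mulr_ge0.
rewrite big_split/= -mulr_sumr lerD2r -big_mkcond/=.
rewrite sumr_const -[E *+ _]mulr_natl; apply: ler_wpM2r => //; rewrite ler_nat.
have [KN|NK] := leqP K N.
  by rewrite -sum1_card -(big_ord_widen N (fun=> 1%N))// sum1_card card_ord.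
by apply: leq_trans (max_card _) _; rewrite card_ord ltnW.
Qed.

Lemma corr_conj a k : (corr a k)^*%C = corr a (- k).
Proof.
rewrite corr_shift -csum_conj; apply: eq_csum => n.
by rewrite conjcM conjcK opprK.
Qed.

Lemma corr_trunc_out r a k : k \notin box (2 * r) -> corr (trunc (box r) a) k = 0.
Proof.
move=> kb; rewrite /corr (csum_seq (s := [::]))//; first by rewrite big_nil.
move=> n _; rewrite /trunc; case: (boolP (n \in box r)) => nb; last by rewrite mul0r.
case: (boolP (n - k \in box r)) => mb; last by rewrite conjc0 mulr0.
exfalso; move/negP: kb; apply; move: nb mb; rewrite !mem_box.
by case: n k => [x y] [z w]; rewrite /sz /=; lia.
Qed.

Lemma cderive_trunc r v t d n : (forall n, cderive (fun s => v s n) t (d n)) ->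
  cderive (fun s => trunc (box r) (v s) n) t (trunc (box r) d n).
Proof.
move=> vd; rewrite /trunc; case: ifP => _; first exact: vd.
exact: cderive_cst.
Qed.

(** By the symmetries of the quartic form, its four entries contribute equally to
    the derivative. *)
Lemma derive_potential_trunc r v t d : (forall n, cderive (fun s => v s n) t (d n)) ->
  is_derive t (1 : R) (fun s => potential (trunc (box r) (v s)))
    (4 * complex.Re (\sum_(n <- box r) (d n)^*%C * cub (trunc (box r) (v t)) n)).
Proof.
move=> vd; pose b s := trunc (box r) (v s); pose e := trunc (box r) d.
have be n : cderive (fun s => b s n) t (e n) by exact: cderive_trunc.
have b0 s n : n \notin box r -> b s n = 0 by rewrite /b /trunc => /negPf ->.
have e0 n : n \notin box r -> e n = 0 by rewrite /e /trunc => /negPf ->.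
have bA s : exists A, inh1 (b s) A.
  eexists; apply: (sumle_seq (uniq_box r)) => [n|n /b0 ->]; first exact: sqr_ge0.
  by rewrite modulus0 mulr0 expr0n.
have corrE s k : corr (b s) k = \sum_(p <- box r) b s p * (b s (p - k))^*%C.
  by rewrite /corr (csum_seq (uniq_box r))// => p /b0 ->; rewrite mul0r.
pose P s := \sum_(k <- box (2 * r)) corr (b s) k * (corr (b s) k)^*%C.
have potE s : potential (b s) = complex.Re (P s).
  rewrite /potential (nsum_seq (uniq_box (2 * r))) => [||k kb]; first last.
  - by rewrite corr_trunc_out// modulus0 expr0n.
  - by move=> k; exact: sqr_ge0.
  rewrite /P; under [in RHS]eq_bigr do rewrite mulJc.
  by rewrite -realc_sum.
pose C1 k := \sum_(p <- box r) e p * (b t (p - k))^*%C.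
pose C2 k := \sum_(p <- box r) b t p * (e (p - k))^*%C.
have cd k : cderive (fun s => corr (b s) k) t (C1 k + C2 k).
  have -> : (fun s => corr (b s) k) = fun s => \sum_(p <- box r) b s p * (b s (p - k))^*%C.
    by apply/funext => s; exact: corrE.
  rewrite /C1 /C2 -big_split/=; apply: cderive_sum => p.
  by apply: cderiveM => //; exact: cderive_conj.
have Pd : cderive P t (\sum_(k <- box (2 * r)) ((C1 k + C2 k) * (corr (b t) k)^*%C +
    corr (b t) k * (C1 k + C2 k)^*%C)).
  by apply: cderive_sum => k; apply: cderiveM => //; exact: cderive_conj.
have [A btA] := bA t.
have cubE n : cub (b t) n = \sum_(k <- box (2 * r)) corr (b t) k * b t (n - k).
  have [-> _] := cub_corr n btA; rewrite (csum_seq (uniq_box (2 * r)))// => k kb.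
  by rewrite corr_trunc_out// mul0r.
pose S := \sum_(n <- box r) (e n)^*%C * cub (b t) n.
have S1 : \sum_(k <- box (2 * r)) C1 k * (corr (b t) k)^*%C = S^*%C.
  rewrite /S conjc_sum; under eq_bigr do rewrite /C1 mulr_suml.
  rewrite exchange_big; apply: eq_bigr => p _.
  rewrite conjcM conjcK cubE conjc_sum mulr_sumr; apply: eq_bigr => k _.
  by rewrite conjcM; ring.
have S2 : \sum_(k <- box (2 * r)) C2 k * (corr (b t) k)^*%C = S.
  have C2E k : C2 k = \sum_(n <- box r) (e n)^*%C * b t (n + k).
    transitivity (csum (fun p => b t p * (e (p - k))^*%C)).
      by rewrite (csum_seq (uniq_box r))// => p /b0 ->; rewrite mul0r.
    rewrite -(csum_bij _ (bij_shift k)) (csum_seq (uniq_box r)).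
      by apply: eq_bigr => n _ /=; rewrite addrK mulrC.
    by move=> n /e0 h /=; rewrite addrK h conjc0 mulr0.
  rewrite /S; under eq_bigr do rewrite C2E mulr_suml.
  rewrite exchange_big; apply: eq_bigr => n _.
  have [-> _] := cub_corr n btA.
  have bijN : bijective (fun k : lattice => - k) by exists (fun k => - k) => k; rewrite opprK.
  rewrite -(csum_bij _ bijN) (csum_seq (uniq_box (2 * r))).
    rewrite mulr_sumr; apply: eq_bigr => k _.
    by rewrite corr_conj /= opprK; ring.
  by move=> k kb /=; rewrite -corr_conj corr_trunc_out// conjc0 mul0r.
have [Pr _] := Pd.
have -> : (fun s => potential (trunc (box r) (v s))) = fun s => complex.Re (P s).
  by apply/funext => s; rewrite -potE.
have SE : \sum_(n <- box r) (d n)^*%C * cub (trunc (box r) (v t)) n = S.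
  rewrite /S big_seq [RHS]big_seq; apply: eq_bigr => n nb.
  by rewrite /e /trunc nb.
rewrite SE; apply: (@is_derive_eq _ _ _ _ _ _ _ _ Pr).
have -> : \sum_(k <- box (2 * r)) ((C1 k + C2 k) * (corr (b t) k)^*%C +
    corr (b t) k * (C1 k + C2 k)^*%C) = (S^*%C + S) + (S^*%C + S)^*%C.
  rewrite big_split/=; congr (_ + _).
    by rewrite -S1 -[in RHS]S2 -big_split/=; apply: eq_bigr => k _; rewrite mulrDl.
  rewrite -S1 -[in RHS]S2 -big_split conjc_sum; apply: eq_bigr => k _.
  transitivity (((C1 k + C2 k) * (corr (b t) k)^*%C)^*%C).
    by rewrite conjcM conjcK mulrC.
  by rewrite mulrDl.
by case: (S) => x y /=; ring.
Qed.

End TruncatedEnergy.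

Section Conservation.
Context {R : realType}.
Implicit Types (a b d : lattice -> R[i]) (n p q m k : lattice) (v : R -> lattice -> R[i]) (g : lattice -> R).

Lemma ReD (x y : R[i]) : complex.Re (x + y) = complex.Re x + complex.Re y.
Proof. by case: x y => ? ? []. Qed.

Lemma ImD (x y : R[i]) : complex.Im (x + y) = complex.Im x + complex.Im y.
Proof. by case: x y => ? ? []. Qed.

Lemma ImB (x y : R[i]) : complex.Im (x - y) = complex.Im x - complex.Im y.
Proof. by case: x y => ? ? []. Qed.

Lemma ImZ (x : R) (y : R[i]) : complex.Im (x%:C%C * y) = x * complex.Im y.
Proof. by case: y => u w /=; rewrite mul0r addr0. Qed.

Lemma Re_sum {T : Type} (s : seq T) (F : T -> R[i]) :
  complex.Re (\sum_(i <- s) F i) = \sum_(i <- s) complex.Re (F i).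
Proof. by elim: s => [|i s IH]; rewrite ?big_nil// !big_cons ReD IH. Qed.

Lemma Im_sum {T : Type} (s : seq T) (F : T -> R[i]) :
  complex.Im (\sum_(i <- s) F i) = \sum_(i <- s) complex.Im (F i).
Proof. by elim: s => [|i s IH]; rewrite ?big_nil// !big_cons ImD IH. Qed.

Variables (mu alpha beta gamma : R).

(** The combinations of the densities of energy, momentum and mass. *)
Let sym n := mu * freq2 n + alpha * n.1%:~R + beta * n.2%:~R + gamma.

Definition flux_linear g r a : R[i] := \sum_(n <- box r) (g n)%:C%C * ((a n)^*%C *
     (cub a n - cub (trunc (box r) a) n)).

Definition flux_quartic r a : R[i] := \sum_(n <- box r) (cub a n)^*%C * cub (trunc (box r) a) n.

Definition flux g r a : R := - complex.Im (flux_linear g r a) + mu * complex.Im (flux_quartic r a).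

(** The truncated nonlinearity conserves mass and momentum exactly. *)
Lemma affine_flux0 a A r : inh1 a A ->
  \sum_(n <- box r) (alpha * n.1%:~R + beta * n.2%:~R + gamma) *
    complex.Im ((a n)^*%C * cub (trunc (box r) a) n) = 0.
Proof.
move=> aA; pose b := trunc (box r) a; have bA : inh1 b A := inh1_trunc _ aA.
have b0 n : n \notin box r -> b n = 0 by rewrite /b /trunc => /negPf ->.
have sumE (l : lattice -> R) : \sum_(n <- box r) l n * complex.Im ((a n)^*%C * cub b n) =
    complex.Im (csum (fun n => (l n)%:C%C * ((b n)^*%C * cub b n))).
  rewrite (csum_seq (uniq_box r)) => [|n /b0 ->]; last by rewrite conjc0 mul0r mulr0.
  rewrite Im_sum big_seq [RHS]big_seq; apply: eq_bigr => n nb.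
  by rewrite ImZ /b /trunc nb.
have l1 : \sum_(n <- box r) n.1%:~R * complex.Im ((a n)^*%C * cub b n) = 0.
  rewrite (sumE (fun n => n.1%:~R)); apply: quartic_real bA _ l1_wt.
  by move=> m n; rewrite rmorphB.
have l2 : \sum_(n <- box r) n.2%:~R * complex.Im ((a n)^*%C * cub b n) = 0.
  rewrite (sumE (fun n => n.2%:~R)); apply: quartic_real bA _ l2_wt.
  by move=> m n; rewrite rmorphB.
have l3 : \sum_(n <- box r) 1 * complex.Im ((a n)^*%C * cub b n) = 0.
  rewrite (sumE (fun=> 1)); have [_ _ e] := quartic_potential bA.
  by under eq_csum do rewrite mul1r; rewrite e.
pose f n := complex.Im ((a n)^*%C * cub b n).
transitivity (alpha * (\sum_(n <- box r) n.1%:~R * f n) + beta * (\sum_(n <- box r) n.2%:~R * f n) +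
  gamma * (\sum_(n <- box r) 1 * f n)); last by rewrite l1 l2 l3; ring.
rewrite !mulr_sumr -!big_split/=; apply: eq_bigr => n _.
by rewrite -/b -/(f n); ring.
Qed.

(** The truncated energy varies only through the interaction of modes inside the
    box with modes outside. *)
Lemma energy_trunc_derive v t r : nls v ->
  is_derive t (1 : R) (fun s => energy_trunc sym mu r (v s)) (flux sym r (v t)).
Proof.
move=> [vA _ vd]; pose d n := 'i%C * (cub (v t) n + (freq2 n)%:C%C * v t n).
have [A aA] := vA t.
have dpot := derive_potential_trunc r (fun n => vd t n : cderive _ _ (d n)).
have [dm _] : cderive (fun s => \sum_(n <- box r) (sym n)%:C%C * (v s n * (v s n)^*%C)) t
    (\sum_(n <- box r) (0 * (v t n * (v t n)^*%C) + (sym n)%:C%C * (d n * (v t n)^*%C + v t n * (d n)^*%C))).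
  apply: cderive_sum => n; apply: cderiveM; first exact: cderive_cst.
  by apply: cderiveM; [exact: vd|apply: cderive_conj; exact: vd].
have mE : (fun s => complex.Re (\sum_(n <- box r) (sym n)%:C%C * (v s n * (v s n)^*%C))) =
    fun s => \sum_(n <- box r) sym n * modulus (v s n) ^+ 2.
  apply/funext => s; rewrite Re_sum; apply: eq_bigr => n _.
  by rewrite mulJc -realcM.
rewrite mE in dm.
have -> : (fun s => energy_trunc sym mu r (v s)) = fun s =>
    2^-1 * (\sum_(n <- box r) sym n * modulus (v s n) ^+ 2) + mu / 4 * potential (trunc (box r) (v s)) by [].
have h1 := is_deriveZ 2^-1 dm.
have h2 := is_deriveZ (mu / 4) dpot.
have h3 := is_deriveD h1 h2.
apply: (@is_derive_eq _ _ _ _ _ _ _ _ h3).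
rewrite /GRing.scale /= /flux /flux_linear /flux_quartic.
set T := cub (trunc (box r) (v t)); set F := cub (v t).
have e1 : complex.Re (\sum_(n <- box r) (0 * (v t n * (v t n)^*%C) + (sym n)%:C%C * (d n * (v t n)^*%C + v t n * (d n)^*%C))) =
    2 * \sum_(n <- box r) - (sym n * complex.Im ((v t n)^*%C * F n)).
  rewrite Re_sum mulr_sumr; apply: eq_bigr => n _; rewrite /d -/F.
  by case: (v t n) (F n) => [x y] [z w] /=; ring.
have e2 : complex.Re (\sum_(n <- box r) (d n)^*%C * T n) =
   \sum_(n <- box r) (complex.Im ((F n)^*%C * T n) + freq2 n * complex.Im ((v t n)^*%C * T n)).
  rewrite Re_sum; apply: eq_bigr => n _; rewrite /d -/F.
  by case: (v t n) (F n) (T n) => [x y] [z w] [x' y'] /=; ring.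
rewrite e1 e2 mulrA mulVf// mul1r.
have -> : mu / 4 * (4 * \sum_(n <- box r) (complex.Im ((F n)^*%C * T n) + freq2 n * complex.Im ((v t n)^*%C * T n))) =
  \sum_(n <- box r) mu * (complex.Im ((F n)^*%C * T n) + freq2 n * complex.Im ((v t n)^*%C * T n)).
  by rewrite mulrA divfK// mulr_sumr.
have := affine_flux0 r aA; rewrite -/T => aff.
rewrite !Im_sum mulr_sumr -sumrN -!big_split/= -[LHS]addr0 -[X in _ + X = _]aff -big_split/=.
apply: eq_bigr => n _; rewrite ImZ /sym.
have -> : (v t n)^*%C * (F n - T n) = (v t n)^*%C * F n - (v t n)^*%C * T n by ring.
rewrite ImB; ring.
Qed.

Lemma flux_quartic_le a A D r : inh1 a A -> inh1 (fun n => a n - trunc (box r) a n) D ->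
  `|complex.Im (flux_quartic r a)| <= Num.sqrt (kappa * (A * A * A)) * Num.sqrt (9 * kappa * A ^+ 2 * D).
Proof.
move=> aA aD; pose b := trunc (box r) a.
have -> : complex.Im (flux_quartic r a) = complex.Im (\sum_(n <- box r) (cub a n)^*%C * (cub b n - cub a n)).
  rewrite /flux_quartic !Im_sum; apply: eq_bigr => n _; rewrite -/b.
  have -> : (cub a n)^*%C * (cub b n - cub a n) = (cub a n)^*%C * cub b n - cub a n * (cub a n)^*%C by ring.
  by rewrite ImB mulJc /= subr0.
apply: le_trans (Im_le_modulus _) _.
have bD : inh1 (fun n => b n - a n) D by apply: sumle_le aD => n; rewrite -modulusN opprB.
have h := inl2_mul (inl2_conj (cub_l2 aA)) (cub_diff (inh1_trunc (box r) aA : inh1 b A) aA bD).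
by apply: le_trans (modulus_sum _ _) _; apply: h; exact: uniq_box.
Qed.

Variable C : R.
Hypothesis symC : forall n, 0 <= sym n <= C * wt n ^+ 2.

Let C0 : 0 <= C.
Proof.
have := symC 0; move=> /andP[h1 h2]; have := le_trans h1 h2.
by rewrite pmulr_lge0// exprn_gt0// wt_gt0.
Qed.

Let symN n : `|sym n| <= C * wt n ^+ 2.
Proof. by have /andP[h1 h2] := symC n; rewrite ger0_norm. Qed.

(** The linear part of the flux is bounded by [energy_flux].  In the quartic part
    no derivative is lost, and it is small at all radii beyond [K]. *)
Lemma flux_average A : 0 <= A -> exists P Q, [/\ 0 <= P, 0 <= Q &
  forall a tau K N, inh1 a A -> 0 <= tau -> inh1 (fun n => a n - trunc (box K) a n) tau ->
  \sum_(r < N) r.+1%:R^-1 * `|flux sym r a| <= P * K.+1%:R + Q * Num.sqrt tau * (harm N + 1)].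
Proof.
move=> A0; have k0 := kappa_ge0 (R := R).
pose c1 := Num.sqrt A * Num.sqrt (kappa * (A * A * A)) : R.
pose c2 := Num.sqrt (kappa * (A * A * A)) * Num.sqrt (9 * kappa * A ^+ 2) : R.
have c10 : 0 <= c1 by rewrite mulr_ge0 ?sqrtr_ge0.
have c20 : 0 <= c2 by rewrite mulr_ge0 ?sqrtr_ge0.
have sA : 0 <= Num.sqrt A by exact: sqrtr_ge0.
exists (C * c1 + `|mu| * (c2 * Num.sqrt A)), (C * (3 * Num.sqrt A * (8 * A)) + `|mu| * c2); split.
- by rewrite addr_ge0 ?mulr_ge0.
- by rewrite addr_ge0 ?mulr_ge0.
move=> a tau K N aA t0 aK; set st := Num.sqrt tau; set H := harm N.
have st0 : 0 <= st by exact: sqrtr_ge0.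
have H0 : 0 <= H by exact: harm_ge0.
have h1 := energy_flux N aA aK symN C0.
have q1 r D : inh1 (fun n => a n - trunc (box r) a n) D -> `|complex.Im (flux_quartic r a)| <= c2 * Num.sqrt D.
  move=> aD; have := flux_quartic_le aA aD.
  rewrite (@sqrtrM _ (9 * kappa * A ^+ 2) D) ?mulr_ge0 ?sqr_ge0//.
  by rewrite mulrA.
have h2 := @weighted_sum_le R (fun r => `|complex.Im (flux_quartic r a)|) (c2 * Num.sqrt A) (c2 * st) K N.
have {}h2 : \sum_(r < N) r.+1%:R^-1 * `|complex.Im (flux_quartic r a)| <= K%:R * (c2 * Num.sqrt A) + c2 * st * H.
  apply: h2; rewrite ?mulr_ge0// => r; first by apply: q1; exact: tail_inh1.
  by move=> Kr; apply: q1; apply: tail_subset aK; exact: box_sub.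
apply: le_trans (_ : \sum_(r < N) (r.+1%:R^-1 * modulus (flux_linear sym r a) +
    `|mu| * (r.+1%:R^-1 * `|complex.Im (flux_quartic r a)|)) <= _).
  apply: ler_sum => r _; rewrite mulrCA -mulrDr ler_wpM2l ?invr_ge0//.
  rewrite /flux; apply: le_trans (ler_normD _ _) _; rewrite normrN normrM lerD2r.
  exact: Im_le_modulus.
rewrite big_split/= -mulr_sumr.
apply: le_trans (lerD h1 (ler_wpM2l (normr_ge0 mu) h2)) _.
rewrite -/c1 -/st -/H -natr1.
set x := C * c1; set y := `|mu| * (c2 * Num.sqrt A); set z := `|mu| * c2.
have x0 : 0 <= x by rewrite mulr_ge0.
have y0 : 0 <= y by rewrite !mulr_ge0.
have zs : 0 <= z * st by rewrite !mulr_ge0.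
have -> : C * ((K%:R + 1) * c1 + 3 * (Num.sqrt A * st * (8 * (H + 1) * A))) =
  x * (K%:R + 1) + C * (3 * Num.sqrt A * (8 * A)) * st * (H + 1) by rewrite /x; ring.
have -> : `|mu| * (K%:R * (c2 * Num.sqrt A) + c2 * st * H) = y * K%:R + z * st * H by rewrite /y /z; ring.
lra.
Qed.

(** Near a time [t0] the tails of [v t] are uniformly small, so by [flux_average]
    the weighted sums of the truncated energies change by a small multiple of
    [harm N] times the elapsed time.  Dividing by [harm N] shows that the energy
    has derivative zero at [t0]. *)
Lemma conservation v : nls v -> forall t0 t1, energy sym mu (v t0) = energy sym mu (v t1).
Proof.
move=> vn; have [vA vc _] := vn.
have tri (x y s s' : R) : `|x - y| <= `|s - s'| + `|s - x| + `|s' - y|.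
  have -> : x - y = (s - s') - (s - x) + (s' - y) by ring.
  by apply: le_trans (ler_normD _ _) _; rewrite lerD2r; exact: ler_normB.
have fin (a1 a2 a3 b1 b2 e h : R) : a1 <= a3 ->
  (a1 + a2) + (b1 + e / 2 * h) + (b2 + e / 2 * h) <= (a3 + e * h) + (a2 + (b1 + b2)) by lra.
pose E t := energy sym mu (v t).
have k0 := kappa_ge0 (R := R).
have close t eta : 0 < eta -> exists K B, [/\ 0 <= B, forall r, `|energy_trunc sym mu r (v t) - E t| <= B &
    forall r, (K <= r)%N -> `|energy_trunc sym mu r (v t) - E t| <= eta].
  move=> eta0; have [A aA] := vA t; have A0 := sumle_ge0 aA.
  pose f D := C * D + `|mu| * (Num.sqrt D * Num.sqrt (kappa * (A * A * A))
    + Num.sqrt A * Num.sqrt (9 * kappa * A ^+ 2 * D)).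
  pose M := C + `|mu| * (Num.sqrt (kappa * (A * A * A)) + Num.sqrt A * Num.sqrt (9 * kappa * A ^+ 2)).
  have M0 : 0 <= M by rewrite addr_ge0// mulr_ge0// addr_ge0 ?mulr_ge0 ?sqrtr_ge0.
  have fM D : 0 <= D <= 1 -> f D <= M * Num.sqrt D.
    move=> /andP[D0 D1]; have s0 : 0 <= Num.sqrt D by exact: sqrtr_ge0.
    have s1 : Num.sqrt D <= 1 by rewrite -sqrtr1 ler_wsqrtr.
    have Ds : D <= Num.sqrt D by rewrite -{1}(sqr_sqrtr D0) expr2 ler_piMr.
    rewrite /f (@sqrtrM _ (9 * kappa * A ^+ 2) D) ?mulr_ge0 ?sqr_ge0//.
    have -> : M * Num.sqrt D = C * Num.sqrt D + `|mu| * (Num.sqrt D * Num.sqrt (kappa * (A * A * A)) +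
        Num.sqrt A * (Num.sqrt (9 * kappa * A ^+ 2) * Num.sqrt D)) by rewrite /M; ring.
    by rewrite lerD2r ler_wpM2l.
  pose D := Num.min 1 ((eta / (M + 1)) ^+ 2).
  have eM : 0 < eta / (M + 1) by rewrite divr_gt0//; lra.
  have D0 : 0 < D by rewrite lt_min ltr01 exprn_gt0.
  have D1 : D <= 1 by rewrite ge_min lexx.
  have Deta : M * Num.sqrt D <= eta.
    have h : D <= (eta / (M + 1)) ^+ 2 by rewrite ge_min lexx orbT.
    have : Num.sqrt D <= eta / (M + 1).
      by apply: le_trans (ler_wsqrtr h) _; rewrite sqrtr_sqr ger0_norm// ltW.
    rewrite ler_pdivlMr; last lra.
    by move=> h1; apply: le_trans _ h1; rewrite mulrC ler_wpM2l ?sqrtr_ge0// lerDl.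
  have [K aK] := tail_box aA D0; exists K, (f A); split.
  - by rewrite addr_ge0 ?mulr_ge0// addr_ge0 ?mulr_ge0 ?sqrtr_ge0.
  - by move=> r; exact: (energy_trunc_close mu symC C0 aA (tail_inh1 (box r) aA)).
  - move=> r Kr; apply: le_trans (energy_trunc_close mu symC C0 aA (tail_subset (box_sub Kr) aK)) _.
    by apply: le_trans (fM D _) Deta; rewrite (ltW D0) D1.
have local t0 eta : 0 < eta -> exists2 delta, 0 < delta & forall t, `|t - t0| < delta ->
    `|E t - E t0| <= eta * `|t - t0|.
  move=> eta0; have [A0 aA0] := vA t0; have A0p := sumle_ge0 aA0.
  pose A := 2 + 2 * A0; have Ap : 0 <= A by rewrite /A; lra.
  have [P [Q [P0 Q0 PQ]]] := flux_average Ap.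
  pose tau := Num.min 1 ((eta / (2 * (Q + 1))) ^+ 2).
  have eQ : 0 < eta / (2 * (Q + 1)) by rewrite divr_gt0// mulr_gt0//; lra.
  have tau0 : 0 < tau by rewrite lt_min ltr01 exprn_gt0.
  have tau1 : tau <= 1 by rewrite ge_min lexx.
  have Qt : Q * Num.sqrt (4 * tau) <= eta.
    have h : tau <= (eta / (2 * (Q + 1))) ^+ 2 by rewrite ge_min lexx orbT.
    have -> : Num.sqrt (4 * tau) = 2 * Num.sqrt tau.
      have -> : 4 * tau = (2 : R) ^+ 2 * tau by ring.
      by rewrite sqrtrM ?sqr_ge0// sqrtr_sqr ger0_norm.
    have : Num.sqrt tau <= eta / (2 * (Q + 1)).
      by apply: le_trans (ler_wsqrtr h) _; rewrite sqrtr_sqr ger0_norm// ltW.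
    rewrite ler_pdivlMr; last by rewrite mulr_gt0//; lra.
    move=> h1; apply: le_trans _ h1.
    have -> : Num.sqrt tau * (2 * (Q + 1)) = Q * (2 * Num.sqrt tau) + 2 * Num.sqrt tau by ring.
    by rewrite lerDl mulr_ge0 ?sqrtr_ge0.
  have [K aK] := tail_box aA0 tau0.
  have /nbhs_ballP[delta /= d0 hd] := vc t0 tau tau0.
  exists delta => // t tt0.
  have near s : `|s - t0| <= `|t - t0| -> inh1 (v s) A /\ inh1 (fun n => v s n - trunc (box K) (v s) n) (4 * tau).
    move=> st; have hs : inh1 (fun n => v s n - v t0 n) tau.
      by apply: hd; rewrite /ball/= distrC; exact: le_lt_trans st tt0.
    split; first by have := inh1_addr hs aA0; apply: sumle_weak; rewrite /A; lra.
    have := inh1D (tail_inh1 (box K) hs) aK.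
    have -> : 2 * tau + 2 * tau = 4 * tau by ring.
    apply: sumle_le => n; rewrite le_eqVlt; apply/orP; left; apply/eqP.
    by congr ((_ * modulus _) ^+ 2); rewrite /trunc; case: ifP => _; ring.
  apply/ler_addgt0Pr => e2 e20.
  have e4 : 0 < e2 / 2 by lra.
  have [K1 [B1 [B10 c1 c1']]] := close t _ e4.
  have [K2 [B2 [B20 c2 c2']]] := close t0 _ e4.
  pose S s N := \sum_(r < N) r.+1%:R^-1 * energy_trunc sym mu r (v s).
  have key N : harm N * `|E t - E t0| <= harm N * (eta * `|t - t0| + e2) +
      ((P * K.+1%:R + Q * Num.sqrt (4 * tau)) * `|t - t0| + (K1%:R * B1 + K2%:R * B2)).
    have Sd z : is_derive z (1 : R) (fun s => S s N) (\sum_(r < N) r.+1%:R^-1 * flux sym r (v z)).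
      rewrite /S; have -> : (fun s => \sum_(r < N) r.+1%:R^-1 * energy_trunc sym mu r (v s)) =
          \sum_(r < N) (fun s => r.+1%:R^-1 * energy_trunc sym mu r (v s)).
        by apply/funext => s; rewrite fct_sumE.
      apply: is_derive_sum => r; exact: is_deriveZ (energy_trunc_derive z r vn).
    have mv : `|S t N - S t0 N| <= (P * K.+1%:R + Q * Num.sqrt (4 * tau) * (harm N + 1)) * `|t - t0|.
      apply: mvt_bound Sd _ => z zt; have [zA zK] := near z zt.
      apply: le_trans (ler_norm_sum _ _ _) _.
      apply: le_trans (PQ (v z) (4 * tau) K N zA _ zK); last by rewrite mulr_ge0// ltW.
      by apply: ler_sum => r _; rewrite normrM ger0_norm// invr_ge0.
    have Sclose s K' B' : 0 <= B' -> (forall r, `|energy_trunc sym mu r (v s) - E s| <= B') ->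
        (forall r, (K' <= r)%N -> `|energy_trunc sym mu r (v s) - E s| <= e2 / 2) ->
        `|S s N - harm N * E s| <= K'%:R * B' + e2 / 2 * harm N.
      move=> B'0 h1 h2; rewrite /S /harm mulr_suml -sumrB.
      apply: le_trans (ler_norm_sum _ _ _) _.
      apply: le_trans (weighted_sum_le N B'0 (ltW e4) h1 h2).
      by apply: ler_sum => r _; rewrite -mulrBr normrM ger0_norm// invr_ge0.
    have s1 := Sclose t K1 B1 B10 c1 c1'.
    have s2 := Sclose t0 K2 B2 B20 c2 c2'.
    have H0 : 0 <= harm N :> R by exact: harm_ge0.
    have -> : harm N * `|E t - E t0| = `|harm N * E t - harm N * E t0|.
      by rewrite -mulrBr normrM (ger0_norm H0).
    have QH : Q * Num.sqrt (4 * tau) * `|t - t0| * harm N <= eta * `|t - t0| * harm N.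
      by rewrite ler_wpM2r// ler_wpM2r.
    have m1 : (P * K.+1%:R + Q * Num.sqrt (4 * tau) * (harm N + 1)) * `|t - t0| =
      Q * Num.sqrt (4 * tau) * `|t - t0| * harm N + (P * K.+1%:R + Q * Num.sqrt (4 * tau)) * `|t - t0| by ring.
    rewrite m1 in mv.
    have m2 : harm N * (eta * `|t - t0| + e2) = eta * `|t - t0| * harm N + e2 * harm N by ring.
    rewrite m2; apply: le_trans (tri _ _ (S t N) (S t0 N)) _.
    by apply: le_trans (lerD (lerD mv s1) s2) _; exact: fin QH.
  exact: harm_limit key.
have Ed t : is_derive t (1 : R) E 0.
  have lim : (fun h => h^-1 *: (E (h *: (1 : R) + t) - E t)) @ (0 : R)^' --> (0 : R).
    apply/cvgrPdist_le => eta eta0; have [delta d0 hd] := local t eta eta0.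
    near=> h; have h0 : h != 0 by near: h; exact: nbhs_dnbhs_neq.
    have hdl : `|h| < delta.
      near: h; apply: nbhs_dnbhs; exists delta => //= y /=; by rewrite sub0r normrN.
    rewrite sub0r normrN /GRing.scale /= mulr1 normrM normfV mulrC ler_pdivrMr ?normr_gt0//.
    have := hd (h + t); rewrite addrK; exact.
  have dE : derivable E t 1 by apply/cvg_ex; exists 0.
  by apply: DeriveDef => //; exact: cvg_lim lim.
by move=> t0 t1; exact: (@is_derive_0_is_cst R E t0 t1 Ed).
Unshelve. all: by end_near.
Qed.

End Conservation.

(** * Classification *)

Section SingleModeSolutions.
Context {R : realType}.
Implicit Types (a b : lattice -> R[i]) (n p q m k : lattice) (v : R -> lattice -> R[i]).

Lemma freq2_pos n : n != 0 -> 1 <= freq2 n :> R.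
Proof.
move=> n0; rewrite /freq2 -[1]/(1%:~R) ler_int.
case: n n0 => x y /= n0; have : x != 0 \/ y != 0.
  by apply/orP; apply: contraNT n0; rewrite negb_or !negbK => /andP[/eqP -> /eqP ->].
rewrite !expr2; case=> h; nia.
Qed.

Lemma freq2_shift n n0 : freq2 (n - n0) = 1 * freq2 n + (- 2 * n0.1%:~R) * n.1%:~R
  + (- 2 * n0.2%:~R) * n.2%:~R + freq2 n0 :> R.
Proof.
case: n n0 => [x y] [z w]; rewrite /freq2 /=.
rewrite !rmorphD !rmorphXn/= !rmorphD !rmorphN/=; ring.
Qed.

Lemma freq2_shift_le n n0 : freq2 (n - n0) <= 2 * wt (- n0) ^+ 2 * wt n ^+ 2 :> R.
Proof.
apply: le_trans (freq2_wt _) _; rewrite -mulrA ler_wpM2l// -exprMn.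
rewrite ler_sqr ?nnegrE ?mulr_ge0 ?wt_ge0//.
by have := @wt_sub R (n - n0) (- n0); rewrite opprK subrK.
Qed.

Lemma corr_single n0 b k : (forall n, n != n0 -> b n = 0) -> k != 0 -> corr b k = 0.
Proof.
move=> b0 k0; rewrite /corr (csum_seq (s := [::]))//; first by rewrite big_nil.
move=> n _; have [->|nn] := eqVneq n n0; last by rewrite b0// mul0r.
rewrite (b0 (n0 - k)) ?conjc0 ?mulr0//.
by apply: contra_neq k0 => h; rewrite -[k](subKr n0) h subrr.
Qed.

Lemma mass_single n0 b : (forall n, n != n0 -> b n = 0) -> mass b = modulus (b n0) ^+ 2.
Proof.
move=> b0; rewrite /mass (nsum_seq (s := [:: n0]))//; first by rewrite big_seq1.
  by move=> n; exact: sqr_ge0.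
by move=> n; rewrite inE => /b0 ->; rewrite modulus0 expr0n.
Qed.

Lemma potential_single n0 b A : inh1 b A -> (forall n, n != n0 -> b n = 0) ->
  potential b = modulus (b n0) ^+ 4.
Proof.
move=> bA b0; rewrite /potential (nsum_seq (s := [:: 0]))//.
- by rewrite big_seq1 (corr0 bA) (mass_single b0) modulusC ger0_norm ?sqr_ge0// -exprM.
- by move=> k; exact: sqr_ge0.
- by move=> k; rewrite inE => k0; rewrite (corr_single b0 k0) modulus0 expr0n.
Qed.

Lemma cub_single n0 b : (forall n, n != n0 -> b n = 0) ->
  cub b n0 = (modulus (b n0) ^+ 2)%:C%C * b n0.
Proof.
move=> b0; rewrite /cub /tri (csum_seq (s := [:: (n0, n0)]))//.
  by rewrite big_seq1 /= subrr add0r mulJc.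
move=> [p q]; rewrite inE xpair_eqE negb_and => /orP[] h /=.
  by rewrite (b0 p h) !mul0r.
by rewrite (b0 q h) conjc0 mulr0 mul0r.
Qed.

Lemma mass_conserved v t0 t1 : nls v -> mass (v t0) = mass (v t1).
Proof.
move=> vn; have h : forall n, 0 <= (0 * freq2 n + 0 * n.1%:~R + 0 * n.2%:~R + 1 : R) <= 1 * wt n ^+ 2.
  by move=> n; rewrite !mul0r !add0r ler01 mul1r expr_ge1 ?wt_ge1 ?wt_ge0.
have := conservation h vn t0 t1; rewrite /energy !mul0r !addr0.
have E t : nsum (fun n => (0 * freq2 n + 0 * n.1%:~R + 0 * n.2%:~R + 1) * modulus (v t n) ^+ 2) = mass (v t).
  by apply: eq_nsum => n; rewrite !mul0r !add0r mul1r.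
by rewrite !E => /(mulfI _) -> //; rewrite invr_eq0 pnatr_eq0.
Qed.

(** After a Galilean shift to the frequency [n0], the energy
    [1/2 \sum |n - n0|^2 |v n|^2 + 1/4 potential v] is at least
    [1/4 (mass v)^2], with equality only for the mode [n0].  A solution
    asymptotic to that mode attains the minimum. *)
Lemma asymptotic_rigidity v a A n0 : nls v -> inh1 a A ->
  asymptotic v (fun t => free_propagator t a) -> (forall n, n != n0 -> a n = 0) ->
  forall t n, n != n0 -> v t n = 0.
Proof.
move=> vn aA va an0 t; have [vA _ _] := vn; have A0 := sumle_ge0 aA.
pose g n := 1 * freq2 n + (- 2 * n0.1%:~R) * n.1%:~R + (- 2 * n0.2%:~R) * n.2%:~R + freq2 n0 : R.
have gE n : g n = freq2 (n - n0) by rewrite freq2_shift.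
pose C := 2 * wt (- n0) ^+ 2 : R.
have C0 : 0 <= C by rewrite mulr_ge0// sqr_ge0.
have gC n : 0 <= g n <= C * wt n ^+ 2 by rewrite gE freq2_ge0 freq2_shift_le.
have cons := conservation gC vn.
pose M := mass (v t).
have M0 : 0 <= M by apply: nsum_ge0 => n; exact: sqr_ge0.
pose E := energy g 1 (v t).
pose al := modulus (a n0).
have al0 : 0 <= al by exact: modulus_ge0.
pose B := 2 + 2 * A; pose k0 := kappa_ge0 (R := R).
have B0 : 0 <= B by rewrite /B; lra.
pose c := Num.sqrt (kappa * (B * B * B)) + Num.sqrt B * Num.sqrt (9 * kappa * B ^+ 2).
have c0 : 0 <= c by rewrite addr_ge0 ?mulr_ge0 ?sqrtr_ge0.
(* [v T] for a late time [T] is compared with the asymptotic mode [z] *)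
have est D : 0 < D <= 1 -> al <= Num.sqrt M + Num.sqrt D /\ E <= C * D + 4^-1 * (al ^+ 4 + c * Num.sqrt D).
  move=> /andP[D0 D1]; have [T /(_ T (lexx T)) [y hy]] := va D D0.
  pose z n := cis y * free_propagator T a n.
  have zA : inh1 z A by apply: (inh1_cis (fun=> y)); exact: (inh1_cis (fun n => T * freq2 n)).
  have zB : inh1 z B by apply: sumle_weak zA; rewrite /B; lra.
  have vB : inh1 (v T) B by have := inh1_addr hy zA; apply: sumle_weak; rewrite /B; lra.
  have z0 n : n != n0 -> z n = 0 by move=> h; rewrite /z /free_propagator an0// !mulr0.
  have zn0 : modulus (z n0) = al by rewrite /z /free_propagator !modulusM !modulus_cis !mul1r.
  split.
    have h1 : modulus (v T n0) <= Num.sqrt M.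
      apply: modulus_le_sqrt.
      by rewrite /M (mass_conserved t T vn); exact: mass_term vB.
    have h2 : modulus (v T n0 - z n0) <= Num.sqrt D.
      apply: modulus_le_sqrt.
      exact: sumle_term (inh1_l2 hy).
    rewrite -zn0 -[z n0](subKr (v T n0)); apply: le_trans (modulusB _ _) _.
    exact: lerD.
  rewrite /E (cons t T) /energy.
  have h1 : nsum (fun n => g n * modulus (v T n) ^+ 2) <= C * D.
    apply: nsum_le => [n|]; first by have /andP[h _] := gC n; rewrite mulr_ge0 ?sqr_ge0.
    apply: sumle_le (sumleZ C0 hy) => n.
    have [->|nn] := eqVneq n n0.
      by rewrite gE subrr /freq2 /= expr0n mul0r mulr_ge0 ?sqr_ge0.
    rewrite -/(z n) z0// subr0 exprMn [leRHS]mulrA ler_wpM2r ?sqr_ge0//.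
    by have /andP[] := gC n.
  have h2 : potential (v T) <= al ^+ 4 + c * Num.sqrt D.
    have := potential_diff vB zB hy; rewrite (potential_single zA z0) zn0.
    rewrite (@sqrtrM _ (9 * kappa * B ^+ 2) D) ?mulr_ge0 ?sqr_ge0// => h.
    rewrite -lerBlDl; apply: le_trans (ler_norm _) _; apply: le_trans h _.
    by rewrite le_eqVlt; apply/orP; left; apply/eqP; rewrite /c; ring.
  have n1 : 0 <= nsum (fun n => g n * modulus (v T n) ^+ 2).
    by apply: nsum_ge0 => n; have /andP[h _] := gC n; rewrite mulr_ge0 ?sqr_ge0.
  lra.
have small (e : R) : 0 < e -> exists2 D : R, 0 < D <= 1 & Num.sqrt D = Num.min 1 e.
  move=> e0; exists (Num.min 1 e ^+ 2).
    have m0 : 0 < Num.min 1 e by rewrite lt_min ltr01.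
    have m1 : Num.min 1 e <= 1 by rewrite ge_min lexx.
    by rewrite exprn_gt0//= exprn_ile1// ltW.
  by rewrite sqrtr_sqr ger0_norm// le_min ler01 ltW.
have alM : al <= Num.sqrt M.
  apply/ler_addgt0Pr => e e0; have [D D01 De] := small e e0.
  have [h _] := est D D01; apply: le_trans h _; rewrite lerD2l De ge_min lexx orbT//.
have EM : E <= 4^-1 * al ^+ 4.
  apply/ler_addgt0Pr => e e0.
  have e1 : 0 < e / (C + c + 1) by rewrite divr_gt0//; lra.
  have [D /andP[D0 D1] De] := small _ e1; have [_ h] := est D (introT andP (conj D0 D1)).
  apply: le_trans h _.
  have s0 : 0 <= Num.sqrt D by exact: sqrtr_ge0.
  have s1 : Num.sqrt D <= 1 by rewrite De ge_min lexx.
  have DD : D <= Num.sqrt D by rewrite -{1}(sqr_sqrtr (ltW D0)) expr2 ler_piMr.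
  have hs : Num.sqrt D <= e / (C + c + 1) by rewrite De ge_min lexx orbT.
  move: hs; rewrite ler_pdivlMr; last lra.
  have t1 : C * D <= C * Num.sqrt D by rewrite ler_wpM2l.
  have t2 : 0 <= c * Num.sqrt D by rewrite mulr_ge0.
  have -> : Num.sqrt D * (C + c + 1) = C * Num.sqrt D + c * Num.sqrt D + Num.sqrt D by ring.
  lra.
have al4 : al ^+ 4 <= M ^+ 2.
  have -> : al ^+ 4 = (al ^+ 2) ^+ 2 by rewrite -exprM.
  rewrite ler_sqr ?nnegrE ?sqr_ge0// -(sqr_sqrtr M0) ler_sqr ?nnegrE ?sqrtr_ge0//.
have [Av vAv] := vA t.
have potM := sqr_mass_le_potential vAv; rewrite -/M in potM.
have g0 n : 0 <= g n * modulus (v t n) ^+ 2 by have /andP[h _] := gC n; rewrite mulr_ge0 ?sqr_ge0.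
have kin : nsum (fun n => g n * modulus (v t n) ^+ 2) <= 0.
  by move: EM; rewrite /E /energy; lra.
move=> n nn; apply: modulus_eq0; apply/eqP.
have := sumle_term n (sumle_nsum g0 (sumle_symbol gC C0 vAv)) => h.
have {}h : g n * modulus (v t n) ^+ 2 <= 0 by exact: le_trans h kin.
have g1 : 1 <= g n by rewrite gE freq2_pos// subr_eq0.
have : modulus (v t n) ^+ 2 <= 0.
  apply: le_trans h; rewrite ler_peMl ?sqr_ge0//.
by rewrite le_eqVlt ltNge sqr_ge0 orbF sqrf_eq0.
Qed.

Lemma polar (z : R[i]) : exists y, z = (modulus z)%:C%C * cis y.
Proof.
have [z0|z0] := eqVneq (modulus z) 0.
  by exists 0; rewrite z0 mul0r; exact: modulus_eq0.
pose x := complex.Re z / modulus z; pose w := complex.Im z / modulus z.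
have xw : x ^+ 2 + w ^+ 2 = 1.
  by rewrite /x /w !exprMn -mulrDl -sqr_modulus exprVn divff// sqrf_eq0.
have x1 : -1 <= x <= 1.
  by rewrite -ler_norml -(@ler_pXn2r _ 2) ?nnegrE// expr1n real_normK ?num_real// -xw lerDl sqr_ge0.
have zE : z = (modulus z)%:C%C * Complex x w.
  rewrite /x /w; case: (z) (z0) => p q /= h; simpc.
  by congr Complex; rewrite mulrCA mulfV ?mulr1.
have w2 : 1 - x ^+ 2 = w ^+ 2 by rewrite -xw; ring.
have [w0|w0] := leP 0 w.
  exists (acos x); rewrite {1}zE /cis acosK// sin_acos// w2 sqrtr_sqr ger0_norm//.
exists (- acos x); rewrite {1}zE /cis cosN sinN acosK// sin_acos// w2 sqrtr_sqr ltr0_norm//.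
by rewrite opprK.
Qed.

(** A single mode has constant modulus, so its equation is linear. *)
Lemma single_mode_solution v n0 t : nls v -> (forall t n, n != n0 -> v t n = 0) ->
  v t n0 = v 0 n0 * cis (t * (modulus (v 0 n0) ^+ 2 + freq2 n0)).
Proof.
move=> vn v0; have [_ _ vd] := vn; set om := _ + freq2 n0.
have mo s : modulus (v s n0) ^+ 2 = modulus (v 0 n0) ^+ 2.
  by rewrite -!(mass_single (v0 _)); exact: mass_conserved.
pose f s := v s n0 * cis (s * (- om)).
have fd s : cderive f s 0.
  apply: (cderive_eq _ (cderiveM (vd s n0) (cderive_cis (- om) s))).
  rewrite (cub_single (v0 s)) mo /om.
  have -> : (- (modulus (v 0 n0) ^+ 2 + freq2 n0))%:C%C =
    - ((modulus (v 0 n0) ^+ 2)%:C%C + (freq2 n0)%:C%C) :> R[i] by rewrite -realcD; exact: rmorphN.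
  by ring.
have fc : f t = f 0.
  have r := @is_derive_0_is_cst R (fun s => complex.Re (f s)) t 0 (fun s => (fd s).1).
  have i := @is_derive_0_is_cst R (fun s => complex.Im (f s)) t 0 (fun s => (fd s).2).
  by move: r i; case: (f t) (f 0) => ? ? [? ?] /= -> ->.
have : f t * cis (t * om) = v t n0.
  by rewrite /f -mulrA -cisD mulrN addNr cis0 mulr1.
by move=> <-; rewrite fc /f mul0r cis0 mulr1.
Qed.

End SingleModeSolutions.

Section Bridge.
Context {R : realType}.
Variable u : R -> R * R -> R[i].
Notation mu := (@lebesgue2 R).
Notation Q := (@fundamental_square R).

(** The equation holds between distributions; [fourier_cubic] identifies the
    coefficients of its right-hand side. *)
Lemma H1_solution_nls : H1_solution u -> nls (fun t => fourier (u t)).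
Proof.
move=> [[uH uc] ud]; have uA t : exists A, inh1 (fourier (u t)) A.
  by have [_ h] := uH t; exact: sobolev_fin_inh1.
split => // [t0 e e0|t n].
  exact: (sobolev_cvg_inh1 (uc t0) e0).
have [ut [utd eqn]] := ud t; have [uL _] := uH t; have [A aA] := uA t.
have utE : ut n = 'i%C * (cub (fourier (u t)) n + (freq2 n)%:C%C * fourier (u t) n).
  have := eqn n; rewrite (fourier_cubic n uL aA) /laplacian => <-.
  have -> : 'i%C * (- 'i%C * ut n + - (freq2 n)%:C%C * fourier (u t) n + (freq2 n)%:C%C * fourier (u t) n) =
    - ('i%C * 'i%C) * ut n by ring.
  have -> : 'i%C * 'i%C = -1 :> R[i] by simpc.
  by rewrite opprK mul1r.
have key (p : R[i] -> R) : (forall x y, p (x - y) = p x - p y) ->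
    (forall (k : R) x, p (k%:C%C * x) = k * p x) -> (forall x, `|p x| <= modulus x) ->
    is_derive t (1 : R) (fun s => p (fourier (u s) n)) (p (ut n)).
  move=> pB pZ pM.
  have lim : (fun h => h^-1 *: (p (fourier (u (h *: (1 : R) + t)) n) - p (fourier (u t) n))) @ (0 : R)^' --> p (ut n).
    apply/cvgrPdist_le => e e0.
    apply: (@filterS _ _ (dnbhs_filter (0 : R)) _ _ _ (sobolev_cvg_mode utd n e0)) => h.
    rewrite distrC /GRing.scale /= mulr1 [h + t]addrC -pB -pZ -pB.
    exact: le_trans (pM _).
  have dE : derivable (fun s => p (fourier (u s) n)) t 1 by apply/cvg_ex; exists (p (ut n)).
  by apply: DeriveDef => //; exact: cvg_lim lim.
rewrite -utE; split; apply: key.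
- by move=> [? ?] [].
- by move=> k [? ?] /=; rewrite mul0r subr0.
- exact: Re_le_modulus.
- by move=> [? ?] [].
- by move=> k [? ?] /=; rewrite mul0r addr0.
- exact: Im_le_modulus.
Qed.

Lemma scatters_asymptotic : scatters_modulo_phases u ->
  exists a A, inh1 a A /\ asymptotic (fun t => fourier (u t)) (fun t => free_propagator t a).
Proof.
move=> [up [theta [[_ upH] lim]]]; have [A aA] := sobolev_fin_inh1 upH.
exists (fourier up), A; split => // e e0.
have [M [_ HM]] := sobolev_cvg_inh1 lim e0.
by exists (M + 1) => t tM; exists (theta t); apply: HM; lra.
Qed.

(** Uniqueness holds on the square, and periodicity spreads it to the plane. *)
Lemma single_mode_ae f n (k : R[i]) : inL2 f -> fourier f n = k ->
  (forall m, m != n -> fourier f m = 0) -> {ae mu, forall x, f x = k * wave n x}.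
Proof.
move=> fL fn f0.
pose c m := if m == n then k else 0.
have gE : trig [:: n] c = fun x => k * wave n x.
  by apply/funext => x; rewrite /trig big_seq1 /c eqxx.
have c0 m : m \notin [:: n] -> c m = 0 by rewrite inE /c => /negPf ->.
have fg m : fourier f m = fourier (trig [:: n] c) m.
  rewrite (fourier_trig m _ c0)// /c; have [->//|mn] := eqVneq m n; exact: f0.
have mg := mfun_trig [:: n] c; have gi := trig_cqint [:: n] c.
have mf := inL2_cmfun fL.
have ae := fourier_inj mf mg (inL2_cqint fL) gi fg; rewrite gE in ae mg.
have pd : periodic2 (fun x => f x - k * wave n x).
  have [pf _ _ _] := fL => x y; have [-> ->] := pf x y.
  have w1 : wave n (x + 2 * pi, y) = wave n (x, y).
    rewrite /wave -(cis_periodic (dotp n (x, y)) n.1); congr cis; rewrite /dotp /=; ring.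
  have w2 : wave n (x, y + 2 * pi) = wave n (x, y).
    rewrite /wave -(cis_periodic (dotp n (x, y)) n.2); congr cis; rewrite /dotp /=; ring.
  by rewrite w1 w2.
have := ae_periodic (cmfunB mf mg) pd; have h : {ae mu, forall x, Q x -> f x - k * wave n x = 0}.
  by move: ae; apply: ae_imp => x e Qx; rewrite e// subrr.
move=> /(_ h); apply: ae_imp => x /eqP; rewrite subr_eq0 => /eqP; exact.
Qed.

End Bridge.

Theorem theorem5p1 (R : realType) (u : R -> R * R -> R[i])
  (u_sol : H1_solution u) (u_scat : scatters_modulo_phases u) :
  exists (A kappa : R) (n : int * int),
    0 <= A /\
    forall t : R, {ae @lebesgue2 R, forall x : R * R,
      u t x = A%:C%C * cis kappa * cis (dotp n x) * cis (freq2 n * t)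
                * cis (`|A| ^+ 2 * t)}.
Proof.
have vn := H1_solution_nls u_sol; have [a [B [aB va]]] := scatters_asymptotic u_scat.
have [n0 an0] := asymptotic_single_mode vn aB va.
have v0 := asymptotic_rigidity vn aB va an0.
have [y hy] := polar (fourier (u 0) n0).
exists (modulus (fourier (u 0) n0)), y, n0; split; first exact: modulus_ge0.
move=> t; have [[uH _] _] := u_sol; have [uL _] := uH t.
have := single_mode_ae uL (single_mode_solution t vn v0) (fun m => v0 t m).
apply: ae_imp => x ->; rewrite {1}hy ger0_norm ?modulus_ge0// /wave.
rewrite [freq2 n0 * t]mulrC [_ ^+ 2 * t]mulrC mulrDr cisD; ring.
Qed.
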